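(* Up to isomorphism, the set of forbidden minors of the class of free-planar graphs consists of exactly the two graphs $K_5^-$ and $K_{3,3}^-$: $$F(Free(Planar)) = \{K_5^-, K_{3,3}^-\}.$$
   Context: Graphs are finite and simple, considered up to isomorphism. $H$ is a minor of $G$, written $H \prec G$, if $H$ can be obtained from $G$ by vertex deletions, edge deletions and edge contractions (every graph is a minor of itself). For a minor closed class $A$ of graphs, $F(A)$ is its set of forbidden minors, i.e. the set of minor-minimal graphs not in $A$: graphs $G \notin A$ such that every $H \notin A$ with $H \prec G$ satisfies $H \cong G$. A planar graph $G$ is called free-planar if for every pair $e$ of distinct non-adjacent vertices of $G$ the graph $G+e$, obtained by adding $e$ as an edge, is again planar; $Free(Planar)$ is the (minor closed) class of free-planar graphs. $K_5^-$ and $K_{3,3}^-$ are the graphs obtained from $K_5$ and $K_{3,3}$, respectively, by deleting one edge. *)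

(* Defs.v *)
From HB Require Import structures.
From mathcomp Require Import all_boot all_order all_algebra.
From mathcomp Require Import all_classical all_reals all_analysis.
Import Order.TTheory GRing.Theory Num.Theory numFieldNormedType.Exports.

Set Implicit Arguments.
Unset Strict Implicit.
Unset Printing Implicit Defensive.

Record sgraph := SGraph {
  vertex :> finType;
  edge : rel vertex;
  edge_sym : symmetric edge;
  edge_irrefl : irreflexive edge }.

Arguments edge {s}.

Definition isomorphic (G H : sgraph) : Prop :=
  exists2 f : G -> H, bijective f & forall x y, edge (f x) (f y) = edge x y.

Definition same_pair (T : eqType) (x y u v : T) : bool :=
  (x == u) && (y == v) || (x == v) && (y == u).

Lemma same_pairC (T : eqType) (x y u v : T) :
  same_pair x y u v = same_pair y x u v.
Proof. by rewrite /same_pair orbC (andbC (y == v)) (andbC (y == u)). Qed.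

Section Operations.
Variable G : sgraph.
Implicit Types u v : G.

Section DeleteVertex.
Variable v : G.
Let edge' : rel {x : G | x != v} := fun x y => edge (val x) (val y).
Fact del_vertex_sym : symmetric edge'.
Proof. by move=> x y; exact: edge_sym. Qed.
Fact del_vertex_irrefl : irreflexive edge'.
Proof. by move=> x; exact: edge_irrefl. Qed.
Definition del_vertex := SGraph del_vertex_sym del_vertex_irrefl.
End DeleteVertex.

Section DeleteEdge.
Variables u v : G.
Let edge' : rel G := fun x y => edge x y && ~~ same_pair x y u v.
Fact del_edge_sym : symmetric edge'.
Proof. by move=> x y; rewrite /edge' edge_sym same_pairC. Qed.
Fact del_edge_irrefl : irreflexive edge'.
Proof. by move=> x; rewrite /edge' edge_irrefl. Qed.
Definition del_edge := SGraph del_edge_sym del_edge_irrefl.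
End DeleteEdge.

(* The guard x != y only makes the operation total: it is used for u != v. *)
Section AddEdge.
Variables u v : G.
Let edge' : rel G := fun x y => edge x y || (x != y) && same_pair x y u v.
Fact add_edge_sym : symmetric edge'.
Proof. by move=> x y; rewrite /edge' edge_sym same_pairC eq_sym. Qed.
Fact add_edge_irrefl : irreflexive edge'.
Proof. by move=> x; rewrite /edge' edge_irrefl eqxx. Qed.
Definition add_edge := SGraph add_edge_sym add_edge_irrefl.
End AddEdge.

(* v is merged into u, which inherits its neighbours; loops and parallel edges
   are suppressed.  Meant for adjacent u and v. *)
Section Contract.
Variables u v : G.
Let edge' : rel {x : G | x != v} := fun x y =>
  (x != y) && [|| edge (val x) (val y),
                  (val x == u) && edge v (val y) |
                  (val y == u) && edge v (val x)].
Fact contract_sym : symmetric edge'.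
Proof.
by move=> x y; rewrite /edge' eq_sym edge_sym; congr (_ && (_ || _)); rewrite orbC.
Qed.
Fact contract_irrefl : irreflexive edge'.
Proof. by move=> x; rewrite /edge' eqxx. Qed.
Definition contract_edge := SGraph contract_sym contract_irrefl.
End Contract.

End Operations.

Arguments del_vertex {G} v.
Arguments del_edge {G} u v.
Arguments add_edge {G} u v.
Arguments contract_edge {G} u v.

(* minor H G : H is a minor of G. *)
Inductive minor (H : sgraph) : sgraph -> Prop :=
| minor_iso (G : sgraph) : isomorphic H G -> minor H G
| minor_del_vertex (G : sgraph) (v : G) : minor H (del_vertex v) -> minor H G
| minor_del_edge (G : sgraph) (u v : G) :
    edge u v -> minor H (del_edge u v) -> minor H G
| minor_contract_edge (G : sgraph) (u v : G) :
    edge u v -> minor H (contract_edge u v) -> minor H G.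

Definition forbidden_minor (A : sgraph -> Prop) (G : sgraph) : Prop :=
  ~ A G /\ forall H, ~ A H -> minor H G -> isomorphic H G.

Definition free_class (A : sgraph -> Prop) (G : sgraph) : Prop :=
  A G /\ forall u v : G, u != v -> ~~ edge u v -> A (add_edge u v).

Local Open Scope classical_set_scope.
Local Open Scope ring_scope.

(* A drawing of G in the plane: vertices are distinct points p x, and an edge xy
   is a simple arc c x y : [0, 1] -> R^2 from p x to p y whose interior avoids
   all vertices and the interiors of all other arcs.  Arcs are indexed by
   ordered pairs, c y x being c x y run backwards; the values of c on
   non-adjacent pairs and outside [0, 1] are irrelevant. *)
Record plane_drawing (R : realType) (G : sgraph)
    (p : G -> R * R) (c : G -> G -> R -> R * R) : Prop := PlaneDrawing {
  drawing_inj : injective p;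
  drawing_continuous : forall x y, edge x y ->
    {within `[0, 1], continuous (c x y)};
  drawing_simple : forall x y, edge x y -> {in `[0, 1] &, injective (c x y)};
  drawing_start : forall x y, edge x y -> c x y 0 = p x;
  drawing_end : forall x y, edge x y -> c x y 1 = p y;
  drawing_rev : forall x y, edge x y ->
    {in `[0, 1], forall t, c y x t = c x y (1 - t)};
  drawing_vertex : forall x y z, edge x y ->
    {in `]0, 1[, forall t, c x y t <> p z};
  drawing_disjoint : forall x y x' y', edge x y -> edge x' y' ->
    ~~ same_pair x y x' y' ->
    {in `]0, 1[ &, forall s t, c x y s <> c x' y' t} }.

Definition planar (R : realType) (G : sgraph) : Prop :=
  exists p c, @plane_drawing R G p c.

Section ConcreteGraphs.

Fact complete_sym n : symmetric (fun x y : 'I_n => x != y).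
Proof. by move=> x y; rewrite eq_sym. Qed.
Fact complete_irrefl n : irreflexive (fun x y : 'I_n => x != y).
Proof. by move=> x; rewrite eqxx. Qed.
Definition complete_graph n := SGraph (@complete_sym n) (@complete_irrefl n).

Let bipartite_edge m n : rel ('I_m + 'I_n) := fun x y =>
  match x, y with inl _, inr _ | inr _, inl _ => true | _, _ => false end.
Fact complete_bipartite_sym m n : symmetric (@bipartite_edge m n).
Proof. by case=> x [] y. Qed.
Fact complete_bipartite_irrefl m n : irreflexive (@bipartite_edge m n).
Proof. by case. Qed.
Definition complete_bipartite m n :=
  SGraph (@complete_bipartite_sym m n) (@complete_bipartite_irrefl m n).

End ConcreteGraphs.

Definition K5_minus : sgraph :=
  del_edge (G := complete_graph 5) ord0 ord_max.

Definition K33_minus : sgraph :=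
  del_edge (G := complete_bipartite 3 3) (inl ord0) (inr ord0).

(* Main.v *)
(** Adding the missing edge to K5^- or K33^- gives K5 or K33, which are not
planar: for disjoint arcs uv and xy the half turns of c_xy(t) - c_uv(s) along the
boundary of the unit square add up to 0, and modulo 2 those along one side only
depend on the directions between vertices; the sum over all pairs of disjoint
edges is odd, a contradiction.

Conversely, if G has neither minor then for all a <> b the graph G + ab has a
realizer: three orders of the vertices such that every vertex beats both ends of
any edge avoiding it in one of them. A realizer gives a point of R^3 for every
vertex, and projecting along (1, 1, 1) gives a drawing, where the edge uv passes
through the coordinatewise maximum of u and v. The realizer is found by induction.
If a set Y of vertices other than a and b, and not all of them, has at most two
neighbours x and y, the realizers of G - Y + xy and of G[Y + x + y] + xy are glued
along xy. Otherwise an induced path from a to b is set aside, and the rest is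
drawn from the outside in, ear by ear, each time keeping the remaining part
connected; whenever this is impossible, K33^- or K5^- shows up as a minor. *)
Require Import Defs.
From mathcomp Require Import all_boot fingroup perm.
From mathcomp Require Import zify.

Set Implicit Arguments.
Unset Strict Implicit.
Unset Printing Implicit Defensive.

(** * Connectivity and models of minors *)

(** The induction is about G + ab, not G: for arbitrary a and b this is already free-planarity, and
    since the drawing must carry ab while the minors are sought in G alone, the obstructions come
    out one edge short of K5 and K33.

    Gluing forces ab to be extreme in the three orders ([rooted]): the realizer of the separated
    part is shrunk to the bend of xy in the other drawing, and its orders agree with those of x and
    y there only if x and y are minimal in the right coordinates.

    Without small separators the obstacle is that an ear buries the stretch of boundary between its
    feet, which is harmless only if nothing buried still has undrawn neighbours. The reserved path
    runs from the first live boundary vertex to b through undrawn vertices, so both ends of the live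
    boundary stay attached to the undrawn part, and a buried attachment would interlace with the
    feet of the ear. Connectivity of the complement of the path settles the remaining case, an ear
    whose feet are the two ends. *)

Section Connectivity.
Variables (V : finType) (E : rel V).
Hypothesis Esym : symmetric E.
Implicit Types (A B D P Y : {set V}) (x y z : V) (s : seq V).

Definition adj A B := [exists x in A, exists y in B, E x y].

Lemma adjP A B : reflect (exists x y, [/\ x \in A, y \in B & E x y]) (adj A B).
Proof.
apply: (iffP exists_inP) => [[x xA /exists_inP[y yB xy]]|[x [y [xA yB xy]]]].
  by exists x, y.
by exists x => //; apply/exists_inP; exists y.
Qed.

Lemma adj_sym A B : adj A B = adj B A.
Proof.
by apply/adjP/adjP => -[x [y [xA yB xy]]]; exists y, x; rewrite Esym.
Qed.

Lemma adjS A A' B B' : A \subset A' -> B \subset B' -> adj A B -> adj A' B'.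
Proof.
move=> /subsetP sA /subsetP sB /adjP[x [y [xA yB xy]]].
by apply/adjP; exists x, y; rewrite sA ?sB.
Qed.

Lemma adj_intro x y A B : E x y -> x \in A -> y \in B -> adj A B.
Proof. by move=> xy xA yB; apply/adjP; exists x, y. Qed.

(** Connectivity of the induced subgraph, expressed by cuts rather than paths, so that an edge
    leaving a given part ([conn_cut]) is available without choosing a path. *)
Definition conn D := (D != set0) &&
  [forall P : {set V}, (P \subset D) && (P != set0) && ~~ adj P (D :\: P)
     ==> (P == D)].

Lemma connP D : reflect (D != set0 /\ forall P, P \subset D -> P != set0 ->
  ~~ adj P (D :\: P) -> P = D) (conn D).
Proof.
apply: (iffP andP) => -[D0 H]; split=> //.
  move=> P PD P0 nadj; apply/eqP.
  by move/forallP/(_ P): H; rewrite PD P0 nadj.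
apply/forallP => P; apply/implyP => /andP[/andP[PD P0] nadj].
by apply/eqP/H.
Qed.

Lemma conn_neq0 D : conn D -> D != set0.
Proof. by case/andP. Qed.

Lemma conn1 x : conn [set x].
Proof.
apply/connP; split; first by apply/set0Pn; exists x; rewrite inE.
move=> P; rewrite subset1 => /orP[/eqP-> //|/eqP->]; by rewrite eqxx.
Qed.

Lemma conn_cut D P x y : conn D -> P \subset D -> x \in P -> y \in D ->
  y \notin P -> adj P (D :\: P).
Proof.
move=> /connP[_ cD] PD xP yD yP; apply: contraT => nadj.
have P0 : P != set0 by apply/set0Pn; exists x.
by move: yP; rewrite (cD P PD P0 nadj) yD.
Qed.

Lemma connU A B : conn A -> conn B -> adj A B -> conn (A :|: B).
Proof.
move=> cA cB /adjP[a [b [aA bB ab]]]; apply/connP; split.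
  by apply/set0Pn; exists a; rewrite inE aA.
move=> P PAB /set0Pn[p pP] nadj.
have half D : conn D -> D \subset A :|: B -> forall x, x \in P -> x \in D ->
    D \subset P.
  move=> cD sD x xP xD; apply/subsetP => y yD; apply: contraT => yP.
  case/negP: nadj.
  have xPD : x \in P :&: D by rewrite inE xP.
  have yPD : y \notin P :&: D by rewrite inE (negbTE yP).
  apply: adjS (conn_cut cD (subsetIr _ _) xPD yD yPD); first exact: subsetIl.
  apply/subsetP => z; rewrite !inE => /andP[nz zD].
  by have := subsetP sD z zD; rewrite !inE zD andbT in nz * => ->; rewrite nz.
have sA := half A cA (subsetUl _ _); have sB := half B cB (subsetUr _ _).
have cross x y : x \in P -> y \in A :|: B -> E x y -> y \in P.
  move=> xP yAB xy; apply: contraT => yP; case/negP: nadj.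
  by apply: (adj_intro xy) => //; rewrite inE yP.
have [/subsetP AP|] := boolP (A \subset P).
  apply/eqP; rewrite eqEsubset PAB subUset; apply/and3P; split=> //.
    exact/subsetP.
  apply: (sB b) => //; apply: (cross a) => //; first exact: AP.
  by rewrite inE bB orbT.
move=> /negP nA; case: nA.
have pAB : p \in A :|: B by move/subsetP: PAB; apply.
move: pAB; rewrite inE => /orP[pA|pB]; first exact: (sA p).
have bP : b \in P by move/subsetP: (sB p pP pB); apply.
by apply: (sA a) => //; apply: (cross b); rewrite ?inE ?aA // Esym.
Qed.

Lemma connU1 A x y : conn A -> y \in A -> E x y -> conn (x |: A).
Proof. by move=> cA yA xy; apply: connU (conn1 x) cA (adj_intro xy _ yA); rewrite inE. Qed.

Lemma component D y : y \in D ->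
  exists Y, [/\ Y \subset D, y \in Y, conn Y & ~~ adj Y (D :\: Y)].
Proof.
move=> yD.
pose Q (Y : {set V}) := [&& Y \subset D, y \in Y & conn Y].
have Q0 : Q [set y] by rewrite /Q sub1set yD inE eqxx conn1.
case: (@arg_maxnP _ [set y] Q (fun Y => #|Y|) Q0) => Y /and3P[YD yY cY] maxY.
exists Y; split=> //; apply/adjP => -[x [z [xY]]]; rewrite inE => /andP[zY zD xz].
have := maxY (z |: Y); rewrite /Q subUset sub1set zD YD inE yY orbT /=.
rewrite (connU1 cY xY) 1?Esym // => /(_ isT); rewrite cardsU1 zY; lia.
Qed.

Lemma conn_path x s : path E x s -> conn [set z in x :: s].
Proof.
elim: s x => [|y s IHs] x /=; first by rewrite set_cons set_nil setU0 conn1.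
case/andP=> xy /IHs cs; rewrite set_cons; apply: (connU1 cs _ xy).
by rewrite !inE eqxx.
Qed.

Lemma path_of_conn D x y : conn D -> x \in D -> y \in D ->
  exists s, [/\ path E x s, last x s = y, uniq (x :: s) & {subset x :: s <= D}].
Proof.
move=> cD xD yD.
pose r := [rel u v | [&& u \in D, v \in D & E u v]].
have : connect r x y.
  pose P := [set z in D | connect r x z].
  have sPD : P \subset D by apply/subsetP => z; rewrite inE => /andP[].
  have xP : x \in P by rewrite inE xD connect0.
  apply: contraT => nxy.
  have yP : y \notin P by rewrite inE (negbTE nxy) andbF.
  have /adjP[u [v [uP vP uv]]] := conn_cut cD sPD xP yD yP.
  move: uP vP; rewrite !inE => /andP[uD xu] /andP[+ vD]; rewrite vD /= => /negP[].
  by apply: (connect_trans xu); apply: connect1; rewrite /= uD vD.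
case/connectP => p pth ->; case/shortenP: pth => q pq uq _.
exists q; split=> //.
  by apply: sub_path pq => u v /and3P[].
move=> z; rewrite inE => /orP[/eqP-> //|zq].
elim: q x {xD uq} pq zq => //= v q IH x /andP[/and3P[_ vD _] pq].
by rewrite inE => /orP[/eqP->|] //; apply: IH pq.
Qed.

End Connectivity.

Section Models.
Variable V : finType.
Implicit Types (E : rel V) (A B D P Y S : {set V}) (x y z : V).

(** A part of [D] that misses [z] is traded for its complement in [D], which by symmetry of [E] has
    no edge out of it either. *)
Lemma conn_root E D z : symmetric E -> z \in D ->
  (forall P, P \subset D -> z \in P -> ~~ adj E P (D :\: P) -> P = D) ->
  conn E D.
Proof.
move=> Esym zD H; apply/connP; split; first by apply/set0Pn; exists z.
move=> P PD P0 nadj; have [zP|zP] := boolP (z \in P); first exact: H.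
have /setP DPD : D :\: P = D.
  apply: H; rewrite ?subsetDl ?inE ?zP //.
  by rewrite setDDr setDv set0U (setIidPr PD) adj_sym.
case/set0Pn: P0 => p pP; have := DPD p.
by rewrite inE pP (subsetP PD p pP).
Qed.

Lemma sub_conn E E' D : {in D &, forall x y, E x y -> E' x y} ->
  conn E D -> conn E' D.
Proof.
move=> sE /connP[D0 H]; apply/connP; split=> // P PD P0 nadj.
apply: H => //; apply: contra nadj => /adjP[x [y [xP]]]; rewrite inE => /andP[yP yD xy].
apply: (@adj_intro _ _ x y) => //; last by rewrite inE yP.
by apply: sE => //; apply: (subsetP PD).
Qed.

(** Branch sets inside a fixed vertex type: passing to a subgraph only changes [E] and [S]. The link
    with the inductive [minor] is [model_minor]. *)
Definition model (T : finType) (e : rel T) E S := exists D : T -> {set V},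
  [/\ forall p, D p \subset S, forall p, conn E (D p),
      forall p q, p != q -> [disjoint D p & D q] &
      forall p q, e p q -> adj E (D p) (D q)].

Definition k33m : rel ('I_3 + 'I_3) := fun p q =>
  match p, q with
  | inl i, inr j | inr j, inl i => (i != ord0) || (j != ord0)
  | _, _ => false
  end.

Definition k5m : rel 'I_5 := fun i j =>
  (i != j) && ~~ ((i == ord0) && (j == ord_max) || (i == ord_max) && (j == ord0)).

Definition minor_free E S := ~ model k33m E S /\ ~ model k5m E S.

(** The pair without an adjacency hypothesis, [x0] and [y0], stands for the deleted edge of
    K33^-. *)
Lemma k33_of_sets E S (x0 x1 x2 y0 y1 y2 : {set V}) : symmetric E ->
  all (fun D => conn E D && (D \subset S)) [:: x0; x1; x2; y0; y1; y2] ->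
  pairwise (fun A B : {set V} => [disjoint A & B]) [:: x0; x1; x2; y0; y1; y2] ->
  adj E x0 y1 -> adj E x0 y2 -> adj E x1 y0 -> adj E x1 y1 -> adj E x1 y2 ->
  adj E x2 y0 -> adj E x2 y1 -> adj E x2 y2 -> model k33m E S.
Proof.
move=> Esym cS dis a01 a02 a10 a11 a12 a20 a21 a22.
pose xs := [:: x0; x1; x2]; pose ys := [:: y0; y1; y2].
exists (fun p : 'I_3 + 'I_3 => match p with inl i => nth set0 xs i | inr j => nth set0 ys j end).
have mem_cS D : D \in xs ++ ys -> conn E D && (D \subset S).
  by move=> Dxy; apply: (allP cS).
have mem3 (s : seq {set V}) (i : 'I_3) : size s = 3 -> nth set0 s i \in s.
  by move=> s3; rewrite mem_nth // s3.
split.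
- by case=> i; apply: (andP (mem_cS _ _)).2; rewrite mem_cat mem3 ?orbT.
- by case=> i; apply: (andP (mem_cS _ _)).1; rewrite mem_cat mem3 ?orbT.
- rewrite /= !andbT -!andbA in dis.
  do !case/andP: dis => ? dis.
  by case=> -[[|[|[|//]]] ?]; case=> -[[|[|[|//]]] ?] //= _; rewrite // disjoint_sym.
- by case=> -[[|[|[|//]]] ?]; case=> -[[|[|[|//]]] ?] //= _; rewrite // adj_sym.
Qed.

(** Here [x0] and [x4] take the places of the two nonadjacent vertices of K5^-. *)
Lemma k5_of_sets E S (x0 x1 x2 x3 x4 : {set V}) : symmetric E ->
  all (fun D => conn E D && (D \subset S)) [:: x0; x1; x2; x3; x4] ->
  pairwise (fun A B : {set V} => [disjoint A & B]) [:: x0; x1; x2; x3; x4] ->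
  adj E x0 x1 -> adj E x0 x2 -> adj E x0 x3 -> adj E x1 x2 -> adj E x1 x3 ->
  adj E x1 x4 -> adj E x2 x3 -> adj E x2 x4 -> adj E x3 x4 -> model k5m E S.
Proof.
move=> Esym cS dis a01 a02 a03 a12 a13 a14 a23 a24 a34.
pose xs := [:: x0; x1; x2; x3; x4].
exists (fun p : 'I_5 => nth set0 xs p).
have mem5 (i : 'I_5) : nth set0 xs i \in xs by rewrite mem_nth.
split.
- by move=> i; case/andP: (allP cS _ (mem5 i)).
- by move=> i; case/andP: (allP cS _ (mem5 i)).
- rewrite /= !andbT -!andbA in dis.
  do !case/andP: dis => ? dis.
  by case=> -[|[|[|[|[|//]]]]] ?; case=> -[|[|[|[|[|//]]]]] ? //= _;
    rewrite // disjoint_sym.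
- by case=> -[|[|[|[|[|//]]]]] ?; case=> -[|[|[|[|[|//]]]]] ? //= _;
    rewrite // adj_sym.
Qed.

Lemma model_sub (T : finType) (e : rel T) E E' S S' : S' \subset S ->
  {in S' &, forall x y, E' x y -> E x y} -> model e E' S' -> model e E S.
Proof.
move=> SS sE [D [DS cD dD aD]]; exists D; split=> // [p|p|p q epq].
- exact: subset_trans SS.
- apply: sub_conn (cD p) => x y xD yD; apply: sE; exact: (subsetP (DS p)).
- have /adjP[x [y [xD yD xy]]] := aD p q epq.
  apply: (adj_intro _ xD yD); apply: sE => //; first exact: (subsetP (DS p)).
  exact: (subsetP (DS q)).
Qed.

Lemma minor_free_sub E E' S S' : S' \subset S ->
  {in S' &, forall x y, E' x y -> E x y} -> minor_free E S -> minor_free E' S'.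
Proof. by move=> SS sE [f1 f2]; split=> /(model_sub SS sE). Qed.

Definition add_edge_rel E u v : rel V :=
  fun x y => E x y || (x == u) && (y == v) || (x == v) && (y == u).

Lemma add_edge_rel_sym E u v : symmetric E -> symmetric (add_edge_rel E u v).
Proof.
move=> Esym x y; rewrite /add_edge_rel Esym.
by case: (E y x) => //=; rewrite orbC andbC (andbC (y == v)).
Qed.

(* Contracting Y onto x realizes the edge xy. *)
Lemma model_contract (T : finType) (e : rel T) E S S' Y x y : symmetric E ->
  S' \subset S -> Y \subset S -> [disjoint Y & S'] -> conn E Y ->
  x \in S' -> y \in S' -> adj E Y [set x] -> adj E Y [set y] ->
  model e (add_edge_rel E x y) S' -> model e E S.
Proof.
move=> Esym SS YS dY cY xS yS /adjP[yx [_ [yxY /set1P-> xY]]].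
move=> /adjP[yy [_ [yyY /set1P-> yY]]] [D [DS cD dD aD]].
have YD p z : z \in Y -> z \in D p = false.
  move=> zY; apply: contraFF (disjointFr dY zY); exact: (subsetP (DS p)).
exists (fun p => if x \in D p then Y :|: D p else D p); split=> [p|p|p q pq|p q epq].
- by case: ifP => _; rewrite ?subUset ?YS (subset_trans (DS p)).
- case: ifPn => xD; last first.
    apply: sub_conn (cD p) => u v uD vD; rewrite /add_edge_rel.
    case/orP=> [/orP[//|]|] /andP[/eqP eu /eqP ev].
      by rewrite -eu uD in xD.
    by rewrite -ev vD in xD.
  apply: (@conn_root E _ yx) => //; first by rewrite inE yxY.
  move=> P PD yxP nadj.
  have YP : Y \subset P.
    apply/subsetP => z zY; apply: contraT => zP.
    have yxPY : yx \in P :&: Y by rewrite inE yxP.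
    have zPY : z \notin P :&: Y by rewrite inE (negbTE zP).
    case/negP: nadj; apply: adjS (conn_cut cY (subsetIr _ _) yxPY zY zPY).
      exact: subsetIl.
    apply/subsetP => t; rewrite !inE => /andP[nt tY].
    by rewrite tY andbT in nt; rewrite nt tY.
  have nE u v : u \in P -> v \in Y :|: D p -> E u v -> v \in P.
    move=> uP vD uv; apply: contraT => vP; case/negP: nadj.
    by apply: (adj_intro uv) => //; rewrite inE vP.
  have xP : x \in P by apply: (nE yx) => //; rewrite inE xD orbT.
  have DP : P :&: D p = D p.
    case/connP: (cD p) => _; apply; first exact: subsetIr.
      by apply/set0Pn; exists x; rewrite inE xP.
    apply/adjP => -[u [v []]]; rewrite !inE => /andP[uP uD] /andP[nvP vD].
    rewrite vD andbT in nvP; case/orP=> [/orP[uv|]|] .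
    + by case/negP: nvP; apply: (nE u) => //; rewrite inE vD orbT.
    + case/andP=> _ /eqP ev; case/negP: nvP; apply: (nE yy).
      * exact: (subsetP YP).
      * by rewrite inE vD orbT.
      * by rewrite ev.
    + by case/andP=> _ /eqP ev; case/negP: nvP; rewrite ev.
  apply/eqP; rewrite eqEsubset PD subUset YP /=.
  by rewrite -{1}DP subsetIl.
- have dis := dD p q pq.
  have YDd r : [disjoint Y & D r].
    by apply/pred0P => z /=; apply/negP => /andP[zY]; rewrite YD.
  case: ifPn => xp; case: ifPn => xq //.
  + by have := disjointFr dis xp; rewrite xq.
  + by rewrite disjoints_subset subUset -!disjoints_subset YDd.
  + by rewrite disjoint_sym disjoints_subset subUset -!disjoints_subset YDd disjoint_sym.
- have lift r : D r \subset (if x \in D r then Y :|: D r else D r).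
    by case: ifP => _ //; rewrite subsetUr.
  have /adjP[u [v [uD vD]]] := aD p q epq.
  case/orP=> [/orP[uv|]|] .
  + by apply: (adj_intro uv); apply: (subsetP (lift _)).
  + case/andP=> /eqP eu /eqP ev; apply: (adj_intro yY); last first.
      by apply: (subsetP (lift _)); rewrite -ev.
    by rewrite -eu uD inE yyY.
  + case/andP=> /eqP eu /eqP ev; apply: (@adj_intro _ _ y yy); first by rewrite Esym.
      by apply: (subsetP (lift _)); rewrite -eu.
    by rewrite -ev vD inE yyY.
Qed.

Lemma minor_free_contract E S S' Y x y : symmetric E ->
  S' \subset S -> Y \subset S -> [disjoint Y & S'] -> conn E Y ->
  x \in S' -> y \in S' -> adj E Y [set x] -> adj E Y [set y] ->
  minor_free E S -> minor_free (add_edge_rel E x y) S'.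
Proof.
move=> Esym SS YS dY cY xS yS ax ay [f1 f2].
by split=> m; [apply: f1|apply: f2];
  exact: (model_contract Esym SS YS dY cY xS yS ax ay m).
Qed.

End Models.

(** * Realizers *)

Section Realizers.
Variable V : finType.
Implicit Types (E : rel V) (S : {set V}) (r : 'I_3 -> V -> nat) (a b u v w x y : V).

(* Three linear orders in the sense of Schnyder. *)
Definition realizer E S r :=
  (forall u v, u \in S -> v \in S -> u != v -> exists c, r c v < r c u) /\
  (forall u v w, u \in S -> v \in S -> w \in S -> E u v -> w != u -> w != v ->
     exists c, (r c u < r c w) && (r c v < r c w)).

(* Geometrically, ab lies on the outer face. *)
Definition rooted S a b r j :=
  (forall c w, c != j -> w \in S -> w != b -> r c b < r c w) /\
  (forall w, w \in S -> w != a -> r j a < r j w).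

Definition cert E S a b := exists r j,
  realizer (add_edge_rel E a b) S r /\ rooted S a b r j.

(** The conditions on a realizer are symmetric in the coordinates, so a transposition moves the
    special coordinate of [rooted] to any prescribed place. *)
Lemma cert_coord E S a b j : cert E S a b ->
  exists2 r, realizer (add_edge_rel E a b) S r & rooted S a b r j.
Proof.
case=> r [j' [[S1 S2] [R1 R2]]]; pose t := tperm j j'.
have tK c : t (t c) = c by exact: tpermK.
exists (fun c => r (t c)); split.
- by move=> u v uS vS uv; have [c lt] := S1 u v uS vS uv; exists (t c); rewrite tK.
- move=> u v w uS vS wS uv wu wv; have [c lt] := S2 u v w uS vS wS uv wu wv.
  by exists (t c); rewrite !tK.
- move=> c w cj wS wb; apply: R1 => //; apply: contra cj => /eqP ej.
  by rewrite -(tK c) ej /t tpermR.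
- by move=> w wS wa; rewrite /t tpermL; apply: R2.
Qed.

(** Lexicographic combination: the vertices of [S2] other than [u] and [v] are placed
    infinitesimally close to the coordinatewise maximum of [u] and [v] in [r1], the bend of the edge
    uv, and ordered there by [r2]. The hypotheses on [r1] say that this maximum is given by [v] in
    coordinate [j] and by [u] in the other two. *)
Lemma glue_coord E E1 E2 S1 S2 a b u v r1 j1 r2 j : u != v ->
  S1 :&: S2 = [set u; v] -> a \in S1 -> b \in S1 -> E1 u v -> E2 u v ->
  (forall x y, x \in S1 :|: S2 -> y \in S1 :|: S2 -> E x y ->
     [&& x \in S1, y \in S1 & E1 x y] || [&& x \in S2, y \in S2 & E2 x y]) ->
  realizer E1 S1 r1 -> rooted S1 a b r1 j1 ->
  realizer E2 S2 r2 -> rooted S2 u v r2 j ->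
  r1 j u < r1 j v -> (forall c, c != j -> r1 c v <= r1 c u) ->
  exists r, realizer E (S1 :|: S2) r /\ rooted (S1 :|: S2) a b r j1.
Proof.
move=> uv S12 aS1 bS1 e1uv e2uv EE [A1 A2] [R1 R2] [B1 B2] [Q1 Q2] ltj lec.
have inS12 x : x \in S1 -> x \in S2 -> (x == u) || (x == v).
  by move=> x1 x2; have := in_setI x S1 S2; rewrite S12 x1 x2 !inE.
have [uS1 uS2] : u \in S1 /\ u \in S2.
  by apply/andP; rewrite -in_setI S12 !inE eqxx.
have [vS1 vS2] : v \in S1 /\ v \in S2.
  by apply/andP; rewrite -in_setI S12 !inE eqxx orbT.
(* [ctr c x] is the end of uv whose [r1] value is the leading part of coordinate [c] for [x] in
   [S2]; [M] exceeds every value of [r2] on [S2], so [r] compares leading parts first. *)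
pose ctr c x := if c == j then (if x == u then u else v)
                else (if x == v then v else u).
pose M := (\sum_(z in S2) \sum_c r2 c z).+1.
have ltM c z : z \in S2 -> r2 c z < M.
  move=> zS; rewrite ltnS (bigD1 z) //= (bigD1 c) //= -addnA; exact: leq_addr.
pose base c x := if x \in S2 then r1 c (ctr c x) else r1 c x.
pose rho c x := if x \in S2 then r2 c x else 0.
have rhoM c x : rho c x < M by rewrite /rho; case: ifP => // /ltM.
pose r c x := M * base c x + rho c x.
have lt_base c x y : base c x < base c y -> r c x < r c y.
  move=> ltb; apply: (@leq_trans (M * base c y)); last exact: leq_addr.
  apply: (@leq_trans (M * (base c x).+1)); last by rewrite leq_mul2l ltb orbT.
  by rewrite /r mulnS (addnC M) ltn_add2l.
have le_base c x y : base c x <= base c y -> rho c x < rho c y -> r c x < r c y.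
  by move=> leb ltr; rewrite /r -addnS leq_add // leq_mul2l leb orbT.
have ctru c : ctr c u = u.
  by rewrite /ctr eqxx (negbTE uv) if_same.
have ctrv c : ctr c v = v.
  by rewrite /ctr eqxx (eq_sym v) (negbTE uv) if_same.
have base1 c x : x \in S1 -> base c x = r1 c x.
  move=> x1; rewrite /base; case: ifP => // x2.
  by case/orP: (inS12 x x1 x2) => /eqP->; rewrite ?ctru ?ctrv.
have base_le c x w : x \in S2 -> r1 c u < r1 c w -> r1 c v < r1 c w -> base c x < r1 c w.
  by move=> xS2 ltu ltv; rewrite /base xS2 /ctr; case: (c == j); case: ifP.
have base2 c x : x \in S2 -> x \notin S1 -> base c x = if c == j then r1 c v else r1 c u.
  move=> x2 x1; rewrite /base x2 /ctr.
  have xu : x != u by apply: contraNneq x1 => ->.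
  have xv : x != v by apply: contraNneq x1 => ->.
  by rewrite (negbTE xu) (negbTE xv); case: eqP => // ->.
have base_u c x w : x \in S2 -> x \notin S1 -> r1 c w < r1 c u -> r1 c w < base c x.
  move=> x2 x1 ltw; rewrite base2 //; case: eqP => // cj.
  by apply: (ltn_trans ltw); rewrite cj.
(* Leading parts cannot contradict [r2]: the only vertex of [S2] with a possibly smaller leading
   part is [u] in coordinate [j] and [v] in the others, and rootedness makes that vertex the minimum
   of [r2]. *)
have ord2 c x y : x \in S2 -> y \in S2 -> r2 c x < r2 c y -> r c x < r c y.
  move=> x2 y2 lt; apply: le_base; last by rewrite /rho x2 y2.
  rewrite /base x2 y2 /ctr; case: eqP => [cj|/eqP cj].
    case: (eqVneq y u) => [yu|_]; last by case: eqP => // _; rewrite cj ltnW.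
    rewrite yu cj in lt; case: (eqVneq x u) => // xu.
    by have := ltn_trans lt (Q2 x x2 xu); rewrite ltnn.
  case: (eqVneq y v) => [yv|_]; last by case: eqP => // _; exact: lec.
  rewrite yv in lt; case: (eqVneq x v) => // xv.
  by have := ltn_trans lt (Q1 c x cj x2 xv); rewrite ltnn.
have ord1 c x y : x \in S1 -> y \in S1 -> r1 c x < r1 c y -> r c x < r c y.
  by move=> x1 y1 lt; apply: lt_base; rewrite !base1.
have only2 x : x \in S1 :|: S2 -> x \notin S1 -> x \in S2.
  by rewrite inE => /orP[->|].
have only1 x : x \in S1 :|: S2 -> x \notin S2 -> x \in S1.
  by rewrite inE => /orP[|->].
have big w x : w \in S1 -> w \notin S2 -> x \in S2 ->
    exists c, forall x, x \in S2 -> r c x < r c w.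
  move=> w1 w2 x2; have wu : w != u by apply: contraNneq w2 => ->.
  have wv : w != v by apply: contraNneq w2 => ->.
  have [c /andP[ltu ltv]] := A2 u v w uS1 vS1 w1 e1uv wu wv.
  by exists c => y y2; apply: lt_base; rewrite (base1 c w) //; apply: base_le.
exists r; split; [split|split].
- move=> x y xS yS xy.
  have [x1|x1] := boolP (x \in S1); have [y1|y1] := boolP (y \in S1).
  + by have [c lt] := A1 x y x1 y1 xy; exists c; apply: ord1.
  + have y2 := only2 y yS y1; have [x2|x2] := boolP (x \in S2).
      by have [c lt] := B1 x y x2 y2 xy; exists c; apply: ord2.
    by have [c lt] := big x y x1 x2 y2; exists c; apply: lt.
  + have x2 := only2 x xS x1; have [y2|y2] := boolP (y \in S2).
      by have [c lt] := B1 x y x2 y2 xy; exists c; apply: ord2.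
    have uy : u != y by apply: contraNneq y2 => <-.
    have [c lt] := A1 u y uS1 y1 uy; exists c.
    by apply: lt_base; rewrite (base1 c y) //; apply: base_u.
  + have [c lt] := B1 x y (only2 x xS x1) (only2 y yS y1) xy.
    by exists c; apply: ord2 => //; apply: only2.
- move=> p q w pS qS wS pq wp wq.
  case/orP: (EE p q pS qS pq) => /and3P[p' q' epq].
    have [w1|w1] := boolP (w \in S1).
      have [c /andP[ltp ltq]] := A2 p q w p' q' w1 epq wp wq.
      by exists c; rewrite !ord1.
    have w2 := only2 w wS w1.
    (* In leading parts [w] lies weakly above both [u] and [v], so it beats pq as soon as one of
       them is not an end of pq. Otherwise pq is uv and [r2] decides. *)
    have byz z : z \in S1 -> z != p -> z != q ->
        (forall c, r1 c p < r1 c z -> r1 c q < r1 c z -> r1 c z <= base c w) ->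
        exists c, (r c p < r c w) && (r c q < r c w).
      move=> z1 zp zq H; have [c /andP[ltp ltq]] := A2 p q z p' q' z1 epq zp zq.
      have le := H c ltp ltq.
      by exists c; rewrite !lt_base // base1 // (leq_trans _ le).
    have leuw c : r1 c u <= base c w.
      by rewrite base2 //; case: eqP => // ->; exact: ltnW.
    have [up|up] := boolP ((u != p) && (u != q)).
      by case/andP: up => up uq; apply: (byz u) => // c _ _; exact: leuw.
    have [vp|vp] := boolP ((v != p) && (v != q)).
      case/andP: vp => vp vq; apply: (byz v) => // c _ _.
      by rewrite base2 //; case: eqP => // /eqP; exact: lec.
    have wu : w != u by apply: contraNneq w1 => ->.
    have wv : w != v by apply: contraNneq w1 => ->.
    have [c /andP[ltu ltv]] := B2 u v w uS2 vS2 w2 e2uv wu wv.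
    have ru : r c u < r c w by apply: ord2.
    have rv : r c v < r c w by apply: ord2.
    exists c; move: up vp; rewrite !negb_and !negbK.
    by move=> /orP[]/eqP<- /orP[]/eqP ev; move: uv; rewrite -?ev ?eqxx // ru rv.
  have [w2|w2] := boolP (w \in S2).
    have [c /andP[ltp ltq]] := B2 p q w p' q' w2 epq wp wq.
    by exists c; rewrite !ord2.
  have [c lt] := big w p (only1 w wS w2) w2 p'; exists c; by rewrite !lt.
- move=> c w cj wS wb; have [w1|w1] := boolP (w \in S1).
    by apply: ord1 => //; apply: R1.
  have w2 := only2 w wS w1; have [bu|bu] := eqVneq b u.
    have [cj'|cj'] := eqVneq c j.
      by apply: lt_base; rewrite base1 // bu base2 // cj' eqxx.
    have := R1 c v cj vS1; rewrite bu eq_sym uv => /(_ isT).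
    by rewrite ltnNge lec.
  by apply: lt_base; rewrite (base1 c b) //; apply: base_u => //; apply: R1; rewrite // eq_sym.
- move=> w wS wa; have [w1|w1] := boolP (w \in S1).
    by apply: ord1 => //; apply: R2.
  have w2 := only2 w wS w1; have [au|au] := eqVneq a u.
    have [cj'|cj'] := eqVneq j1 j.
      by apply: lt_base; rewrite base1 // au base2 // cj' eqxx.
    have := R2 v vS1; rewrite au eq_sym uv => /(_ isT).
    by rewrite ltnNge lec.
  by apply: lt_base; rewrite (base1 j1 a) //; apply: base_u => //; apply: R2; rewrite // eq_sym.
Qed.

(** With three coordinates, at least one of the two strict inequalities occurs exactly once; its
    coordinate becomes the [j] of [glue_coord]. *)
Lemma coord_split (f g : 'I_3 -> nat) :
  (exists c, f c < g c) -> (exists c, g c < f c) ->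
  (exists j, f j < g j /\ forall c, c != j -> g c <= f c) \/
  (exists j, g j < f j /\ forall c, c != j -> f c <= g c).
Proof.
case=> c ltc [d ltd].
have cd : c != d by apply: contraTneq ltc => ->; rewrite -leqNgt ltnW.
have [/existsP[e /andP[ed lte]]|/existsPn H] := boolP [exists e, (e != c) && (f e < g e)].
  right; exists d; split=> // i id; have [->|ic] := eqVneq i c; first exact: ltnW.
  suff -> : i = e by exact: ltnW.
  have de : d != e by apply: contraTneq ltd => ->; rewrite -leqNgt ltnW.
  move: cd id ic ed de; case: c d e i {ltc ltd lte} => [[|[|[|//]]] ?] [[|[|[|//]]] ?] [[|[|[|//]]] ?] [[|[|[|//]]] ?] //= *; exact: val_inj.
left; exists c; split=> // i ic; by have := H i; rewrite ic -leqNgt.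
Qed.

(** Which of [u] and [v] exceeds the other in a single coordinate depends on the realizer of [S1];
    hence certificates for both orientations of uv on [S2]. *)
Lemma glue E E1 E2 S1 S2 a b u v : u != v ->
  S1 :&: S2 = [set u; v] -> a \in S1 -> b \in S1 -> symmetric E1 ->
  add_edge_rel E1 a b u v ->
  (forall x y, x \in S1 :|: S2 -> y \in S1 :|: S2 -> E x y ->
     [&& x \in S1, y \in S1 & add_edge_rel E1 a b x y] ||
     [&& x \in S2, y \in S2 & E2 x y]) ->
  cert E1 S1 a b -> cert E2 S2 u v -> cert E2 S2 v u -> cert E (S1 :|: S2) a b.
Proof.
move=> uv S12 aS1 bS1 E1sym e1uv EE [r1 [j1 [C1 R1]]] cuv cvu.
have /andP[uS1 _] : (u \in S1) && (u \in S2) by rewrite -in_setI S12 !inE eqxx.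
have /andP[vS1 _] : (v \in S1) && (v \in S2).
  by rewrite -in_setI S12 !inE eqxx orbT.
have EE' p q E2' : (forall x y, E2 x y -> E2' x y) ->
    p \in S1 :|: S2 -> q \in S1 :|: S2 -> add_edge_rel E a b p q ->
    [&& p \in S1, q \in S1 & add_edge_rel E1 a b p q] ||
    [&& p \in S2, q \in S2 & E2' p q].
  move=> sE pS qS; rewrite {1}/add_edge_rel => /orP[/orP[pq|]|].
  - case/orP: (EE p q pS qS pq) => [->//|/and3P[-> -> /sE->]].
    by rewrite orbT.
  - by case/andP=> /eqP-> /eqP->; rewrite aS1 bS1 /add_edge_rel !eqxx !orbT.
  - by case/andP=> /eqP-> /eqP->; rewrite aS1 bS1 /add_edge_rel !eqxx !orbT.
have sub2 z t p q : E2 p q -> add_edge_rel E2 z t p q.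
  by rewrite /add_edge_rel => ->.
have added z t : add_edge_rel E2 z t z t by rewrite /add_edge_rel !eqxx orbT.
have vu : v != u by rewrite eq_sym.
have [C11 _] := C1.
have [[j [ltj lec]]|[j [ltj lec]]] :=
    coord_split (C11 v u vS1 uS1 vu) (C11 u v uS1 vS1 uv).
- have [r2 C2 R2] := cert_coord j cuv.
  have [r CR] := glue_coord uv S12 aS1 bS1 e1uv (added u v)
    (fun p q => @EE' p q _ (sub2 u v)) C1 R1 C2 R2 ltj lec.
  by exists r, j1.
- have [r2 C2 R2] := cert_coord j cvu.
  have e1vu : add_edge_rel E1 a b v u by rewrite add_edge_rel_sym.
  have S21 : S1 :&: S2 = [set v; u] by rewrite S12 setUC.
  have [r CR] := glue_coord vu S21 aS1 bS1 e1vu (added v u)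
    (fun p q => @EE' p q _ (sub2 v u)) C1 R1 C2 R2 ltj lec.
  by exists r, j1.
Qed.

(** * Drawings with a staircase boundary *)

Definition triple (f g h : V -> nat) : 'I_3 -> V -> nat :=
  fun c => match val c with 0 => f | 1 => g | _ => h end.

(* S is the part drawn so far, and L its outer boundary from a to b. *)
Record canon E S (L : seq V) a b (f g h : V -> nat) : Prop := Canon {
  canon_sub : {subset L <= S};
  canon_mono : pairwise (fun x y => (f y < f x) && (g x < g y)) L;
  canon_cover : forall w, w \in S ->
    exists2 m, m \in L & w = m \/ f m < f w /\ g m < g w;
  canon_realizer : realizer E S (triple f g h);
  canon_rooted : rooted S a b (triple f g h) (@Ordinal 3 1 isT) }.

(** The boundary is a staircase in the plane of [f] and [g]. Placing [v] just above [y] in [f] and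
    just above [x] in [g] makes it a new corner between them; the corners [L2] then lie strictly
    above it in both coordinates and leave the boundary. Being highest in [h], [v] beats every old
    edge. *)
Lemma canon_insert E S L1 L2 L3 a b x y v f g h : symmetric E -> irreflexive E ->
  a \in S -> b \in S ->
  canon E S (L1 ++ x :: L2 ++ y :: L3) a b f g h -> v \notin S ->
  (forall w, w \in S -> E v w -> w \in x :: L2 ++ [:: y]) ->
  exists f' g' h', canon E (v |: S) (L1 ++ x :: v :: y :: L3) a b f' g' h'.
Proof.
move=> Esym Eirr aS bS [LS mono cover [S1 S2] [R1 R2]] vS Nv.
have S_neq w : w \in S -> w != v by apply: contraTneq => ->.
(* Doubling opens a gap above each old value; the sum in [h'] bounds all old values of [h]. *)
pose f' w := if w == v then (f y).*2.+1 else (f w).*2.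
pose g' w := if w == v then (g x).*2.+1 else (g w).*2.
pose h' w := if w == v then (\sum_(z in S) h z).+1 else h w.
have fS w : w \in S -> f' w = (f w).*2 by move=> wS; rewrite /f' (negbTE (S_neq w wS)).
have gS w : w \in S -> g' w = (g w).*2 by move=> wS; rewrite /g' (negbTE (S_neq w wS)).
have hS w : w \in S -> h' w = h w by move=> wS; rewrite /h' (negbTE (S_neq w wS)).
have fv : f' v = (f y).*2.+1 by rewrite /f' eqxx.
have gv : g' v = (g x).*2.+1 by rewrite /g' eqxx.
have hv w : w \in S -> h w < h' v.
  by move=> wS; rewrite /h' eqxx ltnS (bigD1 w) //= leq_addr.
have mem_LS w : w \in L1 ++ x :: L2 ++ y :: L3 -> w \in S by exact: LS.
have xS : x \in S by apply: mem_LS; rewrite !(mem_cat, inE) eqxx !orbT.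
have yS : y \in S by apply: mem_LS; rewrite !(mem_cat, inE) eqxx !orbT.
have old u w c : u \in S -> w \in S ->
    triple f g h c u < triple f g h c w -> triple f' g' h' c u < triple f' g' h' c w.
  move=> uS wS; rewrite /triple; case: (val c) => [|[|_]].
  - by rewrite !fS // ltn_double.
  - by rewrite !gS // ltn_double.
  - by rewrite !hS.
have before u w : f w < f u -> g u < g w -> u \in S -> w \in S ->
    (f' w < f' u) && (g' u < g' w).
  by move=> *; rewrite !fS ?gS ?ltn_double //; apply/andP.
have M := mono; rewrite pairwise_cat pairwise_cons pairwise_cat pairwise_cons in M.
rewrite allrel_consr allrel_catr allrel_consr !all_cat /= in M.
rewrite allrel_consr in M.
move: M => /and3P[/and3P[/allP L1x /allrelP L12 /andP[/allP L1y /allrelP L13]]].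
move=> pL1 /andP[/and3P[/allP xL2 /andP[fxy gxy] /allP xL3]].
move=> /and3P[/andP[/allP L2y /allrelP L23] pL2 /andP[/allP yL3 pL3]].
have sub1 w : w \in L1 -> w \in S by move=> wL; apply: mem_LS; rewrite mem_cat wL.
have sub3 w : w \in L3 -> w \in S.
  by move=> wL; apply: mem_LS; rewrite !(mem_cat, inE) wL !orbT.
have pw s : {subset s <= S} -> pairwise (fun x y => (f y < f x) && (g x < g y)) s ->
    pairwise (fun x y => (f' y < f' x) && (g' x < g' y)) s.
  elim: s => //= z s IH sS /andP[/allP az ps]; rewrite IH ?andbT //; last first.
    by move=> w ws; apply: sS; rewrite inE ws orbT.
  apply/allP => w ws; have /andP[lt1 lt2] := az w ws.
  by apply: before => //; apply: sS; rewrite inE ?eqxx ?ws ?orbT.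
(* A corner [m] below [w] decides where [w] beats the new edge vl: in [f] if [m] precedes [l] on the
   staircase, in [g] if it follows, and in [f] again if [m] is [l]. *)
have beat l w : l \in x :: L2 ++ [:: y] -> w \in S -> w != l ->
    exists c, (triple f' g' h' c l < triple f' g' h' c w) &&
              (triple f' g' h' c v < triple f' g' h' c w).
  move=> lL wS wl; have [m mL mw] := cover w wS.
  have lS : l \in S.
    by apply: mem_LS; move: lL; rewrite !(mem_cat, inE) => /or3P[] ->; rewrite ?orbT.
  have [fyl gxl] : f y <= f l /\ g x <= g l.
    move: lL; rewrite !(mem_cat, inE) => /or3P[/eqP->||/eqP->].
    - by split; last exact: leqnn; exact: ltnW.
    - move=> lL; have /andP[lt1 _] := L2y l lL; have /andP[_ lt2] := xL2 l lL.
      by split; exact: ltnW.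
    - by split; first exact: leqnn; exact: ltnW.
  have [ltm|lem] := ltnP (f l) (f m).
    have fw : f l < f w by case: mw => [->//|[lt _]]; exact: ltn_trans lt.
    exists (@Ordinal 3 0 isT); by rewrite /triple /= fv !fS // ltn_double fw ltn_Sdouble (leq_ltn_trans fyl).
  have ltg : g l < g m \/ m = l.
    have lL' : l \in L1 ++ x :: L2 ++ y :: L3.
      by move: lL; rewrite !(mem_cat, inE) => /or3P[] ->; rewrite ?orbT.
    case/splitPr: lL' mL mono => p1 p2; rewrite mem_cat inE pairwise_cat pairwise_cons.
    rewrite allrel_consr => /or3P[mp|/eqP->|mp]; last 2 first.
    - by right.
    - by case/and4P=> _ _ /allP/(_ m mp)/andP[_ ->]; left.
    - by case/andP=> /andP[/allP/(_ m mp)/andP[lt _]]; rewrite leqNgt lt in lem.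
  case: ltg => [ltg|ml].
    have gw : g l < g w by case: mw => [->//|[_ lt]]; exact: ltn_trans lt.
    exists (@Ordinal 3 1 isT); by rewrite /triple /= gv !gS // ltn_double gw ltn_Sdouble (leq_ltn_trans gxl).
  case: mw => [wm|[lt _]]; first by rewrite wm ml eqxx in wl.
  exists (@Ordinal 3 0 isT); by rewrite /triple /= fv !fS // ltn_double -ml lt ltn_Sdouble (leq_ltn_trans fyl) // -ml.
have low w : w \in S -> f y < f w \/ g x < g w.
  move=> wS; have [m mL mw] := cover w wS.
  suff [lt|lt] : f y < f m \/ g x < g m.
  - by left; case: mw => [->//|[lt' _]]; exact: ltn_trans lt'.
  - by right; case: mw => [->//|[_ lt']]; exact: ltn_trans lt'.
  move: mL; rewrite !(mem_cat, inE) => /or4P[mL|/eqP->|mL|/orP[/eqP->|mL]].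
  - by left; case/andP: (L1y m mL).
  - by left.
  - by left; case/andP: (L2y m mL).
  - by right.
  - by right; case/andP: (xL3 m mL).
have nS w : w \in v |: S -> w != v -> w \in S by rewrite !inE => /orP[->|].
exists f', g', h'; split.
- move=> w; rewrite mem_cat !inE => /or4P[/sub1|/eqP->|/eqP->|/orP[/eqP->|/sub3]] //;
    by rewrite ?eqxx ?xS ?yS ?orbT // => ->; rewrite orbT.
- rewrite pairwise_cat !pairwise_cons !allrel_consr /= !pw // !andbT.
  have bf w z : w \in S -> z \in S -> (f z < f w) && (g w < g z) ->
    (f' z < f' w) && (g' w < g' z) by move=> wS zS /andP[? ?]; exact: before.
  have -> : (f' y < f' x) && (g' x < g' y) by apply: bf; rewrite // fxy.
  have -> : (f' v < f' x) && (g' x < g' v) by rewrite fv gv fS ?gS // ltn_Sdouble fxy ltnSn.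
  have -> : (f' y < f' v) && (g' v < g' y) by rewrite fv gv fS ?gS // ltn_Sdouble gxy ltnSn.
  rewrite /=; apply/and4P; split; [apply/and4P; split| | |].
  + by apply/allP => m mL; exact: bf (sub1 m mL) xS (L1x m mL).
  + apply/allP => m mL; rewrite fv gv fS ?gS ?sub1 //.
    have /andP[_ lt] := L1x m mL; have /andP[lt' _] := L1y m mL.
    by rewrite ltn_Sdouble lt' ltnS leq_double ltnW.
  + by apply/allP => m mL; exact: bf (sub1 m mL) yS (L1y m mL).
  + by apply/allrelP => m n mL nL; exact: bf (sub1 m mL) (sub3 n nL) (L13 m n mL nL).
  + by apply/allP => m mL; exact: bf xS (sub3 m mL) (xL3 m mL).
  + apply/allP => m mL; rewrite fv gv fS ?gS ?sub3 //.
    have /andP[lt _] := yL3 m mL; have /andP[_ lt'] := xL3 m mL.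
    by rewrite ltn_Sdouble lt' ltnS leq_double ltnW.
  + by apply/allP => m mL; exact: bf yS (sub3 m mL) (yL3 m mL).
- move=> w; have [->|wv] := eqVneq w v.
    by exists v; [rewrite !(mem_cat, inE) eqxx !orbT|left].
  move/nS/(_ wv) => wS; have [m mL mw] := cover w wS.
  have mS := mem_LS m mL.
  have [m2|m2] := boolP (m \in L2).
    exists v; first by rewrite !(mem_cat, inE) eqxx !orbT.
    right; rewrite fv gv fS ?gS // !ltn_Sdouble.
    have /andP[lt _] := L2y m m2; have /andP[_ lt'] := xL2 m m2.
    by case: mw => [->//|[? ?]]; split; [apply: ltn_trans lt _|apply: ltn_trans lt' _].
  exists m; first by move: mL; rewrite !(mem_cat, inE) (negbTE m2) /=; do !case: (_ \in _); do !case: (_ == _).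
  by case: mw => [->|[? ?]]; [left|right; rewrite !fS ?gS // !ltn_double].
- split.
  + move=> u w uS wS uw; have [uv|uv] := eqVneq u v.
      by exists ord_max; rewrite /triple /= uv hS ?hv ?nS // -uv eq_sym.
    have u' := nS u uS uv; have [wv|wv] := eqVneq w v.
      have [lt|lt] := low u u'.
        by exists (@Ordinal 3 0 isT); rewrite /triple /= wv fv fS // ltn_Sdouble.
      by exists (@Ordinal 3 1 isT); rewrite /triple /= wv gv gS // ltn_Sdouble.
    by have [c lt] := S1 u w u' (nS w wS wv) uw; exists c; apply: old => //; exact: nS.
  + move=> u w z uS wS zS uw zu zw.
    have [zv|zv] := eqVneq z v.
      have u' : u \in S by apply: nS; rewrite // -zv eq_sym.
      have w' : w \in S by apply: nS; rewrite // -zv eq_sym.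
      by exists ord_max; rewrite /triple /= zv (hS u u') (hS w w') !hv.
    have z' := nS z zS zv.
    have [uv|uv] := eqVneq u v.
      have wv : w != v by apply: contraTneq uw => ->; rewrite uv Eirr.
      rewrite uv in uw *.
      have [c /andP[lt1 lt2]] := beat w z (Nv w (nS w wS wv) uw) z' zw.
      by exists c; rewrite lt1 lt2.
    have [wv|wv] := eqVneq w v.
      rewrite wv in uw *; rewrite Esym in uw.
      exact: beat (Nv u (nS u uS uv) uw) z' zu.
    have [c /andP[lt1 lt2]] := S2 u w z (nS u uS uv) (nS w wS wv) z' uw zu zw.
    by exists c; rewrite !old // nS.
- split=> [c w c1 wS wb|w wS wa].
    have [wv|wv] := eqVneq w v.
      have yb : f b <= f y.
        by have [->//|yb] := eqVneq y b; apply/ltnW/(R1 (@Ordinal 3 0 isT)).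
      case: c c1 => [[|[|[|//]]] ?] //= _; rewrite /triple /= wv.
        by rewrite fv fS // ltnS leq_double.
      by rewrite hS ?hv.
    have w' := nS w wS wv; apply: (old b w c bS w'); exact: R1.
  have [wv|wv] := eqVneq w v.
    have xa : g a <= g x by have [->//|xa] := eqVneq x a; apply/ltnW/R2.
    by rewrite /triple /= wv gv gS // ltnS leq_double.
  have w' := nS w wS wv; apply: (old a w _ aS w'); exact: R2.
Qed.

End Realizers.

(** * Ears *)

Section Ears.
Variables (V : finType) (E : rel V).
Hypothesis Esym : symmetric E.
Implicit Types (A B D L N P X Y S : {set V}) (x y z l : V) (s : seq V).

Definition att L D := [set l in L | adj E [set l] D].

Definition nb D := [set v | (v \notin D) && adj E [set v] D].

Lemma adj1P x D : reflect (exists2 y, y \in D & E x y) (adj E [set x] D).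
Proof.
apply: (iffP (adjP _ _ _)) => [[z [y [/set1P-> yD xy]]]|[y yD xy]].
  by exists y.
by exists x, y; rewrite inE.
Qed.

Lemma mem_att L D l x : l \in L -> x \in D -> E l x -> l \in att L D.
Proof. by move=> lL xD lx; rewrite inE lL; apply/adj1P; exists x. Qed.

Lemma attP L D l :
  reflect (l \in L /\ exists2 x, x \in D & E l x) (l \in att L D).
Proof. by rewrite inE; apply: (iffP andP) => -[lL /adj1P]. Qed.

Lemma card_gt1 (A : {set V}) x y : x \in A -> y \in A -> x != y -> 1 < #|A|.
Proof. by move=> xA yA xy; apply/card_gt1P; exists x, y. Qed.

Lemma conn_sorted s : sorted E s -> s != [::] -> conn E [set z in s].
Proof. by case: s => // x s ps _; exact: conn_path. Qed.

Section Ear.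
Variables (L N N0 : {set V}).
Hypothesis cN : conn E N.
Hypothesis closed : forall x y, x \in N -> E x y -> y \in L :|: N.
Hypothesis tri : forall Y, Y \proper N -> Y != set0 -> 2 < #|nb Y|.
Hypotheses (N0N : N0 \subset N) (cN0 : conn E N0).

(** [tri] plays the role of 3-connectivity. [N1] is taken maximal among the connected sets
    containing [N0] that leave a connected set with two attachments outside; the ear is what lies
    outside [N1]. The heart is that each of its vertices is adjacent to [N1], for these vertices all
    lie on one path. *)
Lemma ear D0 : D0 \subset N :\: N0 -> conn E D0 -> 1 < #|att L D0| ->
  exists x s l l' X, X = [set z in x :: s] /\
  [/\ uniq (x :: s) /\ path E x s, X \subset N :\: N0, conn E (N :\: X),
      [/\ l != l', l \in L, l' \in L, E l x & E l' (last x s)] &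
      forall D : {set V}, D \subset X -> conn E D -> 1 < #|att L D| -> D = X].
Proof.
move=> D0N cD0 aD0.
pose Q (N1 : {set V}) := [&& N0 \subset N1, N1 \subset N, conn E N1 &
  [exists D : {set V}, [&& D \subset N :\: N1, conn E D & 1 < #|att L D|]]].
have Q0 : Q N0.
  by rewrite /Q subxx N0N cN0; apply/existsP; exists D0; rewrite D0N cD0.
case: (@arg_maxnP _ N0 Q (fun A => #|A|) Q0) => N1.
case/and4P=> N01 N1N cN1 /existsP[D /and3P[DN1 cD aD]] maxN1.
set X := N :\: N1; pose Xc := [set x in X | adj E [set x] N1].
(* If [P] missed [x], then [x] could be added to [N1]. *)
have crit x (P : {set V}) :
    x \in Xc -> P \subset X -> conn E P -> 1 < #|att L P| -> x \in P.
  rewrite !inE => /andP[/andP[xN1 xN] ax] PX cP aP; apply: contraT => xP.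
  suff : Q (x |: N1) by move/maxN1; rewrite /= cardsU1 xN1 add1n ltnn.
  rewrite /Q (subset_trans N01 (subsetUr _ _)) subUset sub1set xN N1N /=.
  case/adj1P: ax => y yN1 xy; rewrite (connU1 Esym cN1 yN1 xy) /=.
  apply/existsP; exists P; rewrite cP aP !andbT; apply/subsetP => z zP.
  have := subsetP PX z zP; rewrite !inE => /andP[zN1 ->]; rewrite (negbTE zN1) orbF andbT.
  by apply: contraNneq xP => <-.
have /card_gt1P[l [l' [/attP[lL [u uD lu]] /attP[l'L [u' u'D lu']] ll']]] := aD.
have [s [ps lst us sD]] := path_of_conn cD uD u'D.
pose U := [set z in u :: s].
have UX : U \subset X.
  by apply/subsetP => z; rewrite inE => /sD; exact: (subsetP DN1).
have XN : X \subset N by exact: subsetDl.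
have N1X : N :\: X = N1 by rewrite setDDr setDv set0U (setIidPr N1N).
have cU : conn E U by exact: conn_path.
have uU : u \in U by rewrite !inE eqxx.
have u'U : u' \in U by rewrite inE -lst mem_last.
have attU (P : {set V}) p q k k' : p \in P -> q \in P -> E k p -> E k' q -> k != k' ->
    k \in L -> k' \in L -> 1 < #|att L P|.
  move=> pP qP kp kq kk kL k'L.
  by apply: card_gt1 kk; [exact: mem_att kp|exact: mem_att kq].
have XcU x : x \in Xc -> x \in u :: s.
  move=> xX; have := crit x U xX UX cU (attU _ _ _ _ _ uU u'U lu lu' ll' lL l'L).
  by rewrite inE.
have [xc xcX] : exists x, x \in Xc.
  have /set0Pn[n nN1] := conn_neq0 cN1.
  have nU : n \notin X by rewrite inE nN1.
  have /adjP[x [y [xX yX xy]]] :=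
    conn_cut cN XN (subsetP UX u uU) (subsetP N1N n nN1) nU.
  exists x; rewrite inE xX; apply/adj1P; exists y => //; by rewrite N1X in yX.
(* A component [Y] of the rest has at most one attachment, hence at least two neighbours [Z] on the
   path [U]; a detour through [Y] around some vertex of [Z] keeps two attachments, against
   [crit]. *)
have XXc : X = Xc.
  apply/eqP; rewrite eqEsubset andbC; apply/andP; split; apply/subsetP => y; first by case/setIdP.
  move=> yX.
  apply: contraT => yXc.
  have yR : y \in X :\: Xc by rewrite inE yXc.
  have [Y [YR yY cY nY]] := component Esym yR.
  have YX : Y \subset X := subset_trans YR (subsetDl _ _).
  have YXc x : x \in Y -> x \notin Xc by move/(subsetP YR); rewrite inE => /andP[].
  have aY : #|att L Y| <= 1.
    rewrite leqNgt; apply/negP => aY; case/negP: (YXc _ (crit xc Y xcX YX cY aY)).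
    exact: xcX.
  have nbY z : z \in nb Y -> (z \in att L Y) || (z \in Xc).
    rewrite inE => /andP[zY /adj1P[t tY zt]].
    have tX := subsetP YX t tY.
    have : z \in L :|: N by apply: (closed (subsetP XN t tX)); rewrite Esym.
    rewrite inE => /orP[zL|zN]; first by rewrite (mem_att zL tY zt).
    apply/orP; right.
    have [zN1|zN1] := boolP (z \in N1).
      case/negP: (YXc t tY); rewrite inE tX; apply/adj1P; exists z => //.
      by rewrite Esym.
    have zX : z \in X by rewrite inE zN1.
    apply: contraT => zXc; case/negP: nY; apply: (@adj_intro _ _ t z); rewrite // 1?Esym //.
    by rewrite !inE zY; rewrite !inE zN1 zN /= in zXc *; rewrite zXc.
  have YN : Y \proper N.
    rewrite properE (subset_trans YX XN); apply/negP => /subsetP NY.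
    have /set0Pn[n nN1] := conn_neq0 cN1.
    have := subsetP YX n (NY n (subsetP N1N n nN1)).
    by rewrite inE nN1.
  have triY := tri YN (conn_neq0 cY).
  pose Z := nb Y :&: Xc.
  have nbZ z : z \in nb Y -> z \in att L Y \/ z \in Z.
    by move=> zn; case/orP: (nbY z zn) => zz; [left|right; rewrite inE zn].
  have nbcard : #|nb Y| <= #|att L Y| + #|Z|.
    rewrite -cardsUI; apply: leq_trans (leq_addr _ _).
    by apply: subset_leq_card; apply/subsetP => z /nbZ[] zz; rewrite inE zz ?orbT.
  have cZ : 1 < #|Z| by move: aY triY nbcard; clear; lia.
  have [us_ usE] : exists t, t = u :: s by exists (u :: s).
  pose ix z := index z us_.
  have /card_gt0P[z0 z0Z] : 0 < #|Z| by exact: ltn_trans cZ.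
  have Zus z : z \in Z -> z \in us_ by rewrite inE usE => /andP[_ /XcU].
  case: (arg_minnP ix z0Z) => z1 z1Z min1.
  case: (arg_maxnP ix z0Z) => z2 z2Z max2.
  have ixinj z t : z \in Z -> t \in Z -> ix z = ix t -> z = t.
    by move=> zZ tZ /(congr1 (nth z us_)); rewrite !nth_index ?Zus.
  have z12 : ix z1 < ix z2.
    have [p [q [pZ qZ]]] := card_gt1P cZ; apply: contraNltn => le21; apply/eqP.
    apply: ixinj => //; apply/eqP; rewrite eqn_leq.
    have := min1 p pZ; have := min1 q qZ; have := max2 p pZ; have := max2 q qZ.
    by move: le21; clear; rewrite /=; lia.
  pose pre := [set z in take (ix z1).+1 us_].
  pose suf := [set z in drop (ix z2) us_].
  have memus (P : {set V}) : P \subset U -> P \subset X by move=> PU; apply: subset_trans UX.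
  have preU : pre \subset U by apply/subsetP => z; rewrite !inE => /mem_take; rewrite usE inE.
  have sufU : suf \subset U by apply/subsetP => z; rewrite !inE => /mem_drop; rewrite usE inE.
  have srt : sorted E us_ by rewrite usE.
  have cpre : conn E pre by apply: conn_sorted; [exact: take_sorted|rewrite usE].
  have z2s : ix z2 < size us_ by rewrite index_mem Zus.
  have csuf : conn E suf.
    apply: conn_sorted; first exact: drop_sorted.
    by rewrite -size_eq0 size_drop subn_eq0 -ltnNge.
  have z1p : z1 \in pre by rewrite inE in_take ?Zus // ltnSn.
  have uP : u \in pre by rewrite inE usE /= mem_head.
  have z2suf : z2 \in suf.
    by rewrite inE (drop_nth z2 z2s) nth_index ?mem_head ?Zus.
  have u'suf : u' \in suf.
    have <- : last u (drop (ix z2) us_) = u'.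
      have := last_cat u (take (ix z2) us_) (drop (ix z2) us_).
      by rewrite cat_take_drop {1}usE /= lst => ->; rewrite (drop_nth z2 z2s).
    by rewrite inE (drop_nth z2 z2s) /= mem_last.
  have notpre z : z \in us_ -> ix z1 < ix z -> z \notin pre.
    by move=> zu lt; rewrite inE in_take // ltnS -ltnNge.
  have notsuf z : z \in us_ -> ix z < ix z2 -> z \notin suf.
    move=> zu lt; rewrite inE; apply/negP => zd.
    have := us; rewrite -usE -[us_](cat_take_drop (ix z2)) cat_uniq => /and3P[_ /hasPn/(_ z zd)/=].
    by rewrite in_take // lt.
  have aZ z : z \in Z -> exists2 t, t \in Y & E z t.
    by rewrite !inE -andbA => /and3P[_ /adj1P].
  have ZY z : z \in Z -> z \notin Y by rewrite inE => /andP[_ zX]; apply: contraL zX => /YXc.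
  have cpY : conn E (pre :|: Y).
    by have [t tY zt] := aZ z1 z1Z; apply: connU => //; apply: adj_intro zt _ _.
  have cYs : conn E (Y :|: suf).
    have [t tY zt] := aZ z2 z2Z; apply: connU => //; apply: adj_intro tY z2suf.
    by rewrite Esym.
  have bad z (P : {set V}) p q k k' : z \in Z -> z \notin P -> P \subset X -> conn E P -> p \in P -> q \in P ->
      E k p -> E k' q -> k != k' -> k \in L -> k' \in L -> False.
    move=> zZ zP PX cP pP qP kp kq kk kL k'L; case/negP: zP.
    apply: (crit z P _ PX cP (attU _ _ _ _ _ pP qP kp kq kk kL k'L)).
    by case/setIP: zZ.
  (* With three neighbours on the path, the detour avoids the middle one. With two, [tri] supplies
     an attachment [l0] of [Y], which replaces the attachment at one end of the path. *)
  have [/existsP[z3 /and3P[z3Z z31 z32]]|/existsPn no3] :=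
      boolP [exists z, [&& z \in Z, z != z1 & z != z2]].
    have lt1 : ix z1 < ix z3.
      by rewrite ltn_neqAle min1 // andbT; apply: contra_neq z31 => /ixinj->.
    have lt2 : ix z3 < ix z2.
      rewrite ltn_neqAle; apply/andP; split; last exact: max2.
      by apply: contra_neq z32 => /ixinj->.
    case: (bad z3 (pre :|: Y :|: suf) u u' l l') => //.
    - by rewrite !(in_setU, negb_or) ZY // notpre ?notsuf ?Zus.
    - by rewrite !subUset memus // YX memus.
    - have [t tY zt] := aZ z2 z2Z; apply: connU => //; apply: (@adj_intro _ _ t z2); rewrite // 1?Esym //.
      by rewrite in_setU tY orbT.
    - by rewrite !in_setU uP.
    - by rewrite in_setU u'suf orbT.
  have [l0 l0Y] : exists l0, l0 \in att L Y.
    have ZZ : Z \subset [set z1; z2].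
      apply/subsetP => z zZ; have := no3 z; rewrite zZ /= !inE -negb_or negbK //.
    have := subset_leq_card ZZ; rewrite cards2 => leZ.
    apply/card_gt0P; move: leZ triY nbcard; clear; case: (_ != _) => /=; lia.
  have /attP[l0L [t tY l0t]] := l0Y.
  have [ll0|ll0] := eqVneq l0 l.
    case: (bad z1 (Y :|: suf) t u' l0 l') => //.
    - by rewrite in_setU negb_or ZY // notsuf // Zus.
    - by rewrite subUset YX memus.
    - by rewrite inE tY.
    - by rewrite in_setU u'suf orbT.
    - by rewrite ll0.
  case: (bad z2 (pre :|: Y) t u l0 l) => //.
  - by rewrite in_setU negb_or ZY // notpre // Zus.
  - by rewrite subUset YX memus.
  - by rewrite inE tY orbT.
  - by rewrite in_setU uP.
have XU : X = U.
  apply/eqP; rewrite eqEsubset UX andbT {1}XXc; apply/subsetP => z /XcU zu.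
  by rewrite inE.
exists u, s, l, l', X; split; first exact: XU.
rewrite N1X; split=> //.
- by apply: setDS.
- by rewrite lst.
- move=> P PX cP aP; apply/eqP; rewrite eqEsubset PX; apply/subsetP => z.
  by rewrite {1}XXc => zX; apply: crit aP.
Qed.
End Ear.
End Ears.

(** * Attachments along the boundary and the two forbidden configurations *)

Section Boundary.
Variables (V : finType) (E : rel V).
Hypothesis Esym : symmetric E.
Implicit Types (A B D K N P X Y S : {set V}) (x y z l : V) (s t L : seq V).

(** Half-open in the index, so that consecutive segments of a path are disjoint and adjacent. *)
Definition seg L i j := [set x in L | i <= index x L < j].

Lemma seg_take_drop L i j : uniq L ->
  seg L i j = [set x in take (j - i) (drop i L)].
Proof.
move=> uL; apply/setP => x; rewrite !inE.
have [xL|xL] := boolP (x \in L); last first.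
  by symmetry; apply: contraNF xL => /mem_take/mem_drop.
have := uL; rewrite -{1}(cat_take_drop i L) cat_uniq => /and3P[_ disj ud].
have := xL; rewrite -{1}(cat_take_drop i L) mem_cat.
have [xt _|xt /= xd] := boolP (x \in take i L).
  have lt : index x L < i by rewrite -in_take.
  rewrite leqNgt lt /=; symmetry; apply/negP => /mem_take xd.
  by case/hasP: disj; exists x.
have ge : i <= index x L by rewrite leqNgt -in_take.
have ixd : index x L = i + index x (drop i L).
  rewrite -{1}(cat_take_drop i L) index_cat (negbTE xt) size_takel //.
  by apply: leq_trans ge _; rewrite index_size.
by rewrite in_take // ge /= ixd ltn_subRL.
Qed.

Lemma conn_seg L i j : uniq L -> sorted E L -> i < j -> i < size L ->
  conn E (seg L i j).
Proof.
move=> uL sL ij iL; rewrite seg_take_drop //; apply: (conn_sorted Esym) => //.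
  by apply: take_sorted; apply: drop_sorted.
have [k jk] : exists k, j - i = k.+1 by exists (j - i).-1; rewrite prednK ?subn_gt0.
by rewrite jk; have := ltn0Sn (size L - i).-1; case: (drop i L) (size_drop i L) => //=; lia.
Qed.

Lemma adj_seg L i j k : uniq L -> sorted E L -> i < j < k -> j < size L ->
  adj E (seg L i j) (seg L j k).
Proof.
case: L => // x0 L' uL sL /andP[ij jk] jL; set L := x0 :: L' in uL sL jL *.
have j1L : j.-1 < size L by lia.
apply: (@adj_intro _ _ (nth x0 L j.-1) (nth x0 L j)).
- have := sortedP x0 sL j.-1; rewrite prednK; last by lia.
  exact.
- by rewrite inE mem_nth // index_uniq //; lia.
- by rewrite inE mem_nth // index_uniq //; lia.
Qed.

Lemma disjoint_seg L i j i' j' : j <= i' -> [disjoint seg L i j & seg L i' j'].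
Proof.
move=> le; apply/pred0P => x /=; apply/negP; rewrite !inE.
by case/andP=> /andP[_ /andP[_ l1]] /andP[_ /andP[l2 _]]; lia.
Qed.

Lemma seg_sub L i j S : {subset L <= S} -> seg L i j \subset S.
Proof. by move=> LS; apply/subsetP => x; rewrite inE => /andP[/LS]. Qed.

Lemma mem_seg L i j x : x \in L -> i <= index x L < j -> x \in seg L i j.
Proof. by rewrite inE => ->. Qed.

Lemma disjoint_seg_set L i j K : {in L, forall x, x \notin K} ->
  [disjoint seg L i j & K].
Proof.
move=> LK; apply/pred0P => x /=; apply/negP; rewrite inE => /andP[/andP[xL _]].
exact/negP/LK.
Qed.

Lemma adj_att L K i j c : c \in att E [set z in L] K -> i <= index c L < j ->
  adj E (seg L i j) K.
Proof.
case/attP; rewrite inE => cL [x xK cx] ic.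
by apply: adj_intro cx _ xK; apply: mem_seg.
Qed.

Section Crossing.
Variables (S K1 K2 : {set V}) (L : seq V).
Hypotheses (uL : uniq L) (sL : sorted E L) (LS : {subset L <= S}).
Hypotheses (K1S : K1 \subset S) (K2S : K2 \subset S).
Hypotheses (cK1 : conn E K1) (cK2 : conn E K2).
Hypotheses (LK1 : {in L, forall x, x \notin K1}) (LK2 : {in L, forall x, x \notin K2}).
Hypotheses (K12 : [disjoint K1 & K2]) (aK : adj E K1 K2).
Let T K := att E [set z in L] K.

(** The four segments cut at [c2], [c3] and [c4], together with [K1] and [K2], form K33^- with sides
    [D1], [D3], [K2] and [D4], [D2], [K1]. The missing edge is between the first and the last
    segment. *)
Lemma crossing c1 c2 c3 c4 : c1 \in T K1 -> c2 \in T K2 -> c3 \in T K1 -> c4 \in T K2 ->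
  index c1 L < index c2 L -> index c2 L < index c3 L -> index c3 L < index c4 L ->
  model k33m E S.
Proof.
move=> T1 T2 T3 T4 l12 l23 l34.
have memL c K : c \in T K -> index c L < size L.
  by case/attP; rewrite inE index_mem.
have s4 := memL _ _ T4.
have s3 := ltn_trans l34 s4; have s2 := ltn_trans l23 s3.
pose D1 := seg L 0 (index c2 L); pose D2 := seg L (index c2 L) (index c3 L).
pose D3 := seg L (index c3 L) (index c4 L); pose D4 := seg L (index c4 L) (size L).
have i2 : 0 < index c2 L by exact: leq_ltn_trans l12.
have L0 : 0 < size L by exact: ltn_trans i2 s2.
apply: (@k33_of_sets _ E S D1 D3 K2 D4 D2 K1) => //.
- by rewrite /= !conn_seg // !seg_sub // K1S K2S cK1 cK2.
- rewrite /= (disjoint_sym D3 D2) (disjoint_sym D4 D2) (disjoint_sym K2 D4).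
  rewrite (disjoint_sym K2 D2) (disjoint_sym K2 K1) K12 /D1 /D2 /D3 /D4.
  by rewrite !(disjoint_seg_set _ _ LK1) !(disjoint_seg_set _ _ LK2) !disjoint_seg // ltnW // (ltn_trans l23).
- by apply: adj_seg; rewrite ?i2.
- by apply: (adj_att T1); rewrite l12.
- by apply: adj_seg; rewrite ?l34.
- by rewrite adj_sym //; apply: adj_seg; rewrite ?l23.
- by apply: (adj_att T3); rewrite leqnn.
- by rewrite adj_sym //; apply: (adj_att T4); rewrite leqnn.
- by rewrite adj_sym //; apply: (adj_att T2); rewrite leqnn.
- by rewrite adj_sym.
Qed.

(** Three segments, one for each common attachment, form K5^- with [K1] and [K2]; again no edge is
    claimed between the first and the last segment. *)
Lemma common3 c1 c2 c3 : c1 \in T K1 -> c2 \in T K1 -> c3 \in T K1 ->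
  c1 \in T K2 -> c2 \in T K2 -> c3 \in T K2 ->
  index c1 L < index c2 L -> index c2 L < index c3 L -> model k5m E S.
Proof.
move=> T1 T2 T3 U1 U2 U3 l12 l23.
have s3 : index c3 L < size L by case/attP: T3; rewrite inE index_mem.
have s2 := ltn_trans l23 s3.
have i2 : 0 < index c2 L by exact: leq_ltn_trans l12.
have L0 : 0 < size L by exact: ltn_trans i2 s2.
pose D1 := seg L 0 (index c2 L); pose D2 := seg L (index c2 L) (index c3 L).
pose D3 := seg L (index c3 L) (size L).
apply: (@k5_of_sets _ E S D1 D2 K1 K2 D3) => //.
- by rewrite /= !conn_seg // !seg_sub // K1S K2S cK1 cK2.
- rewrite /= (disjoint_sym K1 D3) (disjoint_sym K2 D3) K12 /D1 /D2 /D3.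
  by rewrite !(disjoint_seg_set _ _ LK1) !(disjoint_seg_set _ _ LK2) !disjoint_seg // ltnW.
- by apply: adj_seg; rewrite ?i2.
- by apply: (adj_att T1); rewrite l12.
- by apply: (adj_att U1); rewrite l12.
- by apply: (adj_att T2); rewrite leqnn.
- by apply: (adj_att U2); rewrite leqnn.
- by apply: adj_seg; rewrite ?l23.
- by rewrite adj_sym //; apply: (adj_att T3); rewrite leqnn.
- by rewrite adj_sym //; apply: (adj_att U3); rewrite leqnn.
Qed.

End Crossing.

Fixpoint chordless s :=
  if s is x :: s' then all (fun z => ~~ E x z) (behead s') && chordless s' else true.

Section EarSeq.
Variables (W : seq V) (N N0 : {set V}).
Let L := [set z in W].

(** A chord would shortcut the path to a smaller connected set still attached at [l] and [l'],
    against criticality. *)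
Lemma chordless_crit t X l l' : sorted E t -> uniq t -> X = [set z in t] ->
  l != l' -> l \in L -> l' \in L -> E l (head l t) -> E l' (last l' t) ->
  (forall D : {set V}, D \subset X -> conn E D -> 1 < #|att E L D| -> D = X) ->
  chordless t.
Proof.
move=> st ut XE ll' lL l'L hl hl' crit.
suff H p t0 : t = p ++ t0 -> chordless t0 by exact: (H [::]).
elim: t0 p => //= z [|y t2] IH p tE; first by rewrite andbT.
rewrite (IH (rcons p z)) ?cat_rcons // andbT /=; apply/allP => w wt2.
apply/negP => zw; case/splitPr: wt2 tE {IH} => p2 p3 tE.
have u1 : uniq (rcons p z ++ y :: p2 ++ w :: p3) by rewrite cat_rcons -tE.
have s1 : sorted E (rcons p z ++ y :: p2 ++ w :: p3) by rewrite cat_rcons -tE.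
pose D1 := [set v in rcons p z]; pose D2 := [set v in w :: p3].
have cD1 : conn E D1.
  by apply: (conn_sorted Esym); [case/cat_sorted2: s1|case: (p)].
have cD2 : conn E D2.
  by apply: (conn_sorted Esym) => //; case/cat_sorted2: s1 => _; rewrite -cat_cons => /cat_sorted2[].
have memt v : v \in t = [|| v \in rcons p z, v == y, v \in p2 | v \in w :: p3].
  by rewrite tE -(cat_rcons z p) mem_cat [v \in y :: _]inE mem_cat.
have zD1 : z \in D1 by rewrite inE mem_rcons mem_head.
have wD2 : w \in D2 by rewrite inE mem_head.
have cD : conn E (D1 :|: D2) by apply: connU => //; exact: adj_intro zw _ _.
have DX : D1 :|: D2 \subset X.
  by apply/subsetP => v; rewrite XE in_setU 3!inE memt => /orP[]->; rewrite ?orbT.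
have hD : head l t \in D1 :|: D2.
  by rewrite tE in_setU in_set; case: (p) => [|p0 p']; rewrite mem_head.
have hD' : last l' t \in D1 :|: D2.
  have -> : last l' t = last w p3 by rewrite tE last_cat /= last_cat.
  by rewrite in_setU [_ \in D2]in_set mem_last orbT.
have aD : 1 < #|att E L (D1 :|: D2)|.
  by apply: card_gt1 ll'; [exact: mem_att hl|exact: mem_att hl'].
have /setP/(_ y) := crit _ DX cD aD.
rewrite XE in_setU 3!inE memt eqxx orbT => /orP yD.
move: u1; rewrite cat_uniq => /and3P[_ /hasPn hp].
rewrite cons_uniq mem_cat negb_or => /andP[/andP[_ y3] _].
by case: yD => [yp|]; [have := hp y (mem_head _ _); rewrite /= yp|rewrite (negbTE y3)].
Qed.

Hypothesis cN : conn E N.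
Hypothesis closed : forall x y, x \in N -> E x y -> y \in L :|: N.
Hypothesis tri : forall Y : {set V}, Y \proper N -> Y != set0 -> 2 < #|nb E Y|.
Hypotheses (N0N : N0 \subset N) (cN0 : conn E N0).

(** The ear is read in the direction of [W], and criticality locates its attachments: an ear of at
    least two vertices keeps at most one attachment when an end is removed, so all vertices but the
    last can see only [c1], and all but the first only [c3]. *)
Lemma ear_seq (D0 : {set V}) :
  D0 \subset N :\: N0 -> conn E D0 -> 1 < #|att E L D0| ->
  exists t c1 c3 X, X = [set z in t] /\
  [/\ t != [::], uniq t, sorted E t, X \subset N :\: N0 & conn E (N :\: X)] /\
  [/\ c1 \in att E L X, c3 \in att E L X, index c1 W < index c3 W &
      forall c, c \in att E L X -> index c1 W <= index c W <= index c3 W] /\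
  [/\ E c1 (head c1 t), E c3 (last c3 t), chordless t,
      forall z w, z \in t -> z != last c3 t -> w \in W -> E z w -> w = c1 &
      forall z w, z \in t -> z != head c1 t -> w \in W -> E z w -> w = c3].
Proof.
move=> D0N cD0 aD0.
have [x [s [l [l' [X [XE [[uxs pxs] XN cNX [ll' lL l'L lx l's] crit]]]]]]] :=
  ear Esym cN closed tri N0N cN0 D0N cD0 aD0.
have [t [m [m' [[tX t0 ut st] [mm' [mL m'L hm hm']]]]]] : exists t m m',
    [/\ [set z in t] = [set z in x :: s], t != [::], uniq t & sorted E t] /\
    index m W < index m' W /\ [/\ m \in L, m' \in L, E m (head m t) & E m' (last m' t)].
  have [lt|gt|eq] := ltngtP (index l W) (index l' W).
  - by exists (x :: s), l, l'.
  - exists (rev (x :: s)), l', l; split; last split=> //.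
      split; rewrite ?rev_uniq ?rev_sorted //.
      + by apply/setP => z; rewrite !in_set mem_rev.
      + by rewrite -size_eq0 size_rev.
      + by rewrite (eq_sorted (e' := E)) // => u v; exact: Esym.
    split=> //; first by rewrite (lastI x s) rev_rcons.
    by rewrite rev_cons last_rcons.
  - by case/eqP: ll'; rewrite !inE in lL l'L; exact: index_inj eq.
rewrite XE -tX in XN cNX crit; exists t.
have mm : m != m' by apply: contraTneq mm' => ->; rewrite ltnn.
have ch := chordless_crit st ut erefl mm mL m'L hm hm' crit.
have headt c : head c t \in t by case: (t) t0 => [|y p] // _; exact: mem_head.
have lastt c : last c t \in t by case: (t) t0 => [|y p] // _; exact: (mem_last y p).
have [t1|t1] := leqP (size t) 1.
  have [y ty] : exists y, t = [:: y] by case: (t) t0 t1 => [//|y []] // _ _; exists y.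
  have in1 c : c \in att E L [set z in t] -> E c y.
    by case/attP => _ [z]; rewrite ty !inE => /eqP->.
  have mA : m \in att E L [set z in t] by apply: (mem_att mL _ hm); rewrite inE.
  have m'A : m' \in att E L [set z in t] by apply: (mem_att m'L _ hm'); rewrite inE.
  (* A one-vertex ear may have many attachments; the outermost ones are its feet. *)
  case: (arg_minnP (fun c => index c W) mA) => c1 c1A min1.
  case: (arg_maxnP (fun c => index c W) mA) => c3 c3A max3.
  exists c1, c3, [set z in t]; split=> //; split=> //; split; split=> //.
  - have l1 : index c1 W <= index m W by exact: min1.
    have l3 : index m' W <= index c3 W by exact: max3.
    exact: leq_ltn_trans l1 (leq_trans mm' l3).
  - by move=> c cA; rewrite min1 //; exact: max3.
  - by rewrite ty; exact: in1.
  - by rewrite ty; exact: in1.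
  - by move=> z w; rewrite ty !inE /= => /eqP->; rewrite eqxx.
  - by move=> z w; rewrite ty !inE /= => /eqP->; rewrite eqxx.
have attw D w k : D \subset [set z in t] -> conn E D -> D != [set z in t] ->
    k \in att E L D -> w \in att E L D -> w = k.
  move=> DX cD nD kD wD; apply/eqP; apply: contraNT nD => wk; apply/eqP; apply: crit => //.
  exact: card_gt1 wk.
have A1 z w : z \in t -> z != last m' t -> w \in W -> E z w -> w = m.
  have [p [y tE]] : exists p y, t = rcons p y.
    by case/lastP: (t) t0 => [//|p y] _; exists p, y.
  rewrite {1 2}tE last_rcons mem_rcons inE => /orP[->//|zp] _ wW zw.
  have p0 : p != [::] by apply: contraTneq t1 => pE; rewrite tE pE.
  have pX : [set z in p] \subset [set z in t].
    by apply/subsetP => v; rewrite !inE tE mem_rcons inE => ->; rewrite orbT.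
  apply: (attw _ _ _ pX).
  - by apply: (conn_sorted Esym) => //; move: st; rewrite tE -cats1 => /cat_sorted2[].
  - apply: contraTneq ut => /setP/(_ y); rewrite !inE tE mem_rcons mem_head rcons_uniq.
    by move=> ->.
  - apply: (mem_att mL _ hm); rewrite tE inE.
    by case: (p) p0 => //= p1 p' _; rewrite mem_head.
  - by apply: (@mem_att _ _ _ _ _ z); rewrite ?inE // Esym.
have A2 z w : z \in t -> z != head m t -> w \in W -> E z w -> w = m'.
  have [y [p tE]] : exists y p, t = y :: p.
    by case: (t) t0 => [//|y p] _; exists y, p.
  rewrite {1 2}tE /= inE => /orP[->//|zp] _ wW zw.
  have p0 : p != [::] by apply: contraTneq t1 => pE; rewrite tE pE.
  have pX : [set z in p] \subset [set z in t].
    by apply/subsetP => v; rewrite !inE tE inE => ->; rewrite orbT.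
  apply: (attw _ _ _ pX).
  - by apply: (conn_sorted Esym) => //; move: st; rewrite tE -cat1s => /cat_sorted2[].
  - apply: contraTneq ut => /setP/(_ y); rewrite !inE tE mem_head /=.
    by move=> ->.
  - apply: (mem_att m'L _ hm'); rewrite tE inE.
    by case: (p) p0 => //= p1 p' _; rewrite mem_last.
  - by apply: (@mem_att _ _ _ _ _ z); rewrite ?inE // Esym.
have hl : head m t != last m' t.
  case: (t) t1 ut => // y [//|y' p] _ /= /andP[+ _]; apply: contraNneq => ->.
  exact: mem_last.
exists m, m', [set z in t]; split=> //; split=> //; split; split=> //.
- by apply: (mem_att mL _ hm); rewrite inE.
- by apply: (mem_att m'L _ hm'); rewrite inE.
- move=> c /attP[]; rewrite inE => cW [z]; rewrite inE => zt; rewrite Esym => zc.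
  have [zl|zl] := eqVneq z (last m' t); last first.
    by rewrite (A1 z c) // leqnn (ltnW mm').
  by rewrite (A2 z c) ?leqnn ?(ltnW mm') // zl eq_sym.
Qed.

End EarSeq.

End Boundary.

(** * Inserting a whole ear *)

Section CanonChain.
Variable V : finType.
Implicit Types (E : rel V) (S : {set V}) (a b x y v w : V) (s t L : seq V).

Lemma canon_uniq E S L a b f g h : canon E S L a b f g h -> uniq L.
Proof.
move=> H; apply: (@sorted_uniq _ (fun x y => f y < f x)).
- by move=> y x z /= l1 l2; exact: ltn_trans l2 l1.
- by move=> x /=; rewrite ltnn.
- apply: pairwise_sorted; apply: sub_pairwise (canon_mono H) => x y /= /andP[] //.
Qed.

(** Vertices are inserted from left to right, each between its predecessor and [y]. Only the first
    may bury part of the boundary; since [t] is chordless, a later one sees nothing drawn except its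
    predecessor and possibly [y]. *)
Lemma canon_chain E S L1 L2 L3 a b x y t f g h : symmetric E -> irreflexive E ->
  a \in S -> b \in S ->
  canon E S (L1 ++ x :: L2 ++ y :: L3) a b f g h ->
  t != [::] -> uniq t -> {in t, forall v, v \notin S} -> chordless E t ->
  (forall w, w \in S -> E (head x t) w -> w \in x :: L2 ++ [:: y]) ->
  (forall z w, z \in behead t -> w \in S -> E z w -> w = y) ->
  exists f' g' h', canon E (S :|: [set z in t]) (L1 ++ x :: t ++ y :: L3) a b f' g' h'.
Proof.
move=> Esym Eirr; elim: t S L1 L2 x f g h => // v t IH S L1 L2 x f g h aS bS H _.
case/andP=> vt ut tS /= /andP[cv ct] hv ht.
have vS : v \notin S by apply: tS; rewrite mem_head.
have [f' [g' [h' H']]] := canon_insert Esym Eirr aS bS H vS hv.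
case: t => [|u t] in IH vt ut tS cv ct ht *.
  exists f', g', h'; suff -> : S :|: [set z in [:: v]] = v |: S by [].
  by apply/setP => z; rewrite !inE orbC.
have [|||||||||f2 [g2 [h2 H2]]] := IH (v |: S) (rcons L1 x) [::] v f' g' h'.
- by rewrite inE aS orbT.
- by rewrite inE bS orbT.
- by rewrite cat_rcons.
- by [].
- by [].
- move=> z zt; rewrite in_setU1 negb_or tS ?andbT; last by rewrite inE zt orbT.
  by apply: contraNneq vt => <-.
- by [].
- move=> w; rewrite !inE => /orP[/eqP->|wS uw]; first by rewrite eqxx.
  by rewrite (ht u w) ?mem_head // eqxx orbT.
- move=> z w zt; rewrite !inE => /orP[/eqP->|wS zw]; last first.
    by apply: (ht z w); rewrite // inE zt orbT.
  by rewrite Esym => vz; have := allP cv z zt; rewrite vz.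
exists f2, g2, h2; rewrite cat_rcons in H2.
suff -> : S :|: [set z in v :: u :: t] = v |: S :|: [set z in u :: t] by [].
by apply/setP => z; rewrite !inE orbCA orbA.
Qed.

Lemma canon_edge E a b : irreflexive E -> a != b ->
  exists f g h, canon (add_edge_rel E a b) [set a; b] [:: a; b] a b f g h.
Proof.
move=> Eirr ab.
(* [b] is lowest in [f] and [h], and [a] in [g], as [rooted] demands for the middle coordinate. *)
exists (fun x => x == a : nat), (fun x => x == b : nat), (fun x => x == a : nat).
have ba : (b == a) = false by rewrite eq_sym (negbTE ab).
split.
- by move=> w; rewrite !inE.
- by rewrite /= ba (negbTE ab) !eqxx.
- by move=> w wab; exists w; [move: wab; rewrite !inE|left].
- split=> [u v|u v w].
    rewrite !inE => /orP[]/eqP-> /orP[]/eqP->; rewrite ?eqxx // => _.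
      by exists ord0; rewrite /triple /= eqxx ba.
    by exists (@Ordinal 3 1 isT); rewrite /triple /= eqxx (negbTE ab).
  move=> uS vS wS uv; have {uv} : u != v.
    apply: contraTneq uv => ->; rewrite /add_edge_rel Eirr /= andbC orbb.
    by apply: contraNN ab => /andP[/eqP<- /eqP<-].
  move: uS vS wS; rewrite !inE.
  by move=> /orP[]/eqP-> /orP[]/eqP-> /orP[]/eqP->; rewrite ?eqxx.
- split=> [c w|w]; rewrite !inE; last first.
    by case/orP=> /eqP->; rewrite ?eqxx // /triple /= eqxx (negbTE ab).
  by case: c => [[|[|[|//]]] ?] //= _ /orP[]/eqP->; rewrite /triple /= ?eqxx ?ba.
Qed.

End CanonChain.

(** * Drawing from the outside in *)

(** For several sets at once, pairwise disjointness reduces to one labelling that is constant on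
    each of them. *)
Lemma disjoint_color (V : finType) (k : V -> nat) (A B : {set V}) i j :
  {in A, forall x, k x = i} -> {in B, forall x, k x = j} -> i != j ->
  [disjoint A & B].
Proof.
move=> kA kB ij; apply/pred0P => x /=; apply/negP => /andP[xA xB].
by case/eqP: ij; rewrite -(kA x xA) (kB x xB).
Qed.

Lemma split2 (T : eqType) (s : seq T) x y : uniq s -> x \in s -> y \in s ->
  index x s < index y s -> exists s1 s2 s3, s = s1 ++ x :: s2 ++ y :: s3.
Proof.
move=> + xs; case/path.splitPr: xs => s1 s2.
rewrite cat_uniq /= => /and3P[_ /norP[xs1 _] _].
rewrite mem_cat inE !index_cat (negbTE xs1) /= eqxx addn0.
case: ifP => [ys1|_ /=]; first by rewrite ltnNge index_size.
case: eqVneq => [->|_ y2 _]; first by rewrite addn0 ltnn.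
by case/path.splitPr: y2 => s3 s4; exists s1, s3, s4.
Qed.

Lemma between (T : eqType) (s1 s2 s3 : seq T) x y z :
  let s := s1 ++ x :: s2 ++ y :: s3 in
  uniq s -> z \in s -> (index x s < index z s < index y s) = (z \in s2).
Proof.
move=> s us zs.
have us' := us; rewrite cat_uniq in us'; case/and3P: us' => _ /hasPn h1.
rewrite /= cat_uniq mem_cat negb_or => /and3P[/andP[x2 xy] _ /and3P[/hasPn h2 _ _]].
have n1 w : w \in x :: s2 ++ y :: s3 -> w \notin s1 by move/h1.
have ix w : w \in x :: s2 ++ y :: s3 -> index w s = size s1 + index w (x :: s2 ++ y :: s3).
  by move/n1 => w1; rewrite /s index_cat (negbTE w1).
have y2 : y \notin s2 by apply: h2; rewrite mem_head.
have yx : (x == y) = false.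
  by apply/eqP => exy; move: xy; rewrite exy mem_head.
rewrite (ix x) ?mem_head // (ix y); last by rewrite inE mem_cat mem_head !orbT.
rewrite [index x (x :: _)]/= eqxx addn0 [index y (x :: _)]/= yx index_cat (negbTE y2) /= eqxx addn0.
move: zs; rewrite /s mem_cat => /orP[z1|z2].
  have -> : (z \in s2) = false.
    by apply: contraTF z1 => z2; apply: n1; rewrite inE mem_cat z2 orbT.
  by rewrite index_cat z1 ltnNge ltnW // index_mem.
rewrite ix // [index z (x :: _)]/=; case: eqVneq => [<-|xz].
  by rewrite addn0 ltnn (negbTE x2).
rewrite addnS ltnS leq_addr addnS ltnS ltn_add2l index_cat.
by case: ifP => z2'; rewrite ?index_mem // ltnNge leq_addr.
Qed.

Lemma between_le (T : eqType) (s1 s2 s3 : seq T) x y z :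
  let s := s1 ++ x :: s2 ++ y :: s3 in
  uniq s -> z \in s -> index x s <= index z s <= index y s -> z \in x :: s2 ++ [:: y].
Proof.
move=> s us zs /andP[le1 le2]; rewrite inE mem_cat inE.
have [//|zx /=] := eqVneq z x; have [|zy] := eqVneq z y; first by rewrite orbT.
have xs : x \in s by rewrite mem_cat mem_head orbT.
have ys : y \in s by rewrite mem_cat inE mem_cat mem_head !orbT.
rewrite orbF -(between us zs) !ltn_neqAle le1 le2 !andbT.
apply/andP; split; apply/eqP => /(congr1 (nth x s)); rewrite !nth_index // => e.
  by rewrite e eqxx in zx.
by rewrite e eqxx in zy.
Qed.

Lemma eq_chordless (V : finType) (E E' : rel V) (t : seq V) :
  {in t & , forall x y, E x y = E' x y} -> chordless E t = chordless E' t.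
Proof.
elim: t => //= x t IH H; rewrite IH; last first.
  by move=> y z yt zt; apply: H; rewrite inE ?yt ?zt orbT.
congr andb; apply: eq_in_all => y yt; rewrite H ?mem_head // inE.
by rewrite (mem_behead yt) orbT.
Qed.

Section Sweep.
Variables (V : finType) (E : rel V) (S : {set V}) (a b : V).
Hypotheses (Esym : symmetric E) (Eirr : irreflexive E).
Hypotheses (aS : a \in S) (bS : b \in S) (ab : a != b).
Let I := S :\: [set a; b].
Hypothesis fr : minor_free E S.
Hypothesis tri : forall Y : {set V}, Y \proper I -> Y != set0 -> 2 < #|nb E Y|.
Variable M : {set V}.
Hypotheses (cM : conn E M) (MI : M \subset I).
Let E' := add_edge_rel E a b.
Implicit Types (N X Y K D : {set V}) (P R Bs t : seq V) (q x y z w l c : V).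

(* The part S \ N is drawn with outer boundary P ++ q :: R, of which only q :: R
   is still adjacent to N; q :: Bs is what remains of the reserved path from a
   to b, the other vertices of N being in M. *)
Record state N q R P Bs : Prop := State {
  st_canon : exists f g h, canon E' (S :\: N) (P ++ q :: R) a b f g h;
  st_path : sorted E (q :: R);
  st_last : last q R = b;
  st_qb : q != b;
  st_qM : q \notin M;
  st_NI : N \subset I;
  st_conn : conn E N;
  st_closed : forall x y, x \in N -> E x y -> y \in [set z in q :: R] :|: N;
  st_Bs : {subset Bs <= N};
  st_Bs0 : Bs != [::];
  st_Bsuniq : uniq Bs;
  st_Bspath : path E q Bs;
  st_Bslast : E (last q Bs) b;
  st_chordless : chordless E (q :: rcons Bs b);
  st_NM : forall y, y \in N -> (y \in M) = (y \notin Bs);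
  st_RM : forall l, l \in R -> l != b -> l \in M;
  st_core : exists2 m, m \in M & m \notin N }.

Section State.
Variables (N : {set V}) (q : V) (R P Bs : seq V).
Hypothesis st : state N q R P Bs.
Let W := q :: R.
Let T K := att E [set z in W] K.

Lemma st_uniq : uniq W.
Proof.
have [f [g [h H]]] := st_canon st; have := canon_uniq H.
by rewrite cat_uniq => /and3P[].
Qed.

Lemma st_W l : l \in W -> l \in S /\ l \notin N.
Proof.
move=> lW; have [f [g [h H]]] := st_canon st.
by have := canon_sub H (x := l); rewrite mem_cat lW orbT inE => /(_ isT)/andP[].
Qed.

Lemma st_WS : {subset W <= S}.
Proof. by move=> l /st_W[]. Qed.

Lemma st_WK K : K \subset N -> {in W, forall l, l \notin K}.
Proof. by move=> KN l /st_W[_]; apply: contraNN => /(subsetP KN). Qed.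

Lemma st_NS K : K \subset N -> K \subset S.
Proof.
by move=> KN; apply: subset_trans KN (subset_trans (st_NI st) (subsetDl _ _)).
Qed.

Lemma st_tri Y : Y \proper N -> Y != set0 -> 2 < #|nb E Y|.
Proof. by move=> YN; apply: tri; apply: proper_sub_trans YN (st_NI st). Qed.

Lemma st_R : exists2 R0, R = rcons R0 b & W = q :: rcons R0 b.
Proof.
have := st_last st; rewrite /W; case/lastP: R => [/= qb|R0 y].
  by have := st_qb st; rewrite qb eqxx.
by rewrite last_rcons => ->; exists R0.
Qed.

Lemma index_q : index q W = 0.
Proof. by rewrite /= eqxx. Qed.

Lemma st_bW : b \in W.
Proof. by have [R0 _ ->] := st_R; rewrite inE mem_rcons mem_head orbT. Qed.

Lemma index_b c : c \in W -> c != b -> index c W < index b W.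
Proof.
have := st_uniq; have [R0 _ ->] := st_R; rewrite -rcons_cons => u.
have nb' : b \notin q :: R0 by move: u; rewrite rcons_uniq => /andP[].
rewrite mem_rcons inE -cats1 !index_cat (negbTE nb') => /orP[/eqP->|cW _].
  by rewrite eqxx.
by rewrite cW; apply: leq_trans (leq_addr _ _); rewrite index_mem.
Qed.

Lemma index_qlt c : c \in W -> c != q -> 0 < index c W.
Proof. by move=> cW; rewrite /= eq_sym => /negbTE->. Qed.

Lemma indexW_inj c d : c \in W -> d \in W -> index c W = index d W -> c = d.
Proof. by move=> cW dW; exact: index_inj. Qed.

Lemma st_qT K x : x \in K -> E q x -> q \in T K.
Proof. by move=> xK; apply: mem_att xK; rewrite inE mem_head. Qed.

Lemma st_bT K x : x \in K -> E x b -> b \in T K.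
Proof. by move=> xK; rewrite Esym; apply: mem_att xK; rewrite inE st_bW. Qed.

(* M is connected and meets the drawn part, so whatever lies off the reserved
   path reaches the inside of the boundary. *)
Lemma interior D : D \subset N :\: [set z in Bs] -> D != set0 ->
  ~~ adj E D ((N :\: [set z in Bs]) :\: D) ->
  exists x l, [/\ x \in D, l \in R, l != b, l \in M & E x l].
Proof.
move=> DN /set0Pn[d dD] nD.
have NM y : y \in N :\: [set z in Bs] -> (y \in N) && (y \in M).
  by rewrite !inE => /andP[yB yN]; rewrite yN (st_NM st).
have DM : D \subset M by apply/subsetP => y /(subsetP DN)/NM/andP[].
have [m mM mN] := st_core st.
have mD : m \notin D by apply: contraNN mN => /(subsetP DN)/NM/andP[].
have /adjP[x [y [xD yMD xy]]] := conn_cut cM DM dD mM mD.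
move: yMD; rewrite inE => /andP[yD yM].
have xN : x \in N by case/andP: (NM x (subsetP DN x xD)).
have yN : y \notin N.
  apply: contraNN nD => yN; apply: (adj_intro xy xD).
  by rewrite !inE yD yN andbT -(st_NM st).
have := st_closed st xN xy; rewrite inE (negbTE yN) orbF !inE => /orP[/eqP yq|yR].
  by have := st_qM st; rewrite -yq yM.
exists x, y; split=> //; apply: contraTneq (subsetP MI y yM) => ->.
by rewrite !inE eqxx orbT.
Qed.

Lemma BsN : [set z in Bs] \subset N.
Proof. by apply/subsetP => z; rewrite inE; exact: (st_Bs st). Qed.

Section Cross.
Variables X N1 : {set V}.
Hypotheses (XN : X \subset N) (N1N : N1 \subset N) (dX : [disjoint X & N1]).
Hypotheses (cX : conn E X) (cN1 : conn E N1) (aX : adj E X N1).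

Lemma noncrossing c1 c2 c3 c4 : c1 \in T X -> c2 \in T N1 -> c3 \in T X -> c4 \in T N1 ->
  index c1 W < index c2 W -> index c2 W < index c3 W -> index c3 W < index c4 W -> False.
Proof.
move=> *; case: fr => + _; apply.
by apply: (@crossing _ E Esym S X N1 W _ _ _ _ _ _ _ _ _ _ _ c1 c2 c3 c4) => //;
  [exact: st_uniq|exact: (st_path st)|exact: st_WS|exact: st_NS|exact: st_NS
  |exact: st_WK|exact: st_WK].
Qed.

Lemma noncommon c1 c2 c3 : c1 \in T X -> c2 \in T X -> c3 \in T X ->
  c1 \in T N1 -> c2 \in T N1 -> c3 \in T N1 ->
  index c1 W < index c2 W -> index c2 W < index c3 W -> False.
Proof.
move=> *; case: fr => _; apply.
by apply: (@common3 _ E Esym S X N1 W _ _ _ _ _ _ _ _ _ _ _ c1 c2 c3) => //;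
  [exact: st_uniq|exact: (st_path st)|exact: st_WS|exact: st_NS|exact: st_NS
  |exact: st_WK|exact: st_WK].
Qed.

End Cross.

(** [q] and [b] are attached to the undrawn part through the reserved path. If the buried [t] is
    attached as well, interlacing gives K33^- unless the feet of the ear are [q] and [b], and then a
    third attachment of the ear gives K33^- or K5^-. In the remaining case connectivity of [M]
    produces a last K33^-. *)
Lemma uncovered X c1 c3 (t : V) : X \subset N :\: [set z in Bs] -> conn E X ->
  conn E (N :\: X) -> c1 \in T X -> c3 \in T X ->
  (forall c, c \in T X -> index c1 W <= index c W <= index c3 W) ->
  t \in T (N :\: X) -> index c1 W < index t W -> index t W < index c3 W -> False.
Proof.
set N1 := N :\: X => XNB cX cN1 c1X c3X c13 tN1 l1t lt3.
have XN : X \subset N := subset_trans XNB (subsetDl _ _).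
have N1N : N1 \subset N by exact: subsetDl.
have XBs z : z \in X -> z \notin Bs.
  by move=> /(subsetP XNB); rewrite !inE => /andP[].
have BsN1 z : z \in Bs -> z \in N1.
  by move=> zB; rewrite inE (st_Bs st zB) andbT; apply: contraL zB => /XBs.
have TW c K : c \in T K -> c \in W by case/attP; rewrite inE.
have [q1 Bs' BsE] : exists2 q1, q1 \in Bs & E q q1.
  by case: (Bs) (st_Bs0 st) (st_Bspath st) => // y B _ /= /andP[qy _]; exists y; rewrite ?mem_head.
have lB : last q Bs \in Bs.
  by case: (Bs) (st_Bs0 st) => // y B _; exact: (mem_last y B).
have qN1 : q \in T N1 by apply: st_qT BsE; exact: BsN1.
have bN1 : b \in T N1 by apply: st_bT (st_Bslast st); exact: BsN1.
have dX : [disjoint X & N1].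
  by apply/pred0P => z /=; rewrite inE; case: (z \in X).
have dX' : [disjoint N1 & X] by rewrite disjoint_sym.
have /set0Pn[x0 x0X] := conn_neq0 cX.
have q1N1 := BsN1 q1 Bs'.
have q1X : q1 \notin X by move: q1N1; rewrite inE => /andP[].
have aX : adj E X N1 := conn_cut (st_conn st) XN x0X (subsetP N1N q1 q1N1) q1X.
have aX' : adj E N1 X by rewrite adj_sym.
have ce1 : c1 = q.
  apply/eqP; apply: contraT => c1q.
  have := noncrossing N1N XN dX' cN1 cX aX' qN1 c1X tN1 c3X _ l1t lt3.
  by case; rewrite index_q; exact: index_qlt (TW _ _ c1X) c1q.
have ce3 : c3 = b.
  apply/eqP; apply: contraT => c3b.
  have := noncrossing XN N1N dX cX cN1 aX c1X tN1 c3X bN1 l1t lt3.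
  by case; exact: index_b (TW _ _ c3X) c3b.
rewrite ce1 in c1X l1t; rewrite ce3 in c3X lt3.
have TX c : c \in T X -> c = q \/ c = b.
  move=> cT; have cW := TW _ _ cT.
  have [->|cq] := eqVneq c q; first by left.
  have [->|cb] := eqVneq c b; first by right.
  have lqc : index q W < index c W by rewrite index_q; exact: index_qlt.
  have lcb := index_b cW cb.
  have [lt|gt|eq] := ltngtP (index c W) (index t W).
  - by case: (noncrossing N1N XN dX' cN1 cX aX' qN1 cT tN1 c3X lqc lt lt3).
  - by case: (noncrossing XN N1N dX cX cN1 aX c1X tN1 cT bN1 l1t gt lcb).
  - have ct : c = t by apply: indexW_inj eq => //; exact: TW tN1.
    rewrite -ct in tN1.
    by case: (noncommon XN N1N dX cX cN1 aX c1X cT c3X qN1 tN1 bN1 lqc lcb).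
have x0D : x0 \in N :\: [set z in Bs] by exact: (subsetP XNB).
have [O [OD x0O cO nO]] := component Esym x0D.
(* The component of the ear off the reserved path reaches the inside of the boundary, though not
   from the ear itself. The piece [Y] from which it does is adjacent to [X] and to the inside, while
   [q] and [b] are both adjacent to the reserved path, to [X] and to the inside. *)
have [w [l [wO lR lb lM wl]]] := interior OD (conn_neq0 cO) nO.
have lW : l \in W by rewrite inE lR orbT.
have lq : l != q.
  by apply/eqP => lq; have := st_uniq; rewrite /W -lq /= lR.
have wX : w \notin X.
  apply/negP => wX; have lT : l \in T X by apply: mem_att wX _; rewrite ?inE // Esym.
  by case: (TX l lT) => le; rewrite le eqxx in lq lb.
have wOX : w \in O :\: X by rewrite inE wX.
have [Y [YO wY cY nY]] := component Esym wOX.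
have hY z : z \in Y -> [/\ z \in N, z \notin Bs & z \notin X].
  move/(subsetP YO); rewrite inE => /andP[zX /(subsetP OD)]; rewrite !inE => /andP[zB zN].
  by [].
have aYX : adj E Y X.
  have x0Y : x0 \notin Y by apply/negP => /hY[_ _]; rewrite x0X.
  have YO' : Y \subset O := subset_trans YO (subsetDl _ _).
  have /adjP[y [z [yY zOY yz]]] := conn_cut cO YO' wY x0O x0Y.
  apply: (adj_intro yz yY); apply: contraT => zX; case/negP: nY.
  apply: (adj_intro yz yY); move: zOY; rewrite !inE => /andP[-> ->].
  by rewrite zX.
have [R0 RE WE] := st_R.
have tW := TW _ _ tN1.
have mid c : c \in W -> c != q -> c != b -> c \in R0.
  rewrite WE inE mem_rcons inE => /or3P[/eqP->|/eqP->|//]; by rewrite eqxx.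
have tq : t != q by apply: contraTneq l1t => ->; rewrite ltnn.
have tb : t != b by apply: contraTneq lt3 => ->; rewrite ltnn.
have tR0 := mid t tW tq tb; have lR0 := mid l lW lq lb.
have uW := st_uniq; rewrite WE cons_uniq mem_rcons inE negb_or rcons_uniq in uW.
have /andP[/andP[_ qR0] /andP[bR0 uR0]] := uW.
have WN z : z \in W -> z \notin N by case/st_W.
have R0N z : z \in R0 -> z \notin N.
  by move=> zR; apply: WN; rewrite WE inE mem_rcons inE zR !orbT.
have qN : q \notin N by apply: WN; rewrite mem_head.
have bN : b \notin N by apply: WN; exact: st_bW.
have sW := st_path st; rewrite -/W WE /= rcons_path in sW.
have /andP[pR0 R0b] := sW.
have [r0 [R1 R0E]] : exists r R1, R0 = r :: R1.
  by case: (R0) tR0 => // r R1 _; exists r, R1.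
pose D2 := [set z in R0].
have cD2 : conn E D2.
  by apply: (conn_sorted Esym); rewrite R0E //; move: pR0; rewrite R0E /= => /andP[].
case: fr => + _; apply.
(* Labels for [disjoint_color]: 0 to 5 for [Y], [q], [b], the reserved path, [X] and the inside of
   the boundary. *)
pose k z := if z \in X then 4 else if z \in Bs then 3 else if z \in N then 0 else
  if z == q then 1 else if z == b then 2 else 5.
have kY z : z \in Y -> k z = 0.
  by case/hY=> zN zB zX; rewrite /k (negbTE zX) (negbTE zB) zN.
have nXN z : z \notin N -> (z \in X) = false /\ (z \in Bs) = false.
  move=> zN; split; first by apply: contraNF zN => /(subsetP XN).
  by apply: contraNF zN => /(st_Bs st).
have kq z : z \in [set q] -> k z = 1.
  by move/set1P->; rewrite /k; have [-> ->] := nXN q qN; rewrite (negbTE qN) eqxx.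
have kb z : z \in [set b] -> k z = 2.
  move/set1P->; rewrite /k; have [-> ->] := nXN b bN.
  by rewrite (negbTE bN) eqxx eq_sym (negbTE (st_qb st)).
have kB z : z \in [set z in Bs] -> k z = 3.
  by rewrite inE => zB; rewrite /k zB; case: ifP => // /XBs; rewrite zB.
have kX z : z \in X -> k z = 4 by rewrite /k => ->.
have kD z : z \in D2 -> k z = 5.
  rewrite inE => zR; have zN := R0N z zR; rewrite /k; have [-> ->] := nXN z zN.
  rewrite (negbTE zN); case: eqP => [zq|_]; first by rewrite -zq zR in qR0.
  by case: eqP => // zb; rewrite -zb zR in bR0.
have sB : conn E [set z in Bs].
  apply: (conn_sorted Esym); last exact: (st_Bs0 st).
  exact: path_sorted (st_Bspath st).
apply: (@k33_of_sets _ E S Y [set q] [set b] [set z in Bs] X D2) => //.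
- rewrite /= cY !conn1 sB cX cD2 !sub1set (st_WS (mem_head _ _)) (st_WS st_bW).
  rewrite (st_NS BsN) (st_NS XN) (st_NS (_ : Y \subset N)) /=; last first.
    by apply/subsetP => z /hY[].
  by rewrite andbT; apply/subsetP => z; rewrite inE => zR; apply: st_WS; rewrite WE inE mem_rcons inE zR !orbT.
- by rewrite /= (disjoint_color kY kq) // (disjoint_color kY kb) // (disjoint_color kY kB) //
    (disjoint_color kY kX) // (disjoint_color kY kD) // (disjoint_color kq kb) //
    (disjoint_color kq kB) // (disjoint_color kq kX) // (disjoint_color kq kD) //
    (disjoint_color kb kB) // (disjoint_color kb kX) // (disjoint_color kb kD) //
    (disjoint_color kB kX) // (disjoint_color kB kD) // (disjoint_color kX kD).
- by apply: (adj_intro wl); rewrite // inE.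
- by apply: (adj_intro BsE); rewrite inE.
- by case/attP: c1X => _ [x xX qx]; apply: (adj_intro qx); rewrite ?inE.
- by apply: (@adj_intro _ _ q r0); rewrite ?inE ?R0E ?mem_head //; move: pR0; rewrite R0E /= => /andP[].
- by apply: (@adj_intro _ _ b (last q Bs)); rewrite ?inE // Esym; exact: (st_Bslast st).
- by case/attP: c3X => _ [x xX qx]; apply: (adj_intro qx); rewrite ?inE.
- apply: (@adj_intro _ _ b (last q R0)); rewrite ?inE 1?Esym //.
  by rewrite R0E; exact: (mem_last r0 R1).
Qed.

Section Update.
Variables (t : seq V) (c1 c3 : V) (X : {set V}).
Let N1 := N :\: X.
Hypotheses (XE : X = [set z in t]) (t0 : t != [::]) (ut : uniq t) (tpath : sorted E t).
Hypotheses (XN : X \subset N) (c1X : c1 \in T X) (c3X : c3 \in T X).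
Hypothesis c13 : forall c, c \in T X -> index c1 W <= index c W <= index c3 W.
Hypotheses (c1lt3 : index c1 W < index c3 W).
Hypotheses (c1t : E c1 (head c1 t)) (c3t : E c3 (last c3 t)) (tchord : chordless E t).
Hypothesis tatt3 :
  forall z w, z \in t -> z != head c1 t -> w \in W -> E z w -> w = c3.
Hypothesis nostrict :
  forall w, w \in T N1 -> index c1 W < index w W -> index w W < index c3 W -> False.

(** Replacing the stretch strictly between [c1] and [c3] by the ear keeps the boundary invariants
    because, by [nostrict], the vertices lost there have no neighbour among the remaining ones. *)
Lemma update : exists L1 L2 L3, W = L1 ++ c1 :: L2 ++ c3 :: L3 /\
  let W' := L1 ++ c1 :: t ++ c3 :: L3 in
  [/\ exists f g h, canon E' (S :\: N1) (P ++ W') a b f g h, sorted E W',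
      last b W' = b &
      forall x y, x \in N1 -> E x y -> y \in W' \/ y \in N1].
Proof.
have TW c K : c \in T K -> c \in W by case/attP; rewrite inE.
have [L1 [L2 [L3 WE]]] := split2 st_uniq (TW _ _ c1X) (TW _ _ c3X) c1lt3.
exists L1, L2, L3; split=> // W'.
have tX z : (z \in t) = (z \in X) by rewrite XE inE.
have tN z : z \in t -> z \in N by rewrite tX; exact: (subsetP XN).
have abN z : z \in N -> (z != a) && (z != b).
  by move/(subsetP (st_NI st)); rewrite !inE negb_or -andbA => /and3P[-> ->].
have EE z w : z \in N -> E' z w = E z w.
  by case/abN/andP=> za zb; rewrite /E' /add_edge_rel (negbTE za) (negbTE zb) !orbF.
have abSN c : c \in [set a; b] -> c \in S :\: N.
  move=> cab; rewrite inE; have cS : c \in S by move: cab; rewrite !inE => /orP[]/eqP->.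
  rewrite cS andbT; apply/negP => /abN/andP[ca cb].
  by move: cab; rewrite !inE (negbTE ca) (negbTE cb).
have ht : head c1 t \in t by case: (t) t0 => [|y p] // _; exact: mem_head.
have nbW z w : z \in N -> w \in S :\: N -> E z w -> w \in W.
  move=> zN; rewrite inE => /andP[wN _] zw.
  by have := st_closed st zN zw; rewrite inE (negbTE wN) orbF inE.
split.
- have [f [g [h H]]] := st_canon st; rewrite -/W WE catA in H.
  have -> : S :\: N1 = S :\: N :|: [set z in t].
    apply/setP => z; rewrite !inE tX negb_and negbK.
    have [zX|zX] := boolP (z \in X); last by rewrite orbF.
    by rewrite (subsetP (st_NS XN) z zX) orbT.
  have [||||||||||f' [g' [h' H']]] := canon_chain (t := t) _ _ _ _ H.
  all: try by [].
  + exact: add_edge_rel_sym.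
  + by move=> x; rewrite /E' /add_edge_rel Eirr /= andbC orbb; apply: contraNF ab => /andP[/eqP<- /eqP<-].
  + by apply: abSN; rewrite !inE eqxx.
  + by apply: abSN; rewrite !inE eqxx orbT.
  + by move=> v /tN vN; rewrite inE vN.
  + by rewrite -(eq_chordless (E := E)) // => x y /tN xN _; rewrite EE.
  + move=> w wSN; rewrite EE ?tN // => hw.
    have wW := nbW _ _ (tN _ ht) wSN hw.
    have wT : w \in T X by apply: (@mem_att _ _ _ _ _ (head c1 t)); rewrite ?inE // -?tX // Esym.
    by have := c13 wT; have := wW; rewrite WE; apply: between_le; rewrite -WE; exact: st_uniq.
  + move=> z w zt wSN; have zt' := mem_behead zt; rewrite EE ?tN // => zw.
    apply: (tatt3 zt' _ (nbW _ _ (tN _ zt') wSN zw) zw).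
    by move: ut zt; case: (t) => //= y p /andP[yp _] zp; apply: contraNneq yp => <-.
  by exists f', g', h'; rewrite catA.
- have sW := st_path st; rewrite -/W WE in sW.
  have [s1 s2] : sorted E (rcons L1 c1) /\ sorted E (c3 :: L3).
    have := sW; rewrite -cat_rcons => /cat_sorted2[-> s2]; split=> //.
    by case/cat_sorted2: s2.
  have [y [p tE]] : exists y p, t = y :: p by case: (t) t0 => // y p _; exists y, p.
  have -> : W' = rcons L1 c1 ++ t ++ c3 :: L3 by rewrite cat_rcons.
  have : sorted E (t ++ c3 :: L3).
    move: tpath; rewrite tE /= cat_path => -> /=; move: s2 => /= ->; rewrite andbT Esym.
    by move: c3t; rewrite tE.
  have c1y : E c1 y by move: c1t; rewrite tE.
  rewrite tE; case: (L1) s1 => [|l1 L1'] /= s1 s3; first by rewrite c1y.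
  by rewrite cat_path s1 last_rcons /= c1y.
- by have := st_last st; rewrite -[last q R]/(last b W) WE /W' !last_cat /= !last_cat.
- move=> x y xN1 xy; have xN : x \in N by move: xN1; rewrite inE => /andP[].
  have := st_closed st xN xy; rewrite inE inE -/W => /orP[yW|yN]; last first.
    have [yX|yX] := boolP (y \in X); last by right; rewrite inE yX.
    by left; rewrite !(mem_cat, inE) tX yX !orbT.
  left; have := yW; rewrite WE !(mem_cat, inE) => /or4P[->|->|y2|->]; rewrite ?orbT //.
  have yT : y \in T N1 by apply: (mem_att _ xN1); rewrite ?inE // Esym.
  have := @between _ L1 L2 L3 c1 c3 y; rewrite /= -WE => /(_ st_uniq yW).
  by rewrite y2 => /andP[l1 l2]; case: (nostrict yT l1 l2).
Qed.

End Update.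

Lemma conn_Bs : conn E [set z in Bs].
Proof.
apply: (conn_sorted Esym); last exact: (st_Bs0 st).
exact: path_sorted (st_Bspath st).
Qed.

Lemma last_Bs : last q Bs \in Bs.
Proof. by case: (Bs) (st_Bs0 st) => // y B _; exact: (mem_last y B). Qed.

Lemma st_M z : z \in N :\: [set y in Bs] -> z \in M.
Proof. by rewrite !inE => /andP[zB zN]; rewrite (st_NM st zN). Qed.

Lemma card_shrink (t : seq V) X : X = [set z in t] -> t != [::] -> X \subset N ->
  #|N :\: X| < #|N|.
Proof.
move=> XE t0 XN; rewrite cardsD (setIidPr XN) ltn_subrL.
have X0 : 0 < #|X|.
  by case: t t0 XE => // y p _ ->; apply/card_gt0P; exists y; rewrite !inE eqxx.
by rewrite X0; apply: leq_trans X0 _; exact: subset_leq_card.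
Qed.

(** An ear off the reserved path leaves [q] and the path untouched, and its vertices belong to [M],
    so the boundary after [q] stays in [M] up to [b]. *)
Lemma sweep_ear D : D \subset N :\: [set z in Bs] -> conn E D -> 1 < #|T D| ->
  exists N' R', state N' q R' P Bs /\ #|N'| < #|N|.
Proof.
move=> DN cD aD.
have [t [c1 [c3 [X [XE [[t0 ut pt XNB cN1] [[c1X c3X lt13 c13]
  [c1t c3t ch _ t3]]]]]]]] := ear_seq Esym (st_conn st) (st_closed st) st_tri
    BsN conn_Bs DN cD aD.
have cX : conn E X by rewrite XE; apply: (conn_sorted Esym).
have XN : X \subset N := subset_trans XNB (subsetDl _ _).
have [L1 [L2 [L3 [WE [cn pW' lW' cl]]]]] := update XE t0 ut pt XN c1X c3X c13 lt13
  c1t c3t ch t3 (fun w => uncovered XNB cX cN1 c1X c3X c13).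
set W' := L1 ++ c1 :: t ++ c3 :: L3 in cn pW' lW' cl.
have W'E : W' = q :: behead W'.
  by rewrite /W'; case: (L1) WE => [|l1 L1'] /= -[-> _].
have sub l : l \in W' -> l \in X \/ l \in W.
  rewrite WE XE inE !(mem_cat, inE) => /or4P[->|->|->|->]; rewrite ?orbT; by [right|left].
have uW' : uniq W'.
  by have [f [g [h H]]] := cn; have := canon_uniq H; rewrite cat_uniq => /and3P[].
exists (N :\: X), (behead W'); split; last exact: card_shrink XE t0 XN.
split; rewrite -?W'E //.
- by rewrite -lW' W'E.
- exact: st_qb st.
- exact: st_qM st.
- exact: subset_trans (subsetDl _ _) (st_NI st).
- by move=> x y xN1 xy; have [yW|yN] := cl x y xN1 xy; rewrite inE ?yN ?orbT // inE yW.
- move=> z zB; rewrite inE (st_Bs st zB) andbT.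
  by apply/negP => /(subsetP XNB); rewrite !inE zB.
- exact: st_Bs0 st.
- exact: st_Bsuniq st.
- exact: st_Bspath st.
- exact: st_Bslast st.
- exact: st_chordless st.
- by move=> y; rewrite inE => /andP[_ yN]; exact: (st_NM st).
- move=> l lR lb; have [lX|] := sub l (mem_behead lR).
    exact: st_M (subsetP XNB l lX).
  rewrite inE => /orP[/eqP lq|lR']; last exact: (st_RM st).
  by move: uW'; rewrite W'E /= -lq lR.
- by have [m mM mN] := st_core st; exists m; rewrite // inE (negbTE mN) andbF.
Qed.

(** Anything left besides the last path vertex would have a component whose neighbours are that
    vertex and at most one attachment, against [tri]; so a single insertion completes the
    drawing. *)
Lemma sweep_last : Bs = [:: last q Bs] ->
  (forall D, D \subset N :\: [set z in Bs] -> conn E D -> #|T D| <= 1) -> cert E S a b.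
Proof.
move: (last q Bs) (st_Bslast st) (st_Bspath st) last_Bs => q1 q1b + + BsE noD.
rewrite BsE /= andbT => qq1 _.
have q1N : q1 \in N by apply: (st_Bs st); rewrite BsE mem_head.
have NE : N = [set q1].
  apply/eqP; rewrite eqEsubset sub1set q1N andbT; apply/subsetP => y yN.
  apply: contraT; rewrite inE => yq1.
  have yD : y \in N :\: [set z in Bs] by rewrite !inE BsE inE yq1.
  have [Y [YD yY cY nY]] := component Esym yD.
  have YN : Y \proper N.
    rewrite properE (subset_trans YD (subsetDl _ _)); apply/subsetPn; exists q1 => //.
    by apply/negP => /(subsetP YD); rewrite !inE BsE inE eqxx.
  have := st_tri YN (conn_neq0 cY); rewrite ltnNge => /negP[].
  apply: leq_trans (_ : #|T Y :|: [set q1]| <= _); last first.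
    by apply: leq_trans (leq_card_setU _ _) _; rewrite cards1 addn1 ltnS noD.
  apply: subset_leq_card; apply/subsetP => z; rewrite inE => /andP[zY /adj1P[x xY zx]].
  have xN : x \in N by have := subsetP YD x xY; rewrite inE => /andP[].
  have := st_closed st xN; rewrite Esym in zx => /(_ z zx).
  rewrite !in_setU => /orP[zW|zN].
    by rewrite (mem_att zW xY) // Esym.
  apply/orP; right; apply: contraT; rewrite inE => zq; case/negP: nY.
  by apply: (adj_intro zx xY); rewrite !inE zY BsE inE zq zN.
have X1 : [set q1] = [set z in [:: q1]] by apply/setP => z; rewrite !inE.
have qT : q \in T [set q1] by apply: st_qT qq1; rewrite inE.
have bT : b \in T [set q1] by apply: st_bT q1b; rewrite inE.
have N1 : N :\: [set q1] = set0 by rewrite NE setDv.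
have ltqb : index q W < index b W by apply: index_b; [exact: mem_head|exact: st_qb st].
have c13 c : c \in T [set q1] -> index q W <= index c W <= index b W.
  case/attP; rewrite inE => cW _; rewrite index_q /=.
  by have [->//|cb] := eqVneq c b; apply/ltnW/index_b.
have ns w : w \in T (N :\: [set q1]) -> index q W < index w W -> index w W < index b W -> False.
  by rewrite N1 => /attP[_ [x]]; rewrite inE.
have sX : [set q1] \subset N by rewrite sub1set.
have bq1 : E b q1 by rewrite Esym.
have t3 z w : z \in [:: q1] -> z != head q [:: q1] -> w \in W -> E z w -> w = b.
  by rewrite inE => /eqP->; rewrite eqxx.
have [L1 [L2 [L3 [_ [[f [g [h H]]] _ _ _]]]]] :=
  @update [:: q1] q b [set q1] X1 isT isT isT sX qT bT c13 ltqb qq1 bq1 isT t3 ns.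
rewrite N1 setD0 in H.
by exists (triple f g h), (@Ordinal 3 1 isT); split; [exact: canon_realizer H|exact: canon_rooted H].
Qed.

(* With no ear off the reserved path, its next vertex q1 lies on an ear, which
   has to be attached at q. *)
Lemma sweep_next q1 q2 Bs' : Bs = q1 :: q2 :: Bs' ->
  (forall D, D \subset N :\: [set z in Bs] -> conn E D -> #|T D| <= 1) ->
  exists N' R', state N' q1 R' (rcons P q) (q2 :: Bs') /\ #|N'| < #|N|.
Proof.
move=> BsE noD; pose N0 := [set z in q2 :: Bs'].
have TW c K : c \in T K -> c \in W by case/attP; rewrite inE.
have q1N : q1 \in N by apply: (st_Bs st); rewrite BsE mem_head.
have uBs := st_Bsuniq st; rewrite BsE /= in uBs.
have /andP[q1B /andP[q2B uB]] := uBs.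
have pBs := st_Bspath st; rewrite BsE /= in pBs.
have /and3P[qq1 q12 pB] := pBs.
have lBs := st_Bslast st; rewrite BsE /= in lBs.
have chB := st_chordless st; rewrite BsE in chB.
have [/andP[nqq2 nqB] chT] : all (fun z => ~~ E q z) (q2 :: rcons Bs' b) /\
    chordless E (q1 :: rcons (q2 :: Bs') b) by case/andP: chB.
have nq1B : all (fun z => ~~ E q1 z) (rcons Bs' b) by case/andP: chT.
have q1b : ~~ E q1 b by move/allP: nq1B; apply; rewrite mem_rcons mem_head.
have qBs' z : z \in q2 :: Bs' -> ~~ E q z.
  rewrite inE => /orP[/eqP->//|zB]; move/allP: nqB; apply.
  by rewrite mem_rcons inE zB orbT.
(* Off the reserved path the only attachment is inside the boundary. *)
have att_off y l : y \in N :\: [set z in Bs] -> l \in W -> E y l -> l != q /\ l != b.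
  move=> yD lW yl; have [Y [YD yY cY nY]] := component Esym yD.
  have [x [m [xY mR mb mM xm]]] := interior YD (conn_neq0 cY) nY.
  have mT : m \in T Y by apply: (mem_att _ xY); rewrite ?inE ?mR ?orbT // Esym.
  have lT : l \in T Y by apply: (mem_att _ yY); rewrite ?inE // Esym.
  have -> : l = m.
    apply/eqP; apply: contraT => lm; have := card_gt1 lT mT lm.
    by rewrite ltnNge noD.
  by split=> //; apply: contraNneq (st_qM st) => <-.
have N0N : N0 \subset N.
  by apply/subsetP => z; rewrite inE => zB; apply: (st_Bs st); rewrite BsE inE zB orbT.
have cN0 : conn E N0 by apply: (conn_sorted Esym).
have q1N0 : q1 \in N :\: N0 by rewrite !inE q1N andbT.
have NN0 z : z \in N :\: N0 -> z != q1 -> z \in N :\: [set z in Bs].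
  by rewrite !inE BsE [z \in q1 :: _]inE => /andP[zB ->] /negbTE->; rewrite andbT.
(* [q1] is attached at [q]. A second attachment comes from [q1] itself or from a component off the
   path adjacent to it, since otherwise [q] and [q2] would be the only neighbours of [q1]. *)
have [D [DN cD aD]] : exists D : {set V}, [/\ D \subset N :\: N0, conn E D & 1 < #|T D|].
  have qT (K : {set V}) : q1 \in K -> q \in T K by move=> q1K; exact: st_qT qq1.
  have [/exists_inP[w wW /andP[q1w wq]]|/exists_inPn now] :=
      boolP [exists w in W, E q1 w && (w != q)].
    exists [set q1]; rewrite sub1set q1N0 conn1; split=> //.
    apply: (card_gt1 (qT _ (set11 q1)) _ _ : _ < _) => //; last by rewrite eq_sym; exact: wq.
    by apply: (mem_att _ (set11 q1)); rewrite ?inE // Esym.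
  have [/exists_inP[y yD q1y]|/exists_inPn noy] :=
      boolP [exists y in N :\: [set z in Bs], E q1 y].
    have [Y [YD yY cY nY]] := component Esym yD.
    have [x [m [xY mR mb mM xm]]] := interior YD (conn_neq0 cY) nY.
    exists (q1 |: Y); rewrite subUset sub1set q1N0 (connU1 Esym cY yY q1y); split=> //.
      apply/subsetP => z /(subsetP YD); rewrite !inE BsE inE negb_or => /andP[/andP[_ ->] ->] //.
    have mT : m \in T (q1 |: Y).
      by apply: (@mem_att _ _ _ _ _ x); rewrite ?inE ?xY ?mR ?orbT // Esym.
    apply: card_gt1 (qT _ (setU11 _ _)) mT _.
    by apply: contraNneq (st_qM st) => ->.
  have pr : [set q1] \proper N.
    rewrite properE sub1set q1N; apply/subsetPn; exists q2.
      by apply: (st_Bs st); rewrite BsE !inE eqxx orbT.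
    by rewrite inE; apply: contraNneq q1B => <-; rewrite mem_head.
  have := st_tri pr (conn_neq0 (conn1 E q1)); rewrite ltnNge => /negP[].
  apply: leq_trans (_ : #|[set q; q2]| <= _); last by rewrite cards2; case: (_ != _).
  apply: subset_leq_card; apply/subsetP => z; rewrite inE => /andP[zq1 /adj1P[x /set1P->]].
  rewrite Esym => q1z; have := st_closed st q1N q1z; rewrite in_setU inE => /orP[zW|zN].
    by have := now z zW; rewrite q1z /= negbK !inE => ->.
  rewrite !inE; apply/orP; right; apply: contraT => zq2; rewrite inE in zq1.
  have zB : z \notin Bs'.
    by apply/negP => zB; have := allP nq1B z; rewrite mem_rcons inE zB orbT q1z => /(_ isT).
  have zD : z \in N :\: [set z in Bs] by rewrite !inE BsE !inE !negb_or zq1 zq2 zB.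
  by have := noy z zD; rewrite q1z.
have [t [c1 [c3 [X [XE [[t0 ut pt XNB cN1] [[c1X c3X lt13 c13]
  [c1t c3t ch t1 t3]]]]]]]] := ear_seq Esym (st_conn st) (st_closed st) st_tri
    N0N cN0 DN cD aD.
have cX : conn E X by rewrite XE; apply: (conn_sorted Esym).
have XN : X \subset N := subset_trans XNB (subsetDl _ _).
have q1X : q1 \in X.
  apply: contraT => q1X.
  have XD : X \subset N :\: [set z in Bs].
    apply/subsetP => z zX; apply: NN0; first exact: (subsetP XNB).
    by apply: contraNneq q1X => <-.
  have c1c3 : c1 != c3 by apply: contraTneq lt13 => ->; rewrite ltnn.
  by have := card_gt1 c1X c3X c1c3; rewrite ltnNge noD.
have qX : q \in T X by exact: st_qT qq1.
have c1q : c1 = q.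
  apply/eqP; apply: contraT => c1q; have := c13 q qX.
  by rewrite index_q leqn0 eqn0Ngt index_qlt // (TW _ _ c1X).
have XB z : z \in X -> z != q1 -> z \in N :\: [set z in Bs].
  by move=> /(subsetP XNB); exact: NN0.
(* The reserved path is chordless, so [q1] does not see [b]; the other vertices of the ear are off
   the path and see only the inside. Hence [b] lies beyond the ear, and any buried attachment would
   interlace with its feet. *)
have c3b : c3 != b.
  have /attP[_ [x xX xc3]] := c3X; rewrite Esym in xc3.
  have [xq1|xq1] := eqVneq x q1; first by apply: contraNneq q1b => <-; rewrite -xq1.
  by have [] := att_off x c3 (XB x xX xq1) (TW _ _ c3X) xc3.
have N1N : N :\: X \subset N by exact: subsetDl.
have BsN1 z : z \in q2 :: Bs' -> z \in N :\: X.
  move=> zB; rewrite inE (subsetP N0N) ?inE // andbT.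
  by apply/negP => /(subsetP XNB); rewrite inE [z \in N0]inE zB.
have lN1 : last q2 Bs' \in N :\: X by apply: BsN1; exact: mem_last.
have bN1 : b \in T (N :\: X) by exact: st_bT lBs.
have dX : [disjoint X & N :\: X].
  by apply/pred0P => z /=; rewrite inE; case: (z \in X).
have q2N1 : q2 \in N :\: X by apply: BsN1; exact: mem_head.
have aX : adj E X (N :\: X) := adj_intro q12 q1X q2N1.
have ns w : w \in T (N :\: X) -> index c1 W < index w W -> index w W < index c3 W -> False.
  move=> wT l1 l3; apply: (noncrossing XN N1N dX cX cN1 aX c1X wT c3X bN1 l1 l3).
  exact: index_b (TW _ _ c3X) c3b.
have [L1 [L2 [L3 [WE [cn pW' lW' cl]]]]] := update XE t0 ut pt XN c1X c3X c13 lt13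
  c1t c3t ch t3 ns.
have L1E : L1 = [::].
  case: L1 WE {cn pW' lW' cl} => [//|l1 L1] /= [<- RE].
  by have := st_uniq; rewrite /W RE c1q /= mem_cat mem_head orbT.
(* Vertices after the head see only [c3], whereas [q1] sees [q]; so [q1] heads the ear and can take
   over as the next [q]. *)
have [t' tE] : exists t', t = q1 :: t'.
  have [y [p tE]] : exists y p, t = y :: p by case: (t) t0 => // y p _; exists y, p.
  exists p; rewrite tE; congr (_ :: _); apply/eqP; apply: contraT => yq.
  have q1t : q1 \in t by rewrite XE inE in q1X.
  have := t3 q1 q q1t; rewrite tE /= eq_sym => /(_ yq (mem_head _ _)).
  by rewrite Esym => /(_ qq1) qc3; rewrite -qc3 c1q ltnn in lt13.
set W' := L1 ++ c1 :: t ++ c3 :: L3 in cn pW' lW' cl.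
have W'E : W' = q :: q1 :: t' ++ c3 :: L3 by rewrite /W' L1E c1q tE.
have sub l : l \in W' -> l \in X \/ l \in W.
  rewrite WE XE inE !(mem_cat, inE) => /or4P[->|->|->|->]; rewrite ?orbT; by [right|left].
have uW' : uniq W'.
  by have [f [g [h H]]] := cn; have := canon_uniq H; rewrite cat_uniq => /and3P[].
rewrite W'E in cn pW' lW' cl uW' sub.
exists (N :\: X), (t' ++ c3 :: L3); split; last exact: card_shrink XE t0 XN.
split=> //.
- by rewrite cat_rcons.
- by case/andP: pW'.
- by apply: contraNneq q1b => e; rewrite e in qq1 q1N *; have := st_W st_bW; rewrite q1N => -[].
- by rewrite (st_NM st q1N) BsE mem_head.
- exact: subset_trans (subsetDl _ _) (st_NI st).
- move=> x y xN1 xy; have [|yN] := cl x y xN1 xy; last by rewrite inE yN orbT.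
  rewrite inE => /orP[/eqP yq|yW]; last by rewrite !inE -in_cons yW.
  have xN : x \in N by move: xN1; rewrite inE => /andP[].
  have [xB|xB] := boolP (x \in q2 :: Bs').
    by have := qBs' x xB; rewrite Esym -yq xy.
  have xD : x \in N :\: [set z in Bs].
    apply: NN0; first by rewrite inE xN andbT inE.
    by apply: contraTneq xN1 => ->; rewrite inE q1X.
  by have [] := att_off x y xD (_ : y \in W) xy; rewrite yq ?mem_head ?eqxx.
- by rewrite /= q2B.
- by rewrite /= q12.
- move=> y yN1; have yN : y \in N by move: yN1; rewrite inE => /andP[].
  rewrite (st_NM st yN) BsE inE; suff /negbTE-> : y != q1 by [].
  by apply: contraTneq yN1 => ->; rewrite inE q1X.
- move=> l lR lb; have [|lX|] := sub l.
  + by rewrite 2!inE lR !orbT.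
  + apply/st_M/NN0; first exact: (subsetP XNB).
    by apply: contraTneq lR => ->; move: uW' => /and3P[_ + _].
  + rewrite inE => /orP[/eqP lq|lR']; last exact: (st_RM st).
    by move: uW'; rewrite -lq /= inE lR orbT.
- by have [m mM mN] := st_core st; exists m; rewrite // inE (negbTE mN) andbF.
Qed.

End State.

Lemma sweep N q R P Bs : state N q R P Bs -> cert E S a b.
Proof.
have [n] := ubnP #|N|; elim: n => // n IH in N q R P Bs * => leN st.
have [/existsP[D /and3P[DN cD aD]]|/existsPn noD] := boolP [exists D : {set V},
    [&& D \subset N :\: [set z in Bs], conn E D & 1 < #|att E [set z in q :: R] D|]].
  have [N' [R' [st' ltN]]] := sweep_ear st DN cD aD.
  by apply: IH st'; exact: leq_trans ltN leN.
have noD' (D : {set V}) : D \subset N :\: [set z in Bs] -> conn E D ->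
    #|att E [set z in q :: R] D| <= 1.
  by move=> DN cD; rewrite leqNgt; have := noD D; rewrite DN cD.
case: Bs st noD' {noD} => [|q1 [|q2 Bs']] st noD.
- by have := st_Bs0 st.
- exact: sweep_last st erefl noD.
- have [N' [R' [st' ltN]]] := sweep_next st erefl noD.
  by apply: IH st'; exact: leq_trans ltN leN.
Qed.

End Sweep.

Lemma chordless_rcons (V : finType) (E : rel V) t b : uniq t -> chordless E t ->
  (forall z, z \in t -> z != last b t -> ~~ E z b) -> chordless E (rcons t b).
Proof.
elim: t => //= x t IH /andP[xt ut] /andP[axt ct] H.
rewrite IH // ?andbT; last first.
  move=> z zt zl; apply: H; first by rewrite inE zt orbT.
  by case: (t) zl zt.
case: (t) xt axt H => //= y p xp ap H.
rewrite all_rcons ap andbT; apply: H; first exact: mem_head.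
by apply: contraNneq xp => ->; exact: mem_last.
Qed.

(** * The initial drawing and the choice of the reserved path *)

Section Base.
Variables (V : finType) (E : rel V) (S : {set V}) (a b : V).
Hypotheses (Esym : symmetric E) (Eirr : irreflexive E).
Hypotheses (aS : a \in S) (bS : b \in S) (ab : a != b) (nab : ~~ E a b).
Hypothesis supp : forall x y, E x y -> y \in S.
Hypothesis fr : minor_free E S.
Let I := S :\: [set a; b].
Hypothesis tri : forall Y : {set V}, Y \proper I -> Y != set0 -> 2 < #|nb E Y|.
Let E' := add_edge_rel E a b.

Let E'irr : irreflexive E'.
Proof.
move=> x; rewrite /E' /add_edge_rel Eirr /= andbC orbb.
by apply: contraNF ab => /andP[/eqP<- /eqP<-].
Qed.

Let EE z w : z \in I -> E' z w = E z w.
Proof.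
rewrite !inE negb_or => /andP[/andP[za zb] _].
by rewrite /E' /add_edge_rel (negbTE za) (negbTE zb) !orbF.
Qed.

Let closed x y : x \in I -> E x y -> y \in [set z in [:: a; b]] :|: I.
Proof.
move=> _ xy; have yS := supp xy; rewrite !inE yS andbT.
by case: (y == a); case: (y == b).
Qed.

Lemma cert_canon L f g h : canon E' S L a b f g h -> cert E S a b.
Proof.
move=> H; exists (triple f g h), (@Ordinal 3 1 isT).
by split; [exact: canon_realizer H|exact: canon_rooted H].
Qed.

Let SE : S = [set a; b] :|: I.
Proof.
apply/setP => z; rewrite !inE; case: eqVneq => [->//|_]; case: eqVneq => [->//|_].
by [].
Qed.

Lemma first_ear (X : {set V}) (t : seq V) : X = [set z in t] -> X \subset I ->
  t != [::] -> uniq t -> chordless E t ->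
  (forall z w, z \in t -> z != head a t -> w \in [:: a; b] -> E z w -> w = b) ->
  exists f g h, canon E' ([set a; b] :|: X) (a :: t ++ [:: b]) a b f g h.
Proof.
move=> XE XI t0 ut ch t3; have [f [g [h H]]] := canon_edge Eirr ab.
have tI z : z \in t -> z \in I by move=> zt; apply: (subsetP XI); rewrite XE inE.
have [|||||||||||f' [g' [h' H']]] := @canon_chain _ E' [set a; b] [::] [::] [::] a b a b t f g h.
all: try by [].
- exact: add_edge_rel_sym.
- by rewrite !inE eqxx.
- by rewrite !inE eqxx orbT.
- by move=> v /tI; rewrite inE => /andP[].
- by rewrite -(eq_chordless (E := E)) // => x y /tI xI _; rewrite EE.
- by move=> w; rewrite !inE.
- move=> z w zt wab; have zt' := mem_behead zt; rewrite EE ?tI // => zw.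
  apply: (t3 z w zt' _ _ zw); last by move: wab; rewrite !inE.
  by move: ut zt; case: (t) => //= y p /andP[yp _] zp; apply: contraNneq yp => <-.
by exists f', g', h'; rewrite XE.
Qed.

(** Two disjoint ears from [a] to [b] are extracted, each with connected complement in [I]. The
    first, [B], is reserved and its complement is [M]; the second lies in [M] and is drawn at once,
    so that [M] meets the drawn part. *)
Lemma base : cert E S a b.
Proof.
have [f0 [g0 [h0 H0]]] := canon_edge Eirr ab.
have [I0|I0] := eqVneq I set0.
  by apply: (@cert_canon [:: a; b] f0 g0 h0); rewrite SE I0 setU0.
have /set0Pn[n nI] := I0.
have cI : conn E I.
  have [Y [YI nY cY nadj]] := component Esym nI.
  have [->//|YnI] := eqVneq I Y.
  have pr : Y \proper I by rewrite properEneq eq_sym YnI.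
  have := tri pr (conn_neq0 cY); rewrite ltnNge => /negP[].
  apply: leq_trans (_ : #|[set a; b]| <= _); last by rewrite cards2; case: (_ != _).
  apply: subset_leq_card; apply/subsetP => z; rewrite inE => /andP[zY /adj1P[x xY zx]].
  have xI := subsetP YI x xY; have := closed xI; rewrite Esym in zx => /(_ z zx).
  rewrite in_setU !inE => /orP[//|zI]; case/negP: nadj.
  by apply: (adj_intro zx xY); rewrite !inE zY.
have [n1|n1] := eqVneq I [set n].
  have nE : I = [set z in [:: n]] by apply/setP => z; rewrite n1 !inE.
  have [|f [g [h H]]] := first_ear nE (subxx _) isT isT isT.
    by move=> z w; rewrite inE => /eqP->; rewrite eqxx.
  by apply: (@cert_canon (a :: [:: n] ++ [:: b]) f g h); rewrite SE.
pose L := [set z in [:: a; b]].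
have nbI (D : {set V}) : D \subset I -> nb E D \subset att E L D :|: (I :\: D).
  move=> DI; apply/subsetP => z; rewrite inE => /andP[zD /adj1P[x xD zx]].
  have xI := subsetP DI x xD; have := closed xI; rewrite Esym in zx => /(_ z zx).
  rewrite in_setU => /orP[zL|zI]; rewrite in_setU.
    by rewrite (mem_att zL xD) // Esym.
  by rewrite in_setD zD zI orbT.
have aL : a \in L by rewrite !inE eqxx.
have bL : b \in L by rewrite !inE eqxx orbT.
have [y yIn] : exists y, y \in I :\: [set n].
  apply/set0Pn; rewrite setD_eq0; apply: contra n1 => In.
  by rewrite eqEsubset In sub1set.
have two (D : {set V}) k : D \subset I -> conn E D -> D != I -> nb E D \subset att E L D :|: [set k] ->
    1 < #|att E L D|.
  move=> DI cD nDI nbD; have pr : D \proper I by rewrite properEneq nDI.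
  have := tri pr (conn_neq0 cD); have := subset_leq_card nbD.
  have le := leq_card_setU (att E L D) [set k]; rewrite cards1 addn1 in le.
  by move=> le1 le2; have := leq_trans (leq_trans le2 le1) le.
have [D [DI yD cD nadj]] := component Esym yIn.
have DI' : D \subset I := subset_trans DI (subsetDl _ _).
have nD : n \notin D by apply/negP => /(subsetP DI); rewrite !inE eqxx.
have aD : 1 < #|att E L D|.
  apply: (two D n) => //; first by apply: contraTneq nI => <-; rewrite (negbTE nD).
  apply/subsetP => z zn; have := subsetP (nbI D DI') z zn; rewrite !in_setU => /orP[->//|].
  rewrite in_setD => /andP[zD zI]; apply/orP; right; apply: contraT => zn'.
  move: zn; rewrite inE => /andP[_ /adj1P[x xD zx]]; case/negP: nadj.
  rewrite Esym in zx; apply: (adj_intro zx xD); move: zI zn'; rewrite !inE => -> ->.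
  by rewrite zD.
have nI' : [set n] \subset I by rewrite sub1set.
(* The choice of [n] as [N0] keeps it out of the ear, so that the complement is not empty. *)
have [B [c1 [c3 [X [XE [[B0 uB pB XNB cM] [[c1X c3X lt13 c13]
  [c1t c3t chB t1 t3]]]]]]]] := ear_seq Esym cI closed tri nI' (conn1 E n) DI cD aD.
have ends c d : c \in L -> d \in L -> index c [:: a; b] < index d [:: a; b] -> c = a /\ d = b.
  rewrite !inE /= => /orP[]/eqP-> /orP[]/eqP->; rewrite ?eqxx ?(negbTE ab) //=.
have attL (D' : {set V}) c : c \in att E L D' -> c \in L by rewrite inE => /andP[].
have [c1a c3b] := ends _ _ (attL _ _ c1X) (attL _ _ c3X) lt13.
rewrite {c1}c1a {c3}c3b in c1X c3X lt13 c13 c1t c3t t1 t3.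
have BI z : z \in B -> z \in I.
  by move=> zB; have := subsetP XNB z; rewrite XE !inE zB => /(_ isT)/andP[].
have XI : X \subset I := subset_trans XNB (subsetDl _ _).
have nX : n \notin X by apply/negP => /(subsetP XNB); rewrite !inE eqxx.
have hB : head a B \in B by case: (B) B0 => //= *; exact: mem_head.
have lB : last b B \in B by case: (B) B0 => //= *; exact: mem_last.
have lBb : last a B = last b B by case: (B) B0.
have MI : I :\: X \subset I := subsetDl _ _.
have cX : conn E X by rewrite XE; exact: conn_sorted.
(* Otherwise k and the other one of a, b are the only neighbours of I \ {k}. *)
have attM k c : k \in B -> c \in L -> (forall z, z \in B -> z != k -> forall w, w \in [:: a; b] -> E z w -> w != c) ->
    c \in att E L (I :\: X).
  move=> kB cL kc; apply: contraT => cM'.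
  have pr : I :\ k \proper I by rewrite properD1 // BI.
  have nn : n \in I :\ k.
    rewrite in_setD1 nI andbT; apply: contraNneq nX => ->; by rewrite XE inE.
  have /set0Pn : exists z, z \in I :\ k by exists n.
  move=> /(tri pr); rewrite ltnNge => /negP[].
  have sub : nb E (I :\ k) \subset k |: (L :\ c).
    apply/subsetP => z zn; have := subsetP (nbI _ (subD1set I k)) z zn.
    rewrite in_setU => /orP[zL|]; last first.
      by rewrite in_setD in_setD1 in_setU1 negb_and negbK => /andP[/orP[->//|/negP zI] /zI].
    have [zL' [x xD zx]] := attP _ _ _ _ zL.
    rewrite in_setU1 in_setD1 zL' andbT; apply/orP; right.
    move: xD; rewrite in_setD1 => /andP[xk xI].
    apply: contraTneq zx => zc; apply/negP => zx; rewrite zc in zx.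
    have [xX|xX] := boolP (x \in X).
      rewrite Esym in zx; have := kc x _ xk c _ zx.
      rewrite eqxx => H; suff: false by []; apply: H.
        by move: xX; rewrite XE inE.
      by move: cL; rewrite !inE.
    case/negP: cM'; apply: (mem_att cL _ zx); by rewrite in_setD xX.
  apply: leq_trans (subset_leq_card sub) _.
  rewrite cardsU1; have := cardsD1 c L; rewrite cL.
  have -> : #|L| = 2.
    by rewrite /L cardsE; apply/card_uniqP; rewrite /= inE ab.
  by rewrite add1n => -[<-]; case: (k \notin _).
have aM : a \in att E L (I :\: X).
  apply: (attM (head a B)) => //.
  by move=> z zB zk w wW zw; rewrite (t3 z w zB) // eq_sym.
have bM : b \in att E L (I :\: X).
  by apply: (attM (last b B)) => // z zB zk w wW zw; rewrite (t1 z w zB).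
have aM2 : 1 < #|att E L (I :\: X)| by exact: card_gt1 aM bM ab.
(* Now [N0] is the reserved path itself: the second ear avoids it, and the undrawn rest, which
   contains it, stays connected. *)
have [t2 [d1 [d3 [X2 [X2E [[t20 u2 p2 X2M cN2] [[d1X d3X lt2 _]
  [d1t d3t ch2 s1 s3]]]]]]]] := ear_seq Esym cI closed tri XI cX (subxx _) cM aM2.
have [d1a d3b] := ends _ _ (attL _ _ d1X) (attL _ _ d3X) lt2.
rewrite {d1}d1a {d3}d3b in d1X d3X lt2 d1t d3t s1 s3.
have X2I : X2 \subset I := subset_trans X2M MI.
have [|f [g [h H]]] := first_ear X2E X2I t20 u2 ch2.
  by move=> z w zt zh wW zw; exact: (s3 z w).
have SE2 : S :\: (I :\: X2) = [set a; b] :|: X2.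
  apply/setP => z; rewrite in_setU; have [zX|zX] := boolP (z \in X2).
    have zI := subsetP X2I z zX; rewrite orbT in_setD in_setD zX /=.
    by move: zI; rewrite in_setD => /andP[].
  rewrite orbF in_setD in_setD zX /= in_setD negb_and negbK.
  have [z2|z2] := boolP (z \in [set a; b]); last by rewrite andNb.
  by move: z2; rewrite !inE => /orP[]/eqP->; rewrite ?aS ?bS.
have h2 : head a t2 \in t2 by case: (t2) t20 => //= *; exact: mem_head.
have t2M z : z \in t2 -> z \in I :\: X.
  by move=> zt; apply: (subsetP X2M); rewrite X2E inE.
have XB z : (z \in X) = (z \in B) by rewrite XE inE.
apply: (@sweep _ E S a b Esym Eirr aS bS ab fr tri _ cM MI (I :\: X2) a (t2 ++ [:: b]) [::] B).
split => //.
- by exists f, g, h; rewrite SE2.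
- case: (t2) t20 p2 d1t d3t => //= x t _ px ax lb.
  by rewrite ax cat_path px /= Esym lb.
- by rewrite last_cat.
- by rewrite !inE eqxx /= andbF.
- exact: subsetDl.
- move=> x w; rewrite in_setD => /andP[_ xI] xw; have := closed xI xw.
  rewrite !in_setU in_setD; have [wX|wX] := boolP (w \in X2).
    by move=> _; rewrite X2E inE in wX; rewrite in_set in_cons mem_cat wX orbT.
  rewrite !in_set !in_cons mem_cat !in_cons !in_nil => /orP[/orP[->//|/orP[->|//]]|wI]; by rewrite ?wI ?orbT.
- move=> z zB; rewrite in_setD BI // andbT; apply: contraL zB => zX.
  by have := subsetP X2M z zX; rewrite in_setD XB => /andP[].
- by case: (B) B0 pB c1t => //= x t _ -> ->.
- by rewrite lBb Esym.
- have ch : chordless E (rcons B b).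
    apply: chordless_rcons => // z zB zl; apply/negP => zb.
    by have := t1 z b zB zl _ zb; rewrite !inE eqxx orbT => /(_ isT)/eqP; rewrite eq_sym (negbTE ab).
  rewrite /= ch andbT; case: (B) uB t3 => //= x t /andP[xt _] t3'.
  rewrite all_rcons nab; apply/allP => z zt; apply/negP => az; rewrite Esym in az.
  have zx : z != x by apply: contraNneq xt => <-.
  by have := t3' z a _ zx (mem_head _ _) az; rewrite inE zt orbT => /(_ isT)/eqP; rewrite (negbTE ab).
- by move=> w; rewrite !in_setD XB => /andP[_ ->]; rewrite andbT.
- move=> l; rewrite mem_cat inE => /orP[/t2M //|/eqP->]; by rewrite eqxx.
- exists (head a t2); first exact: t2M.
  by rewrite in_setD X2E inE h2.
Qed.

End Base.

Lemma model_card (V T : finType) (e : rel T) (E : rel V) S : model e E S -> #|T| <= #|S|.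
Proof.
case=> D [DS cD dD _].
have [d dP] := fin_all_exists (fun p => set0Pn _ (conn_neq0 (cD p))).
have dI : injective d.
  move=> p q pq; apply/eqP; apply: contraT => npq.
  by have := disjointFr (dD p q npq) (dP p); rewrite pq dP.
rewrite -(card_codom dI) subset_leq_card //.
by apply/subsetP => _ /codomP[p ->]; exact: subsetP (DS p) _ (dP p).
Qed.

Lemma minor_free_small (V : finType) (E : rel V) (S : {set V}) : #|S| < 5 -> minor_free E S.
Proof.
move=> S5; split=> /model_card; rewrite ?card_sum !card_ord leqNgt //.
  by rewrite (leq_trans S5).
by rewrite S5.
Qed.

Lemma cert_mono (V : finType) (E E0 : rel V) (S : {set V}) a b :
  (forall x y, x \in S -> y \in S -> E x y -> add_edge_rel E0 a b x y) ->
  cert E0 S a b -> cert E S a b.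
Proof.
move=> H [r [j [[S1 S2] R]]]; exists r, j; split=> //; split=> // u v w uS vS wS uv.
apply: S2 => //; move: uv; rewrite {1}/add_edge_rel => /orP[/orP[/(H u v uS vS)//|]|] uv;
by rewrite /add_edge_rel uv ?orbT.
Qed.

(** * Separators with at most two vertices *)

Section Step.
Variables (V : finType) (E : rel V) (S : {set V}) (a b : V).
Hypotheses (Esym : symmetric E) (Eirr : irreflexive E).
Hypotheses (aS : a \in S) (bS : b \in S) (ab : a != b) (nab : ~~ E a b).
Hypothesis supp : forall x y, E x y -> y \in S.
Hypothesis fr : minor_free E S.
Let I := S :\: [set a; b].
Hypothesis IH : forall (E' : rel V) (S' : {set V}) a' b', #|S'| < #|S| ->
  symmetric E' -> irreflexive E' -> a' \in S' -> b' \in S' -> a' != b' ->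
  minor_free E' S' -> cert E' S' a' b'.

(** Outside [Y] the edge xy must already be present in [E1] or be ab, whence [e1xy]; on the side of
    [Y] the certificate itself adds xy, in both orientations. *)
Lemma cut_cert E1 (Y : {set V}) x y : Y \proper I -> Y != set0 ->
  x \in S :\: Y -> y \in S :\: Y -> x != y -> nb E Y \subset [set x; y] ->
  symmetric E1 -> irreflexive E1 -> minor_free E1 (S :\: Y) -> add_edge_rel E1 a b x y ->
  (forall u v, E u v -> E1 u v) -> cert E S a b.
Proof.
move=> YI Y0 xS yS xy nY E1sym E1irr fr1 e1xy EE1.
have YI' := proper_sub YI.
have YS : Y \subset S by apply: subset_trans YI' (subsetDl _ _).
have nbY c : c \in [set a; b] -> c \notin Y.
  by move=> cab; apply/negP => /(subsetP YI'); rewrite in_setD cab.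
have aS1 : a \in S :\: Y by rewrite in_setD nbY ?aS // !inE eqxx.
have bS1 : b \in S :\: Y by rewrite in_setD nbY ?bS // !inE eqxx orbT.
have ltS1 : #|S :\: Y| < #|S|.
  apply: proper_card; rewrite properEneq subsetDl andbT.
  by apply: contraNneq Y0 => /setDidPl; rewrite -setI_eq0 (setIidPr YS).
have SE : S = (S :\: Y) :|: (x |: (y |: Y)).
  move: xS yS; rewrite !in_setD => /andP[_ xS] /andP[_ yS].
  apply/setP => z; rewrite !inE; case: eqVneq => [->|_]; first by rewrite xS orbT.
  case: eqVneq => [->|_] /=; first by rewrite yS orbT.
  by have [/(subsetP YS)->|_] := boolP (z \in Y); [|rewrite orbF].
have S2S : x |: (y |: Y) \subset S.
  by apply/subsetP => z zxy; rewrite SE in_setU zxy orbT.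
have xy2 : [set x; y] = (S :\: Y) :&: (x |: (y |: Y)).
  move: xS yS; rewrite !in_setD => /andP[xY xS] /andP[yY yS].
  apply/setP => z; rewrite !inE; case: eqVneq => [->|_]; first by rewrite xS xY.
  case: eqVneq => [->|_] /=; first by rewrite yS yY.
  by case: (z \in Y); rewrite ?andbF.
(* [Y] is proper in [I], so at least three vertices lie outside it, and [x] and [y] cannot be all of
   them. *)
have ltS2 : #|x |: (y |: Y)| < #|S|.
  apply: proper_card; rewrite properEneq S2S andbT; apply/eqP => e.
  have /properP[_ [z zI zY]] := YI.
  have in2 c : c \in S -> c \notin Y -> (c == x) || (c == y).
    by rewrite -e !inE => /or3P[->|->|->]; rewrite ?orbT.
  move: zI; rewrite in_setD !inE negb_or => /andP[/andP[za zb] zS].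
  move: (in2 z zS zY) (in2 a aS) (in2 b bS).
  rewrite !nbY ?inE ?eqxx ?orbT // => /orP[]/eqP ez /(_ isT)/orP[]/eqP ea /(_ isT)/orP[]/eqP eb;
  by move: za zb ab; rewrite ez ea eb ?eqxx.
have fr2 : minor_free E (x |: (y |: Y)) by apply: minor_free_sub fr.
rewrite SE; apply: (glue (E2 := E) xy (esym xy2) aS1 bS1 E1sym e1xy).
- move=> u v; rewrite -SE => uS vS uv.
  have side p q : p \in Y -> E p q -> q \in x |: (y |: Y).
    move=> pY pq; have [qY|qY] := boolP (q \in Y); first by rewrite !inE qY !orbT.
    have : q \in nb E Y by rewrite inE qY; apply/adj1P; exists p; rewrite // Esym.
    by move/(subsetP nY); rewrite !inE orbA => ->.
  have [uY|uY] := boolP (u \in Y).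
    by rewrite (side u v uY uv) uv !in_setU1 uY !orbT.
  have [vY|vY] := boolP (v \in Y).
    have vu : E v u by rewrite Esym.
    by rewrite (side v u vY vu) uv !in_setU1 vY !orbT.
  by rewrite !in_setD uY vY uS vS /add_edge_rel EE1.
- exact: IH.
- by apply: IH; rewrite // !inE eqxx ?orbT.
- by apply: IH; rewrite // ?inE ?eqxx ?orbT // eq_sym.
Qed.

(** With two neighbours of [Y], the edge xy arises by contracting [Y]. With fewer, the difficulty is
    to find a pair along which to glue without creating a minor: ab itself, an edge already present
    at [x], or an edge added to a very small graph. *)
Lemma cert_step : cert E S a b.
Proof.
have [tri|] := boolP [forall Y : {set V}, (Y \proper I) && (Y != set0) ==> (2 < #|nb E Y|)].
  apply: base => // Y YI Y0; have /forallP/(_ Y) := tri; by rewrite YI Y0.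
move=> /forallPn[Y0]; rewrite negb_imply -leqNgt => /andP[/andP[Y0I /set0Pn[y0 y0Y]] nY0].
(* Contraction needs a connected set, and a component of [Y0] has no neighbours beyond those of
   [Y0]. *)
have [Y [YY0 y0Y' cY nadj]] := component Esym y0Y.
have YI : Y \proper I := sub_proper_trans YY0 Y0I.
have YI' := proper_sub YI.
have YS : Y \subset S := subset_trans YI' (subsetDl _ _).
have Yn0 := conn_neq0 cY.
have nbY c : c \in [set a; b] -> c \notin Y.
  by move=> cab; apply/negP => /(subsetP YI'); rewrite in_setD cab.
have aS1 : a \in S :\: Y by rewrite in_setD nbY ?aS // !inE eqxx.
have bS1 : b \in S :\: Y by rewrite in_setD nbY ?bS // !inE eqxx orbT.
have nYS z : z \in nb E Y -> z \in S :\: Y.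
  rewrite inE in_setD => /andP[-> /adj1P[x xY zx]] /=; rewrite Esym in zx; exact: supp zx.
have nYY0 : nb E Y \subset nb E Y0.
  apply/subsetP => z; rewrite !inE => /andP[zY /adj1P[x xY zx]].
  have -> /= : z \notin Y0.
    by apply: contraNN nadj => zY0; rewrite Esym in zx; apply: (adj_intro zx xY); rewrite in_setD zY.
  by apply/adj1P; exists x; rewrite // (subsetP YY0).
have {nY0 nYY0 y0Y' y0Y YY0 Y0I} nY : #|nb E Y| <= 2 := leq_trans (subset_leq_card nYY0) nY0.
have frY : minor_free E (S :\: Y) by apply: minor_free_sub fr => //; exact: subsetDl.
have E'ab : add_edge_rel E a b a b by rewrite /add_edge_rel !eqxx orbT.
have [n0|[x xN]] := set_0Vmem (nb E Y).
  by apply: (@cut_cert E Y a b) => //; rewrite n0 sub0set.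
have xS1 := nYS x xN.
have [ex|] := boolP [exists y in nb E Y, y != x].
  have /exists_inP[y yN yx] := ex; have yS1 := nYS y yN.
  have nE : nb E Y = [set x; y].
    apply/esym/eqP; rewrite eqEcard subUset !sub1set xN yN cards2 eq_sym yx; exact: nY.
  apply: (@cut_cert (add_edge_rel E x y) Y x y) => //; rewrite 1?eq_sym ?nE //.
  - exact: add_edge_rel_sym.
  - move=> u; rewrite /add_edge_rel Eirr /= andbC orbb.
    by apply: contraNF yx => /andP[/eqP<- /eqP<-].
  - apply: (minor_free_contract (S := S) (Y := Y)) => //; first exact: subsetDl.
    + by rewrite -setI_eq0 setIDA setDIl setDv set0I.
    + by rewrite adj_sym //; move: xN; rewrite inE => /andP[].
    + by rewrite adj_sym //; move: yN; rewrite inE => /andP[].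
  - by rewrite /add_edge_rel !eqxx !orbT.
  - by move=> u v uv; rewrite /add_edge_rel uv.
move=> nx; have nE : nb E Y \subset [set x].
  apply/subsetP => z zN; rewrite inE; apply: contraNT nx => zx.
  by apply/exists_inP; exists z.
have nE2 y : nb E Y \subset [set x; y] by apply: subset_trans nE (subsetUl _ _).
have [xa|xa] := eqVneq x a.
  by apply: (@cut_cert E Y x b) => //; rewrite xa.
have [xb|xb] := eqVneq x b.
  apply: (@cut_cert E Y x a) => //; rewrite xb 1?eq_sym //.
  by rewrite add_edge_rel_sym.
have [/exists_inP[y yS1 xy]|nxy] := boolP [exists y in S :\: Y, E x y].
  apply: (@cut_cert E Y x y) => //; last by rewrite /add_edge_rel xy.
  by apply: contraTneq xy => ->; rewrite Eirr.
have xI : x \in I.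
  by move: xS1; rewrite !in_setD !inE (negbTE xa) (negbTE xb) => /andP[].
have nx0 : nb E (x |: Y) = set0.
  apply/setP => z; rewrite inE in_set0; apply/negP => /andP[zxY /adj1P[w]].
  move: zxY; rewrite in_setU1 negb_or in_setU1 => /andP[zx zY] /orP[/eqP->|wY] zw.
    case/negP: nxy; apply/exists_inP; exists z; last by rewrite Esym.
    by rewrite in_setD zY; apply: supp (_ : E x z); rewrite Esym.
  have : z \in nb E Y by rewrite inE zY; apply/adj1P; exists w.
  by move/(subsetP nE); rewrite inE (negbTE zx).
(* Here [x] and [Y] together have no neighbours: if [I] has other vertices, they are cut off along
   ab; if not, only [a], [b] and [x] lie outside [Y], too few for either minor after adding xa. *)
have [xYI|xYI] := eqVneq (x |: Y) I; last first.
  apply: (@cut_cert E (x |: Y) a b) => //.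
  - by rewrite properEneq xYI subUset sub1set xI.
  - by apply/set0Pn; exists x; rewrite !inE eqxx.
  - by rewrite in_setD in_setU1 negb_or eq_sym xa nbY ?aS // !inE eqxx.
  - by rewrite in_setD in_setU1 negb_or eq_sym xb nbY ?bS // !inE eqxx orbT.
  - by rewrite nx0 sub0set.
  - by apply: minor_free_sub fr => //; exact: subsetDl.
apply: (@cut_cert (add_edge_rel E x a) Y x a) => //.
- exact: add_edge_rel_sym.
- move=> u; rewrite /add_edge_rel Eirr /= andbC orbb.
  by apply: contraNF xa => /andP[/eqP<- /eqP<-].
- apply: minor_free_small; apply: leq_ltn_trans (_ : #|x |: [set a; b]| < _).
    apply: subset_leq_card; apply/subsetP => z; rewrite in_setD => /andP[zY zS].
    rewrite in_setU1; have := in_setU1 z x Y; rewrite xYI (negbTE zY) orbF => <-.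
    by rewrite in_setD zS andbT orNb.
  by rewrite cardsU1 cards2; case: (_ \notin _); case: (_ != _).
- by rewrite /add_edge_rel !eqxx !orbT.
- by move=> u v uv; rewrite /add_edge_rel uv.
Qed.

End Step.

Theorem minor_free_cert (V : finType) (E : rel V) (S : {set V}) a b :
  symmetric E -> irreflexive E -> a \in S -> b \in S -> a != b -> minor_free E S -> cert E S a b.
Proof.
have [n] := ubnP #|S|; elim: n V E S a b => // n IH V E S a b /ltnSE-leSn Esym Eirr aS bS ab fr.
(* [cert_step] wants ab absent and all edges inside [S]; the certificate puts ab back. *)
pose E0 x y := [&& x \in S, y \in S, E x y & ~~ ((x == a) && (y == b) || (x == b) && (y == a))].
apply: (@cert_mono _ _ E0) => [x y xS yS xy|].
  by rewrite /add_edge_rel /E0 xS yS xy /=; case: (x == a); case: (y == b); case: (x == b); case: (y == a).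
apply: cert_step => //.
- by move=> x y; rewrite /E0 Esym andbCA orbC (andbC (y == a)) (andbC (y == b)).
- by move=> x; rewrite /E0 Eirr !andbF.
- by rewrite /E0 !eqxx !andbF.
- by move=> x y /and4P[].
- by apply: minor_free_sub fr => // x y _ _ /and4P[].
- move=> E' S' a' b' lt; apply: IH; exact: leq_trans lt leSn.
Qed.

(** * Minors *)

Lemma conn_im (V W : finType) (E : rel V) (E' : rel W) (h : V -> W) (D : {set V}) :
  (forall x y, x \in D -> y \in D -> E x y -> h x = h y \/ E' (h x) (h y)) ->
  conn E D -> conn E' (h @: D).
Proof.
move=> H cD; have [/set0Pn[d dD] cut] := connP _ _ cD.
apply/connP; split; first by apply/set0Pn; exists (h d); exact: imset_f.
move=> P PD /set0Pn[z zP] nadj; apply/eqP; rewrite eqEsubset PD /=.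
suff AD : D :&: h @^-1: P = D.
  by apply/subsetP => _ /imsetP[x xD ->]; move: xD; rewrite -AD !inE => /andP[].
apply: cut; first exact: subsetIl.
  have /imsetP[x xD zE] := subsetP PD z zP.
  by apply/set0Pn; exists x; rewrite !inE xD -zE.
apply: contra nadj => /adjP[x [y [+ + xy]]].
rewrite !inE => /andP[xD xP] /andP[yP yD]; rewrite yD /= in yP.
have [e|e] := H x y xD yD xy; first by rewrite -e xP in yP.
by apply: (adj_intro e xP); rewrite inE yP imset_f.
Qed.

(** Serves deletion and contraction alike: [h] is the map to the smaller graph, which identifies
    vertices only within a branch set and either keeps or collapses each edge. *)
Lemma model_im (T V W : finType) (e : rel T) (E : rel V) (E' : rel W) (h : V -> W)
  (D : T -> {set V}) : irreflexive e ->
  (forall p, conn E (D p)) ->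
  (forall p q x y, x \in D p -> y \in D q -> h x = h y -> p = q) ->
  (forall p q, e p q -> adj E (D p) (D q)) ->
  (forall p q x y, x \in D p -> y \in D q -> E x y -> h x = h y \/ E' (h x) (h y)) ->
  model e E' [set: W].
Proof.
move=> eirr cD hD aD HE; exists (fun p => h @: D p); split.
- by move=> p; exact: subsetT.
- by move=> p; apply: conn_im (cD p) => x y; exact: HE.
- move=> p q pq; apply/pred0P => z /=; apply/negP => /andP[/imsetP[x xp ->] /imsetP[y yq /(hD p q x y xp yq)]].
  by move/eqP; rewrite (negbTE pq).
- move=> p q epq; have /adjP[x [y [xp yq xy]]] := aD p q epq.
  have [hxy|exy] := HE p q x y xp yq xy.
    by have := hD p q x y xp yq hxy; move: epq => /[swap] ->; rewrite eirr.
  by apply: (adj_intro exy); exact: imset_f.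
Qed.

Lemma bij_minor (H G : sgraph) (f : H -> G) : bijective f ->
  (forall x y, edge x y -> edge (f x) (f y)) -> minor H G.
Proof.
have [n] := ubnP #|[set p : G * G | edge p.1 p.2]|; elim: n G f => // n IH G f /ltnSE-leGn bf fE.
have [/forallP iso|/forallPn[u /forallPn[v]]] :=
  boolP [forall x, forall y, edge (f x) (f y) ==> edge x y].
  apply: minor_iso; exists f => // x y; apply/idP/idP => [xy|/fE//].
  by have /forallP/(_ y)/implyP := iso x; apply.
rewrite negb_imply => /andP[uv nuv].
apply: (minor_del_edge uv); apply: (IH (del_edge (f u) (f v)) f) => //.
  apply: leq_trans leGn; apply: proper_card; apply/properP; split.
    by apply/subsetP => p; rewrite !inE => /andP[].
  exists (f u, f v); first by rewrite inE.
  by rewrite inE /edge /= /same_pair !eqxx andbF.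
move=> x y xy; rewrite /edge /= fE //=.
have fI := bij_inj bf; apply: contra nuv; rewrite /same_pair !(inj_eq fI).
by case/orP => /andP[/eqP<- /eqP<-] //; rewrite edge_sym.
Qed.

(** A vertex outside all branch sets is deleted, and an edge inside a branch set of several vertices
    is contracted; when neither occurs, the branch sets are singletons covering [G], and deleting
    edges is enough. *)
Lemma model_minor (H G : sgraph) (p0 : H) :
  model (@edge H) (@edge G) [set: G] -> minor H G.
Proof.
have [n] := ubnP #|G|; elim: n G => // n IH G /ltnSE-leGn [D [_ cD dD aD]].
have Dne p : exists x, x \in D p by apply/set0Pn; exact: conn_neq0 (cD p).
have dD' p q x : x \in D p -> x \in D q -> p = q.
  move=> xp xq; apply/eqP; apply: contraT => /dD d.
  by have := disjointFr d xp; rewrite xq.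
have ltsub (v : G) : #|{: {x : G | x != v}}| < n.
  have e : #|[pred x | x != v]| = #|predC1 v| by exact: eq_card.
  by rewrite card_sig e cardC1 prednK //; apply/card_gt0P; exists v.
have [/forallP cov|/forallPn[v /existsPn vD]] := boolP [forall v, exists p, v \in D p]; last first.
  have [u0 u0D] := Dne p0.
  have u0v : u0 != v by apply: contraTneq u0D => ->.
  (* An arbitrary default for [insubd]: on the branch sets, which avoid [v], it is the identity. *)
  pose w0 : {x : G | x != v} := exist _ u0 u0v.
  apply: (@minor_del_vertex _ _ v); apply: IH; first exact: ltsub.
  have hE p x : x \in D p -> val (insubd w0 x) = x.
    by move=> xp; rewrite insubdK // unfold_in; apply: contraTneq xp => ->.
  apply: (@model_im _ _ _ _ _ (@edge (del_vertex v)) (insubd w0) D) => //.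
  - exact: edge_irrefl.
  - move=> p q x y xp yq /(congr1 val); rewrite !(hE p x) ?(hE q y) // => e.
    by apply: dD' xp _; rewrite e.
  - by move=> p q x y xp yq xy; right; rewrite /edge /= (hE p x) ?(hE q y).
have [/forallP one|/forallPn[p]] := boolP [forall p, #|D p| == 1]; last first.
  have [u uD] := Dne p => cDp.
  have [y yD yu] : exists2 y, y \in D p & y != u.
    apply/exists_inP; apply: contraNT cDp => /exists_inPn h.
    apply/cards1P; exists u; apply/setP => y; rewrite inE.
    by apply/idP/eqP => [/h/negPn/eqP//|->].
  have cu := cD p; have /adjP[_ [v [/set1P-> vD uv]]] : adj edge [set u] (D p :\: [set u]).
    by apply: (conn_cut cu _ _ yD); rewrite ?sub1set ?inE.
  move: vD; rewrite in_setD1 => /andP[vu vD]; have uv' : u != v by rewrite eq_sym.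
  (* With [u] as default, [insubd w0] is the contraction map sending [v] to [u]. *)
  pose w0 : {x : G | x != v} := exist _ u uv'.
  apply: (minor_contract_edge uv); apply: IH; first exact: ltsub.
  have hE x : val (insubd w0 x) = if x == v then u else x.
    by rewrite val_insubd; case: (x == v).
  apply: (@model_im _ _ _ _ _ (@edge (contract_edge u v)) (insubd w0) D) => //.
  - exact: edge_irrefl.
  - move=> q q' x z xq zq /(congr1 val); rewrite !hE.
    have [xv|xv] := eqVneq x v; have [zv|zv] := eqVneq z v => e.
    + by apply: dD' xq _; rewrite xv -zv.
    + by rewrite xv in xq; rewrite (dD' _ _ _ xq vD) (dD' _ _ _ zq (_ : z \in D p)) // -e.
    + by rewrite zv in zq; rewrite (dD' _ _ _ zq vD) (dD' _ _ _ xq (_ : x \in D p)) // e.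
    + by apply: dD' xq _; rewrite e.
  - move=> q q' x z xq zq xz.
    have [e|e] := eqVneq (insubd w0 x) (insubd w0 z); first by left.
    right; rewrite /edge /= e /= !hE.
    have [xv|xv] := eqVneq x v; have [zv|zv] := eqVneq z v.
    + by rewrite xv zv edge_irrefl in xz.
    + by move: xz; rewrite xv eqxx => ->; rewrite orbT.
    + by move: xz; rewrite zv eqxx edge_sym => ->; rewrite !orbT.
    + by rewrite xz.
have fP p : exists x, D p == [set x] by have /cards1P[x ->] := one p; exists x.
have [f fE] := fin_all_exists fP.
apply: (@bij_minor _ _ f).
  have finj : injective f.
    by move=> p q pq; apply: (dD' p q (f p)); rewrite (eqP (fE _)) inE // pq.
  apply: (inj_card_bij finj).
  rewrite -(card_imset predT finj) subset_leq_card //; apply/subsetP => x _.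
  have /existsP[p] := cov x; rewrite (eqP (fE p)) inE => /eqP->; exact: imset_f.
move=> p q /aD /adjP[x [y []]]; rewrite (eqP (fE p)) (eqP (fE q)) !inE.
by move=> /eqP-> /eqP->.
Qed.

Lemma isomorphic_sym (G H : sgraph) : isomorphic G H -> isomorphic H G.
Proof.
case=> f [g fK gK] fE; exists g; first by exists f.
by move=> x y; rewrite -fE !gK.
Qed.

Definition arcs (G : sgraph) : {set G * G} := finset (fun q : G * G => edge q.1 q.2).

Lemma iso_card (G H : sgraph) : isomorphic G H -> #|G| = #|H| /\ #|arcs G| = #|arcs H|.
Proof.
case=> f [g fK gK] fE; split; first by apply: bij_eq_card; exists g.
rewrite -(card_imset (mem (arcs G)) (f := fun q => (f q.1, f q.2))); last first.
  by move=> [x y] [x' y'] /= [/(can_inj fK)-> /(can_inj fK)->].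
apply: eq_card => -[x y]; rewrite inE /=; apply/imsetP/idP => [[[x' y']] /=|xy].
  by rewrite inE /= -fE => xy [-> ->].
by exists (g x, g y); rewrite ?inE /= ?gK // -fE !gK.
Qed.

Lemma card_sub_neq (G : sgraph) (v : G) : #|{: {x : G | x != v}}| = #|G|.-1.
Proof.
by rewrite card_sig -(cardC1 v); apply: eq_card.
Qed.

(** Deletions and contractions lower the number of vertices, or keep it and lower the number of
    arcs, and they never raise either; equality of both counts leaves only an isomorphism. *)
Lemma minor_card (H G : sgraph) : minor H G ->
  [/\ #|H| <= #|G|, #|arcs H| <= #|arcs G| &
      #|H| = #|G| -> #|arcs H| = #|arcs G| -> isomorphic H G].
Proof.
have pred_lt (K : sgraph) (v : K) n : n <= #|K|.-1 -> n < #|K|.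
  by move=> h; apply: leq_ltn_trans h _; rewrite prednK //; apply/card_gt0P; exists v.
elim=> [{}G iso|{}G v _ [cV cE _]|{}G u v uv _ [cV cE _]|{}G u v uv _ [cV cE _]].
- by have [-> ->] := iso_card iso.
- rewrite card_sub_neq in cV; have lt := pred_lt _ v _ cV.
  split; [exact: ltnW| |by move=> e; rewrite e ltnn in lt].
  apply: leq_trans cE _; rewrite -(card_imset (mem (arcs (del_vertex v))) (f := fun q => (val q.1, val q.2))).
    apply: subset_leq_card; apply/subsetP => _ /imsetP[[x y] + ->]; by rewrite !inE.
  by move=> [x y] [x' y'] /= [/val_inj-> /val_inj->].
- have lt : #|arcs (del_edge u v)| < #|arcs G|.
    apply: proper_card; apply/properP; split; first by apply/subsetP => q; rewrite !inE => /andP[].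
    by exists (u, v); rewrite !inE //= /edge /= /same_pair !eqxx andbF.
  split=> //; first exact: leq_trans cE (ltnW lt).
  by move=> _ e; rewrite e leqNgt lt in cE.
- rewrite card_sub_neq in cV; have lt := pred_lt _ v _ cV.
  split; [exact: ltnW| |by move=> e; rewrite e ltnn in lt].
  apply: leq_trans cE _; pose h x := if x == v then u else x.
  rewrite -(card_imset (mem (arcs (contract_edge u v))) (f := fun q => (val q.1, val q.2))); last first.
    by move=> [x y] [x' y'] /= [/val_inj-> /val_inj->].
  (* Each arc of the contracted graph is the image under [h] of an arc of [G]. *)
  apply: leq_trans (leq_imset_card (fun q => (h q.1, h q.2)) (mem (arcs G))).
  apply: subset_leq_card; apply/subsetP => _ /imsetP[[x y] + ->] /=.
  have hx (z : {x : G | x != v}) : h (val z) = val z by rewrite /h (negbTE (valP z)).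
  have hv : h v = u by rewrite /h eqxx.
  rewrite inE /= => /andP[_ /or3P[xy|/andP[/eqP xu vy]|/andP[/eqP yu vx]]]; apply/imsetP.
  + by exists (val x, val y); rewrite ?inE //= !hx.
  + by exists (v, val y); rewrite ?inE //= hx hv xu.
  + by exists (val x, v); rewrite ?inE //= ?hx ?hv ?yu // edge_sym.
Qed.

Lemma arcs_sum (G : sgraph) : #|arcs G| = \sum_(x : G) \sum_(y : G) (edge x y : nat).
Proof.
rewrite -sum1_card pair_big big_mkcond /=; apply: eq_bigr => q _.
by rewrite inE; case: edge.
Qed.

(** Arcs are ordered pairs, so 18 is twice the 9 edges of K5^-, as 16 below is twice the 8 edges of
    K33^-. K33^- has more vertices and K5^- more edges, so neither is a minor of the other. *)
Lemma card_K5_minus : #|K5_minus| = 5 /\ #|arcs K5_minus| = 18.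
Proof.
split; first exact: card_ord.
rewrite arcs_sum; rewrite !big_ord_recl !big_ord0.
reflexivity.
Qed.

Lemma card_K33_minus : #|K33_minus| = 6 /\ #|arcs K33_minus| = 16.
Proof.
split; first by rewrite card_sum !card_ord.
rewrite arcs_sum !big_sumType /= !big_ord_recl !big_ord0 !big_sumType !big_ord_recl !big_ord0.
reflexivity.
Qed.

Lemma k33mE : k33m =2 @edge K33_minus.
Proof.
by move=> [i|i] [j|j] //=; rewrite /same_pair /= ?orbF negb_and // orbC.
Qed.

Lemma k33m_minor (G : sgraph) : model k33m (@edge G) [set: G] -> minor K33_minus G.
Proof.
case=> D [DS cD dD aD]; apply: (@model_minor K33_minus _ (inl ord0)); exists D; split=> // p q.
by rewrite -k33mE; exact: aD.
Qed.

Lemma k5m_minor (G : sgraph) : model k5m (@edge G) [set: G] -> minor K5_minus G.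
Proof. exact: (@model_minor K5_minus _ ord0). Qed.

Lemma minor_K5_minus (G H : sgraph) : minor K5_minus H \/ minor K33_minus H ->
  minor H G -> isomorphic G K5_minus -> isomorphic H G.
Proof.
move=> min HG /iso_card[cV cE]; have [hV hE heq] := minor_card HG.
have [k5V k5E] := card_K5_minus; have [k33V _] := card_K33_minus.
case: min => /minor_card[mV mE _]; last by have := leq_trans mV hV; rewrite k33V cV k5V.
by apply: heq; apply/eqP; rewrite eqn_leq ?hV ?hE ?cV ?cE.
Qed.

Lemma minor_K33_minus (G H : sgraph) : minor K5_minus H \/ minor K33_minus H ->
  minor H G -> isomorphic G K33_minus -> isomorphic H G.
Proof.
move=> min HG /iso_card[cV cE]; have [hV hE heq] := minor_card HG.
have [_ k5E] := card_K5_minus; have [_ k33E] := card_K33_minus.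
case: min => /minor_card[mV mE _]; first by have := leq_trans mE hE; rewrite k5E cE k33E.
by apply: heq; apply/eqP; rewrite eqn_leq ?hV ?hE ?cV ?cE.
Qed.

From mathcomp Require Import all_order all_algebra.
From mathcomp Require Import all_classical all_reals all_analysis.
From mathcomp Require Import ring lra.
Import Order.TTheory GRing.Theory Num.Theory numFieldNormedType.Exports.

Local Open Scope ring_scope.

(** * Drawing a realizer *)

Section Drawing.
Variables (R : realType) (G : sgraph) (r : 'I_3 -> G -> nat).
Hypothesis sep : forall u v : G, u != v -> exists c, (r c v < r c u)%N.
Hypothesis beat : forall u v w : G, edge u v -> w != u -> w != v ->
  exists c, (r c u < r c w)%N && (r c v < r c w)%N.
Implicit Types (u v w x y : G) (i c : 'I_3) (s t k l m : R).

Let rr i u : R := (r i u)%:R.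
Let top i u v := Num.max (rr i u) (rr i v).

(* The edge uv is routed through the coordinatewise maximum of u and v in R^3,
   and everything is projected along (1, 1, 1). *)
Definition ramp t := (1 - t *+ 2 + `|1 - t *+ 2|) / 2.

Definition space_arc u v t i :=
  top i u v - ramp t * (top i u v - rr i u) - ramp (1 - t) * (top i u v - rr i v).

Let j0 : 'I_3 := ord0.
Let j1 : 'I_3 := @Ordinal 3 1 isT.
Let j2 : 'I_3 := @Ordinal 3 2 isT.

Definition arc u v t : R * R :=
  (space_arc u v t j0 - space_arc u v t j2, space_arc u v t j1 - space_arc u v t j2).

Definition point u : R * R := (rr j0 u - rr j2 u, rr j1 u - rr j2 u).

(** Half of the edge in R^3: a segment from [u] to the coordinatewise maximum of [u] and [v],
    reached at [l] = 1. *)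
Definition half u v l i := rr i u + l * (top i u v - rr i u).

Lemma topC i u v : top i u v = top i v u.
Proof. exact: maxC. Qed.

Lemma ramp_lo t : t <= 2^-1 -> ramp t = 1 - t *+ 2 /\ ramp (1 - t) = 0.
Proof.
move=> t2; have h : 0 <= 1 - t *+ 2 by lra.
have h' : 1 - (1 - t) *+ 2 = - (1 - t *+ 2) by ring.
rewrite /ramp h' normrN (ger0_norm h); split; by field.
Qed.

Lemma space_arc_rev u v t i : space_arc v u (1 - t) i = space_arc u v t i.
Proof.
have e : 1 - (1 - t) = t by ring.
by rewrite /space_arc (topC i v u) e; ring.
Qed.

Lemma space_arc_lo u v t i : t <= 2^-1 -> space_arc u v t i = half u v (t *+ 2) i.
Proof. by move=> /ramp_lo[e1 e2]; rewrite /space_arc e1 e2 /half; ring. Qed.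

Lemma interior_half u v t : 0 < t < 1 -> exists l, 0 < l <= 1 /\
  ((forall i, space_arc u v t i = half u v l i) \/
   (forall i, space_arc u v t i = half v u l i)).
Proof.
move=> /andP[t0 t1]; case: (lerP t 2^-1) => t2.
  exists (t *+ 2); split; first by apply/andP; split; lra.
  by left=> i; rewrite space_arc_lo.
exists ((1 - t) *+ 2); split; first by apply/andP; split; lra.
by right=> i; rewrite -space_arc_rev space_arc_lo //; lra.
Qed.

Lemma space_arc0 u v i : space_arc u v 0 i = rr i u.
Proof. by rewrite space_arc_lo ?/half; [rewrite mul0rn mul0r addr0|lra]. Qed.

Lemma space_arc1 u v i : space_arc u v 1 i = rr i v.
Proof. by rewrite -space_arc_rev subrr space_arc0. Qed.

Lemma half_ge u v l i : 0 <= l -> rr i u <= half u v l i.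
Proof.
by move=> l0; rewrite /half lerDl mulr_ge0 // subr_ge0 /top le_max lexx.
Qed.

Lemma half_le u v l i : 0 <= l <= 1 -> half u v l i <= top i u v.
Proof.
move=> /andP[l0 l1]; have h : rr i u <= top i u v by rewrite /top le_max lexx.
rewrite /half; nra.
Qed.

Lemma top_lt i u v w : (r i u < r i w)%N && (r i v < r i w)%N -> top i u v < rr i w.
Proof. by move=> /andP[uw vw]; rewrite /top gt_max /rr !ltr_nat uw vw. Qed.

(** The fibres of the projection are the lines of direction (1, 1, 1). *)
Lemma pairE (p q : 'I_3 -> R) :
  (p j0 - p j2, p j1 - p j2) = (q j0 - q j2, q j1 - q j2) ->
  exists k, forall i, p i = q i + k.
Proof.
case=> e0 e1; exists (p j2 - q j2) => -[[|[|[|//]]] H].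
- have -> : Ordinal H = j0 by exact: val_inj.
  by lra.
- have -> : Ordinal H = j1 by exact: val_inj.
  by lra.
- have -> : Ordinal H = j2 by exact: val_inj.
  by lra.
Qed.

(** Exchanging the edges allows [k] to be taken nonnegative. If [x] is not an end of uv, it lies
    above both ends in some coordinate, which contradicts the sign. If it is a common end, a
    coordinate where it exceeds the other end of uv forces [k] = 0, and the coordinates in which
    third vertices beat the edges finish. *)
Lemma half_disjoint u v x y l m k : edge u v -> edge x y -> ~~ same_pair u v x y ->
  0 < l <= 1 -> 0 < m <= 1 -> 0 <= k -> (forall i, half u v l i = half x y m i + k) -> False.
Proof.
move=> uv xy nuv l01 m01 k0 e.
have [l0 l1] := andP l01; have [m0 m1] := andP m01.
have l01' : 0 <= l <= 1 by rewrite ltW.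
have m01' : 0 <= m <= 1 by rewrite ltW.
have uvn : u != v by apply: contraTneq uv => ->; rewrite edge_irrefl.
have [xu|xu] := eqVneq x u; last have [xv|xv] := eqVneq x v; last first.
- have [c /top_lt lt] := beat uv xu xv; have := half_le u v c l01'.
  by have := half_ge x y c (ltW m0); have := e c; lra.
- subst x; have yu : y != u by apply: contraNneq nuv => ->; rewrite /same_pair !eqxx orbT.
  have [i] := sep xu; rewrite -(ltr_nat R) -/(rr i u) -/(rr i v) => lt.
  have := half_le u v i l01'; have := half_ge v y i (ltW m0); rewrite /top (max_r (ltW lt)) => h1 h2.
  have k00 : k = 0 by apply/eqP; rewrite eq_le k0 andbT; have := e i; lra.
  have [|c /top_lt lt'] := beat xy uvn; first by rewrite eq_sym.
  have := half_le v y c m01'; have := half_ge u v c (ltW l0).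
  by have := e c; rewrite k00 addr0; lra.
subst x; have yv : y != v by apply: contraNneq nuv => ->; rewrite /same_pair !eqxx.
have yun : y != u by apply: contraTneq xy => ->; rewrite edge_irrefl.
have [i] := sep uvn; rewrite -(ltr_nat R) -/(rr i u) -/(rr i v) => lt.
have := half_ge u y i (ltW m0); have := half_le u v i l01'; rewrite /top (max_l (ltW lt)) => h1 h2.
have k00 : k = 0 by apply/eqP; rewrite eq_le k0 andbT; have := e i; lra.
have [c /top_lt lc] := beat uv yun yv.
have vu : v != u by rewrite eq_sym.
have vy : v != y by rewrite eq_sym.
have [d /top_lt ld] := beat xy vu vy.
have uc : rr c u <= top c u v by rewrite /top le_max lexx.
have ud : rr d u <= top d u y by rewrite /top le_max lexx.
have yc : rr c y <= top c u y by rewrite /top le_max lexx orbT.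
have vd : rr d v <= top d u v by rewrite /top le_max lexx orbT.
(* Both halves start at [u]. In coordinate [c] the bend of uy is higher than that of uv, so [m] <
   [l]; in coordinate [d] it is the other way round. *)
have := e c; have := e d; rewrite k00 !addr0 /half => /addrI ed /addrI ec.
have [lm|ml] := lerP l m; nra.
Qed.

Lemma arc_continuous u v : continuous (arc u v).
Proof.
have clin : continuous (fun t : R => 1 - t *+ 2).
  move=> t; apply: cvgB; first exact: cvg_cst.
  by under eq_fun do rewrite mulr2n; apply: cvgD; exact: cvg_id.
have cr : continuous ramp.
  move=> t; apply: cvgM; last exact: cvg_cst.
  by apply: cvgD; [exact: clin|apply: cvg_norm; exact: clin].
have cr' : continuous (fun t : R => ramp (1 - t)).
  move=> t; apply: (@continuous_comp _ _ _ (fun t : R => 1 - t) ramp); last exact: cr.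
  by apply: cvgB; [exact: cvg_cst|exact: cvg_id].
have cs i : continuous (fun t => space_arc u v t i).
  move=> t; apply: cvgB; first apply: cvgB; first exact: cvg_cst.
    by apply: cvgM; [exact: cr|exact: cvg_cst].
  by apply: cvgM; [exact: cr'|exact: cvg_cst].
have cd i j : continuous (fun t => space_arc u v t i - space_arc u v t j).
  by move=> t; apply: cvgB; exact: cs.
by move=> t; exact: (cvg_pair (cd j0 j2 t) (cd j1 j2 t)).
Qed.

(** One coordinate depends only on [ramp t] and another only on [ramp (1 - t)]. These vary in
    opposite directions, so the shift along (1, 1, 1) vanishes, and [t] is recovered from their
    difference 1 - 2t. *)
Lemma arc_inj u v s t : edge u v -> arc u v s = arc u v t -> s = t.
Proof.
move=> uv /pairE[k e].
have uvn : u != v by apply: contraTneq uv => ->; rewrite edge_irrefl.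
have [c] := sep uvn; have [d] : exists d, (r d u < r d v)%N by apply: sep; rewrite eq_sym.
rewrite -!(ltr_nat R) -!/(rr _ _) => ltd ltc.
have := e c; have := e d; rewrite /space_arc /top (max_l (ltW ltc)) (max_r (ltW ltd)) !subrr !mulr0 !subr0.
have rd p : ramp p - ramp (1 - p) = 1 - p *+ 2.
  have h' : 1 - (1 - p) *+ 2 = - (1 - p *+ 2) by ring.
  by rewrite /ramp h' normrN; field.
have rm p q : p <= q -> ramp q <= ramp p.
  move=> pq; rewrite /ramp; apply: ler_wpM2r; first by rewrite invr_ge0.
  by case: (ger0P (1 - p *+ 2)) => ?; case: (ger0P (1 - q *+ 2)) => ?; lra.
move=> ed ec.
suff [e1 e2] : ramp s = ramp t /\ ramp (1 - s) = ramp (1 - t).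
  by have := rd s; have := rd t; rewrite e1 e2; lra.
have p0 : 0 < rr c u - rr c v by rewrite subr_gt0.
have q0 : 0 < rr d v - rr d u by rewrite subr_gt0.
have kc : (ramp (1 - t) - ramp (1 - s)) * (rr c u - rr c v) = k by lra.
have kd : (ramp t - ramp s) * (rr d v - rr d u) = k by lra.
have k0 : k = 0.
  have [st|ts] := lerP s t.
    have h1 := rm _ _ st; have h2 : ramp (1 - s) <= ramp (1 - t) by apply: rm; lra.
    by apply/eqP; rewrite eq_le -{1}kd -{1}kc mulr_le0_ge0 ?mulr_ge0 ?(ltW p0) ?(ltW q0) //; lra.
  have h1 := rm _ _ (ltW ts); have h2 : ramp (1 - t) <= ramp (1 - s) by apply: rm; lra.
  by apply/eqP; rewrite eq_le -{1}kc -{1}kd mulr_le0_ge0 ?mulr_ge0 ?(ltW p0) ?(ltW q0) //; lra.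
move: kc kd; rewrite k0 => /eqP; rewrite mulf_eq0 (gt_eqF p0) orbF => /eqP h1.
by move=> /eqP; rewrite mulf_eq0 (gt_eqF q0) orbF => /eqP h2; split; lra.
Qed.

Lemma realizer_planar : planar R G.
Proof.
exists point, arc; split.
- move=> x y /(@pairE (fun i => rr i x) (fun i => rr i y))[k e].
  apply/eqP; apply: contraT => xy.
  have [c] := sep xy; have [d] : exists d, (r d x < r d y)%N by apply: sep; rewrite eq_sym.
  by rewrite -!(ltr_nat R) -!/(rr _ _); have := e c; have := e d; lra.
- by move=> x y _; apply: continuous_subspaceT; exact: arc_continuous.
- by move=> x y xy s t _ _; exact: arc_inj.
- by move=> x y _; rewrite /arc !space_arc0.
- by move=> x y _; rewrite /arc !space_arc1.
- by move=> x y _ t _; rewrite /arc !(space_arc_rev y x).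
- move=> x y z xy t; rewrite in_itv /= => t01 zE; have [t0 t1] := andP t01.
  have zx : z != x.
    apply/eqP => zx; move: zE; rewrite zx => zE.
    have : t = 0 by apply: (arc_inj xy); rewrite zE /arc !space_arc0.
    by move/eqP; rewrite (gt_eqF t0).
  have zy : z != y.
    apply/eqP => zy; move: zE; rewrite zy => zE.
    have : t = 1 by apply: (arc_inj xy); rewrite zE /arc !space_arc1.
    by move/eqP; rewrite (lt_eqF t1).
  have [k e] := @pairE (space_arc x y t) (fun i => rr i z) zE.
  have [l [/andP[l0 l1] he]] := interior_half x y t01.
  have l01 : 0 <= l <= 1 by rewrite ltW.
  have [c /top_lt ltc] := beat xy zx zy.
  have k0 : k < 0.
    have := e c; case: he => ->; [have := half_le x y c l01|have := half_le y x c l01];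
    by rewrite ?(topC c y x); lra.
  have xz : x != z by rewrite eq_sym.
  have yz : y != z by rewrite eq_sym.
  case: he => he; [have [i] := sep xz|have [i] := sep yz];
    rewrite -(ltr_nat R) -!/(rr _ _) => lti; have := e i; rewrite he.
  - by have := half_ge x y i (ltW l0); lra.
  - by have := half_ge y x i (ltW l0); lra.
- move=> x y x' y' xy xy' n s t; rewrite !in_itv /= => s01 t01 /pairE[k e].
  have [l [l01 hl]] := interior_half x y s01.
  have [m [m01 hm]] := interior_half x' y' t01.
  have yx : edge y x by rewrite edge_sym.
  have yx' : edge y' x' by rewrite edge_sym.
  have nC u v u' v' : ~~ same_pair u v u' v' -> ~~ same_pair u' v' u v.
    by rewrite /same_pair (eq_sym u') (eq_sym v') (eq_sym u' v) (eq_sym v' u) (andbC (v == _)).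
  have nL u v u' v' : ~~ same_pair u v u' v' -> ~~ same_pair v u u' v'.
    by rewrite same_pairC.
  have [u [v [uv nuv {}hl]]] : exists u v, [/\ edge u v, ~~ same_pair u v x' y' &
      forall i, space_arc x y s i = half u v l i].
    by case: hl => hl; [exists x, y|exists y, x; split=> //; exact: nL].
  have [u' [v' [uv' nuv' {}hm]]] : exists u' v', [/\ edge u' v', ~~ same_pair u' v' u v &
      forall i, space_arc x' y' t i = half u' v' m i].
    by case: hm => hm; [exists x', y'|exists y', x']; split=> //; rewrite ?[in same_pair y' _ _ _]same_pairC nC.
  have {}e i : half u v l i = half u' v' m i + k by rewrite -hl -hm.
  have [k0|k0] := lerP 0 k.
    by apply: (half_disjoint uv uv' _ l01 m01 k0 e); exact: nC.
  apply: (half_disjoint uv' uv nuv' m01 l01 (_ : 0 <= - k)) => [|i]; first by rewrite oppr_ge0 ltW.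
  by rewrite e addrK.
Qed.

End Drawing.

(** * Nonplanarity of K5 and K33 *)

Local Open Scope classical_set_scope.

Section Turning.
Variable R : realType.
Implicit Types (a b d g : R * R) (s t : R).

Definition dot a b := a.1 * b.1 + a.2 * b.2.

(** A half-open upper half-plane: of a nonzero vector and its opposite exactly one is [up]. *)
Definition up a := (0 < a.2) || (a.2 == 0) && (0 < a.1).

(* Counterclockwise half-turns from a to b, when the angle is acute: the
   horizontal axis is crossed on the side of a. *)
Definition turn a b : int := ((up b)%:Z - (up a)%:Z) * (if 0 < a.1 then 1 else -1).

Lemma up_opp a : a != 0 -> up (- a) = ~~ up a.
Proof.
case: a => x y a0; rewrite /up /= oppr_gt0 oppr_eq0 oppr_gt0.
have [yn|yp|y0] := ltgtP y 0 => //=.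
have x0 : x != 0 by apply: contra a0 => /eqP x0; rewrite x0 y0.
by rewrite -leNgt le_eqVlt (negbTE x0).
Qed.

Lemma up_neq0 a b : up a -> ~~ up b -> 0 < dot a b -> 0 < a.1 * b.1.
Proof.
rewrite /up /dot => ua ub d.
have a2 : 0 <= a.2 by case/orP: ua => [/ltW//|/andP[/eqP-> _]].
have b2 : b.2 <= 0 by move: ub; rewrite negb_or -leNgt => /andP[].
by have := mulr_ge0_le0 a2 b2; lra.
Qed.

Lemma side a b : up a != up b -> 0 < dot a b -> (0 < a.1) = (0 < b.1).
Proof.
move=> ne d; have h : 0 < a.1 * b.1.
  case ua: (up a) ne => ub.
    by apply: up_neq0 d => //; rewrite ua // ; case: (up b) ub.
  rewrite mulrC; apply: up_neq0; rewrite ?ua //; first by case: (up b) ub.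
  by rewrite /dot mulrC (mulrC b.2).
by rewrite -(pmulr_rgt0 a.1 h); nra.
Qed.

Lemma dot_neq0 a b : 0 < dot a b -> a != 0.
Proof. by apply: contraTneq => ->; rewrite /dot !mul0r addr0 ltxx. Qed.

Lemma dotC a b : dot a b = dot b a.
Proof. by rewrite /dot mulrC (mulrC a.2). Qed.

(** Passing to opposites reverses both the change of [up] and the side of the axis, so the signs
    cancel; thus a difference of points may be read from either arc. *)
Lemma turn_opp a b : 0 < dot a b -> turn (- a) (- b) = turn a b.
Proof.
move=> d; have a0 := dot_neq0 d; have b0 : b != 0 by apply: (@dot_neq0 b a); rewrite dotC.
rewrite /turn !up_opp //; case ua: (up a); case ub: (up b); rewrite ?subrr ?mul0r //.
all: have a1 : a.1 != 0.
1,3: have : 0 < a.1 * b.1 by [apply: up_neq0; rewrite ?ua ?ub|rewrite mulrC; apply: up_neq0; rewrite ?ua ?ub // dotC].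
1,2: by apply: contraTneq => ->; rewrite mul0r ltxx.
all: rewrite /= oppr_gt0; case: ltgtP a1 => // _ _; by [].
Qed.

Lemma turn_cocycle a b d : 0 < dot a b -> 0 < dot b d -> 0 < dot a d ->
  turn a b + turn b d = turn a d.
Proof.
move=> ab bd ad; rewrite /turn; have [e|ne] := eqVneq (up a) (up b).
  rewrite e subrr mul0r add0r; have [->|ne] := eqVneq (up b) (up d); first by rewrite subrr !mul0r.
  by rewrite (side ne bd) -(side _ ad) ?e.
rewrite -(side ne ab) -mulrDl; congr (_ * _); ring.
Qed.

(** An integer equation with an explicit witness rather than a congruence, so that the relation for
    the whole square can be halved in [drawing_parity]. *)
Lemma turn_parity a b : exists w : int, turn a b = w *+ 2 + (up b)%:Z - (up a)%:Z.
Proof.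
rewrite /turn; case: ifP => _; first by exists 0; rewrite mulr1 mul0rn add0r.
by exists ((up a)%:Z - (up b)%:Z); rewrite mulrN1; ring.
Qed.

Lemma sum_turn_parity (f : nat -> R * R) n : exists w : int,
  \sum_(i < n) turn (f i) (f i.+1) = w *+ 2 + (up (f n))%:Z - (up (f 0%N))%:Z.
Proof.
elim: n => [|n [w IH]]; first by exists 0; rewrite big_ord0; ring.
have [w' e] := turn_parity (f n) (f n.+1).
by exists (w + w'); rewrite big_ord_recr /= IH e; ring.
Qed.

(** A discrete Stokes formula: the two ways around each cell agree, hence also the two ways around
    the grid. *)
Lemma grid_sum (hor ver : nat -> nat -> int) n m :
  (forall i j, (i < n)%N -> (j < m)%N -> hor i j + ver i.+1 j = ver i j + hor i j.+1) ->
  \sum_(i < n) hor i 0%N + \sum_(j < m) ver n j = \sum_(j < m) ver 0%N j + \sum_(i < n) hor i m.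
Proof.
elim: m => [|m IH] H; first by rewrite !big_ord0 addr0 add0r.
rewrite !big_ord_recr /= addrA IH; last by move=> i j ni jm; apply: H => //; exact: ltnW.
suff e : \sum_(i < n) hor i m + ver n m = ver 0%N m + \sum_(i < n) hor i m.+1.
  by rewrite -!addrA e.
have : forall i, (i < n)%N -> hor i m + ver i.+1 m = ver i m + hor i m.+1 by move=> i ni; exact: H.
elim: (n) => [|k IHk] Hk; first by rewrite !big_ord0 addr0 add0r.
have IHk' := IHk (fun i ik => Hk i (ltnW ik)).
rewrite !big_ord_recr /= -addrA Hk // addrA IHk' addrA //.
Qed.

Lemma grid_turn (e f : nat -> R * R) n m :
  (forall i i' j j', (i <= i' <= i.+1)%N -> (j <= j' <= j.+1)%N -> (i' <= n)%N -> (j' <= m)%N ->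
     0 < dot (f j - e i) (f j' - e i')) ->
  \sum_(i < n) turn (e i - f 0%N) (e i.+1 - f 0%N) + \sum_(j < m) turn (f j - e n) (f j.+1 - e n) =
  \sum_(j < m) turn (f j - e 0%N) (f j.+1 - e 0%N) + \sum_(i < n) turn (e i - f m) (e i.+1 - f m).
Proof.
move=> H; pose F i j := f j - e i.
have := @grid_sum (fun i j => turn (F i j) (F i.+1 j)) (fun i j => turn (F i j) (F i j.+1)) n m.
have neg j : (j <= m)%N -> \sum_(i < n) turn (e i - f j) (e i.+1 - f j) = \sum_(i < n) turn (F i j) (F i.+1 j).
  move=> jm; apply: eq_bigr => i _; have opp k : e k - f j = - F k j by rewrite /F opprB.
  by rewrite !opp turn_opp //; apply: H; rewrite ?leqnn ?leqnSn.
rewrite !neg //; apply=> i j ni jm.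
by rewrite !turn_cocycle //; apply: H; rewrite ?leqnn ?leqnSn // ltnW.
Qed.

(** * A fine mesh for disjoint arcs, by compactness *)

Lemma unit_cover (P : nat -> R -> Prop) :
  (forall s0, 0 <= s0 <= 1 -> exists2 d : R, 0 < d & exists N, forall s n, 0 <= s <= 1 ->
     `|s - s0| < d -> (N <= n)%N -> P n s) ->
  exists N, forall n s, (N <= n)%N -> 0 <= s <= 1 -> P n s.
Proof.
move=> H; have /compact_near_coveringP/near_covering_withinP cov := @segment_compact R 0 1.
have [|N _ HN] := cov nat \oo P _.
  move=> s0; rewrite /= in_itv /= => /H[d d0 [N HN]].
  exists (ball s0 d, [set n | (N <= n)%N]).
    by split; [exact: nbhsx_ballx|exists N].
  by move=> [s n] /= [bs Nn]; rewrite in_itv /= => s01; apply: HN; rewrite // distrC.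
by exists N => n s Nn s01; apply: (HN n) => //; rewrite /= in_itv.
Qed.

(** With [p] a nonzero coordinate of [g] and tolerance |p|/4, that coordinate contributes at least
    9/16 p^2 and the other at least -(x' - y')^2/4, which exceeds -1/16 p^2. *)
Lemma dot_open g : g != 0 -> exists2 d : R, 0 < d & forall a b,
  `|a.1 - g.1| < d -> `|a.2 - g.2| < d -> `|b.1 - g.1| < d -> `|b.2 - g.2| < d -> 0 < dot a b.
Proof.
case: g => g1 g2 g0 /=; rewrite /dot.
have key (p q x y x' y' : R) : 0 < `|p| -> `|x - p| < `|p| / 4 -> `|x' - q| < `|p| / 4 ->
    `|y - p| < `|p| / 4 -> `|y' - q| < `|p| / 4 -> 0 < x * y + x' * y'.
  move=> p0; rewrite !ltr_norml => /andP[x1 x2] /andP[x3 x4] /andP[y1 y2] /andP[y3 y4].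
  have h1 : (`|p| * 3 / 4) ^+ 2 <= x * y.
    move: x1 x2 y1 y2; case: ger0P p0 => _ p0 x1 x2 y1 y2.
      by rewrite expr2 ler_pM //; lra.
    by rewrite -[x * y]mulrNN expr2 ler_pM //; lra.
  have h2 : 0 <= (`|p| / 2 - (x' - y')) * (`|p| / 2 + (x' - y')) by rewrite mulr_ge0 //; lra.
  have h3 := sqr_ge0 (x' + y'); have h4 := mulr_gt0 p0 p0.
  move: h1 h2 h3 h4; rewrite !expr2; set M := `|p|; move: M => M; lra.
have [le|lt] := lerP `|g2| `|g1|.
  have p0 : 0 < `|g1|.
    rewrite normr_gt0; apply: contra g0 => /eqP g10; move: le.
    by rewrite g10 normr0 normr_le0 => /eqP->.
  exists (`|g1| / 4) => [|[a1 a2] [b1 b2] /= h1 h2 h3 h4]; first by rewrite divr_gt0.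
  exact: key h1 h2 h3 h4.
exists (`|g2| / 4) => [|[a1 a2] [b1 b2] /= h1 h2 h3 h4].
  by rewrite divr_gt0 // (le_lt_trans _ lt).
by rewrite addrC; apply: key h2 h1 h4 h3; rewrite ?ltW // (le_lt_trans _ lt).
Qed.

Lemma within_eps (e : R -> R * R) s0 (d : R) : {within `[0, 1], continuous e} -> 0 <= s0 <= 1 -> 0 < d ->
  exists2 k : R, 0 < k & forall s, 0 <= s <= 1 -> `|s - s0| < k ->
    `|(e s).1 - (e s0).1| < d /\ `|(e s).2 - (e s0).2| < d.
Proof.
move=> ce s01 d0; move/subspace_continuousP: ce => /(_ s0) /=; rewrite in_itv /= => /(_ s01) ce.
have := ce (ball (e s0) d) (nbhsx_ballx _ _ d0).
move=> /nbhs_ballP[k /= k0 H]; exists k => // s sI sk.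
have := H s; rewrite /ball /= distrC in_itv /= => /(_ sk sI)[/=].
by rewrite /ball /= !(distrC (_ (e s0))).
Qed.

(** On a fine mesh, neighbouring difference vectors form an acute angle, as [turn] requires.
    Compactness of the square is applied one factor at a time. *)
Lemma arcs_cover (e f : R -> R * R) :
  {within `[0, 1], continuous e} -> {within `[0, 1], continuous f} ->
  (forall s t, 0 <= s <= 1 -> 0 <= t <= 1 -> e s <> f t) ->
  exists N, forall n s s' t t', (N <= n)%N -> 0 <= s <= 1 -> 0 <= s' <= 1 -> 0 <= t <= 1 -> 0 <= t' <= 1 ->
    `|s' - s| <= n.+1%:R^-1 -> `|t' - t| <= n.+1%:R^-1 -> 0 < dot (f t - e s) (f t' - e s').
Proof.
move=> ce cf nef.
have step s0 t0 : 0 <= s0 <= 1 -> 0 <= t0 <= 1 -> exists N, forall n s s' t t',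
    (N <= n)%N -> 0 <= s <= 1 -> 0 <= s' <= 1 -> 0 <= t <= 1 -> 0 <= t' <= 1 ->
    `|s' - s| <= n.+1%:R^-1 -> `|t' - t| <= n.+1%:R^-1 ->
    `|s - s0| < N.+1%:R^-1 -> `|t - t0| < N.+1%:R^-1 -> 0 < dot (f t - e s) (f t' - e s').
  move=> s01 t01; have [|d d0 Hd] := @dot_open (f t0 - e s0).
    by rewrite subr_eq0; apply/eqP => /esym; exact: nef.
  have d2 : 0 < d / 2 by rewrite divr_gt0.
  have [k1 k10 H1] := within_eps ce s01 d2; have [k2 k20 H2] := within_eps cf t01 d2.
  pose k := Num.min k1 k2 / 2; have k0 : 0 < k by rewrite divr_gt0 // lt_min k10.
  have kk1 : k + k <= k1 by rewrite /k -splitr ge_min lexx.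
  have kk2 : k + k <= k2 by rewrite /k -splitr ge_min lexx orbT.
  pose N := Num.truncn k^-1.
  have Nk : N.+1%:R^-1 < k by rewrite invf_plt ?posrE //; exact: truncnS_gt.
  exists N => n s s' t t' Nn sI sI' tI tI' ss tt ss0 tt0.
  have nN : n.+1%:R^-1 <= N.+1%:R^-1 :> R by rewrite lef_pV2 ?posrE ?ler_nat ?ltnS.
  have near (p p' p0 : R) : `|p' - p| <= n.+1%:R^-1 -> `|p - p0| < N.+1%:R^-1 -> `|p - p0| < k + k /\ `|p' - p0| < k + k.
    move=> h1 h2; have h3 := ler_normD (p' - p) (p - p0); rewrite addrA subrK in h3.
    have h4 := lt_trans h2 Nk; have h5 := le_lt_trans (le_trans h1 nN) Nk.
    split; first by apply: lt_trans h4 _; rewrite ltrDl.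
    exact: le_lt_trans h3 (ltrD h5 h4).
  have [ns ns'] := near _ _ _ ss ss0; have [nt nt'] := near _ _ _ tt tt0.
  have [a1 a2] := H1 s sI (lt_le_trans ns kk1); have [b1 b2] := H1 s' sI' (lt_le_trans ns' kk1).
  have [c1 c2] := H2 t tI (lt_le_trans nt kk2); have [d1 d2'] := H2 t' tI' (lt_le_trans nt' kk2).
  have tri (x y x0 y0 : R) : `|x - x0| < d / 2 -> `|y - y0| < d / 2 -> `|(y - x) - (y0 - x0)| < d.
    rewrite !ltr_norml => /andP[h1 h2] /andP[h3 h4]; apply/andP; split; lra.
  by apply: Hd => /=; exact: tri.
pose P n s := forall s' t t', 0 <= s' <= 1 -> 0 <= t <= 1 -> 0 <= t' <= 1 ->
  `|s' - s| <= n.+1%:R^-1 -> `|t' - t| <= n.+1%:R^-1 -> 0 < dot (f t - e s) (f t' - e s').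
have [|N HN] := @unit_cover P.
  move=> s0 s01.
  (* [M] is both the threshold for the mesh and, through 1/(M + 1), the radius in [s], so that the
     covering in [t] yields the two together. *)
  pose Q M t := forall n s s' t', (M <= n)%N -> 0 <= s <= 1 -> 0 <= s' <= 1 -> 0 <= t' <= 1 ->
    `|s' - s| <= n.+1%:R^-1 -> `|t' - t| <= n.+1%:R^-1 ->
    `|s - s0| < M.+1%:R^-1 -> 0 < dot (f t - e s) (f t' - e s').
  have [|M HM] := @unit_cover Q.
    move=> t0 t01; have [N HN] := step s0 t0 s01 t01.
    exists N.+1%:R^-1; first by rewrite invr_gt0.
    exists N => t M tI tt0 NM n s s' t' Mn sI sI' tI' h1 h2 h3.
    apply: (HN n) => //; first exact: leq_trans NM Mn.
    by apply: lt_le_trans h3 _; rewrite lef_pV2 ?posrE ?ler_nat ?ltnS.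
  exists M.+1%:R^-1; first by rewrite invr_gt0.
  exists M => s n sI ss0 Mn s' t t' sI' tI tI' h1 h2.
  exact: (HM M t (leqnn _) tI n).
by exists N => n s s' t t' Nn sI sI' tI tI' h1 h2; exact: (HN n s).
Qed.

(** Half of [grid_turn]: each turning is 2w plus a difference of values of [up], and reversing a
    pair of vertices replaces h by 1 - h, which makes the remaining terms even. What matters is that
    [w u v x] depends only on one edge and one vertex. *)
Lemma drawing_parity (G : sgraph) (p : G -> R * R) c : plane_drawing p c ->
  exists w : G -> G -> G -> int, forall u v x y, edge u v -> edge x y -> uniq [:: u; v; x; y] ->
  let h (k l : G) := (up (p l - p k))%:Z in
  w u v x + w x y v - w x y u - w u v y + h x v - h x u - h y v + h y u = 0.
Proof.
move=> dr; pose T := (G * G * G * G)%type.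
have U01 t : 0 <= t <= 1 -> [\/ t = 0, t = 1 | 0 < t < 1].
  move=> /andP[]; rewrite le_eqVlt => /orP[/eqP<- _|t0]; first by constructor 1.
  by rewrite le_eqVlt => /orP[/eqP->|t1]; [constructor 2|constructor 3; rewrite t0].
have disj u v x y s t : edge u v -> edge x y -> uniq [:: u; v; x; y] ->
    0 <= s <= 1 -> 0 <= t <= 1 -> c u v s <> c x y t.
  move=> uv xy un /U01 s01 /U01 t01.
  move: un; rewrite /= !inE !negb_or => /and4P[/and3P[_ ux uy] /andP[vx vy] _ _].
  have pI := drawing_inj dr.
  have pp (k l : G) : k != l -> p k <> p l by move=> kl /pI e; rewrite e eqxx in kl.
  have pv (k l z : G) r : edge k l -> 0 < r < 1 -> c k l r <> p z.
    by move=> kl r01; apply: (drawing_vertex dr kl); rewrite in_itv.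
  have pv' (k l z : G) r : edge k l -> 0 < r < 1 -> p z <> c k l r by move=> kl r01 /esym; exact: pv.
  case: s01 => [->|->|s01]; case: t01 => [->|->|t01];
    rewrite ?(drawing_start dr uv) ?(drawing_end dr uv) ?(drawing_start dr xy) ?(drawing_end dr xy);
    try by [exact: pp|exact: pv|exact: pv'].
  apply: (drawing_disjoint dr uv xy); rewrite ?in_itv //.
  by rewrite /same_pair negb_or !negb_and ux uy.
(* One mesh for all pairs of edges; otherwise the turning of uv seen from [x] could depend on
   [y]. *)
have [N HN] : exists N : nat, forall u v x y n s s' t t', edge u v -> edge x y -> uniq [:: u; v; x; y] ->
    (N <= n)%N -> 0 <= s <= 1 -> 0 <= s' <= 1 -> 0 <= t <= 1 -> 0 <= t' <= 1 ->
    `|s' - s| <= n.+1%:R^-1 -> `|t' - t| <= n.+1%:R^-1 ->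
    0 < dot (c x y t - c u v s) (c x y t' - c u v s').
  have one (q : T) : exists N, edge q.1.1.1 q.1.1.2 -> edge q.1.2 q.2 ->
      uniq [:: q.1.1.1; q.1.1.2; q.1.2; q.2] -> forall n s s' t t',
      (N <= n)%N -> 0 <= s <= 1 -> 0 <= s' <= 1 -> 0 <= t <= 1 -> 0 <= t' <= 1 ->
      `|s' - s| <= n.+1%:R^-1 -> `|t' - t| <= n.+1%:R^-1 ->
      0 < dot (c q.1.2 q.2 t - c q.1.1.1 q.1.1.2 s) (c q.1.2 q.2 t' - c q.1.1.1 q.1.1.2 s').
    case: q => [[[u v] x] y] /=.
    have [uv|_] := boolP (edge u v); last by exists 0%N.
    have [xy|_] := boolP (edge x y); last by exists 0%N.
    have [un|nun] := boolP (uniq [:: u; v; x; y]); last by exists 0%N => _ _ un; rewrite /= un in nun.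
    have [|N HN] := arcs_cover (drawing_continuous dr uv) (drawing_continuous dr xy).
      by move=> s t; exact: disj.
    by exists N => _ _ _; exact: HN.
  have [N HN] := fin_all_exists one.
  exists (\max_q N q)%N => u v x y n s s' t t' uv xy un Nn.
  by apply: (HN (u, v, x, y) uv xy un); apply: leq_trans Nn; exact: leq_bigmax.
pose z i : R := i%:R / N.+1%:R.
pose e u v i := c u v (z i).
have z01 i : (i <= N.+1)%N -> 0 <= z i <= 1.
  by move=> iN; rewrite divr_ge0 //= ler_pdivrMr // mul1r ler_nat.
have zz i i' : (i <= i' <= i.+1)%N -> `|z i' - z i| <= N.+1%:R^-1.
  move=> /andP[ii' i'i]; rewrite /z -mulrBl -natrB // normrM normr_nat ger0_norm ?invr_ge0 //.
  by rewrite ler_piMl ?invr_ge0 // (ler_nat _ _ 1) leq_subLR addn1.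
have z0 : z 0%N = 0 by rewrite /z mul0r.
have z1 : z N.+1 = 1 by rewrite /z divff.
pose W u v x := \sum_(i < N.+1) turn (e u v i - p x) (e u v i.+1 - p x).
have wP (q : G * G * G) : exists w : int, W q.1.1 q.1.2 q.2 = w *+ 2 +
    (up (e q.1.1 q.1.2 N.+1 - p q.2))%:Z - (up (e q.1.1 q.1.2 0%N - p q.2))%:Z.
  exact: (sum_turn_parity (fun i => e q.1.1 q.1.2 i - p q.2)).
have [w wE] := fin_all_exists wP.
exists (fun u v x => w (u, v, x)) => u v x y uv xy un.
have upn (k l : G) : k != l -> (up (p l - p k))%:Z = 1 - (up (p k - p l))%:Z.
  move=> kl; rewrite -opprB up_opp; first by case: (up _).
  by rewrite subr_eq0 (inj_eq (drawing_inj dr)).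
have prem i i' j j' : (i <= i' <= i.+1)%N -> (j <= j' <= j.+1)%N -> (i' <= N.+1)%N ->
    (j' <= N.+1)%N -> 0 < dot (e x y j - e u v i) (e x y j' - e u v i').
  move=> ii jj iN jN; have iN0 : (i <= N.+1)%N by case/andP: ii => ii _; exact: leq_trans ii iN.
  have jN0 : (j <= N.+1)%N by case/andP: jj => jj _; exact: leq_trans jj jN.
  by apply: (HN u v x y N); rewrite ?z01 ?zz.
have := grid_turn prem.
have e0 (k l : G) : edge k l -> e k l 0%N = p k by move=> kl; rewrite /e z0 (drawing_start dr).
have e1 (k l : G) : edge k l -> e k l N.+1 = p l by move=> kl; rewrite /e z1 (drawing_end dr).
have wE' (k l m : G) := wE (k, l, m); rewrite /= in wE'.
rewrite !e0 // !e1 // -!/(W _ _ _) !wE' !e0 // !e1 //.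
move: un; rewrite /= !inE !negb_or => /and4P[/and3P[_ ux uy] /andP[vx vy] _ _].
rewrite (upn v x) // 1?(upn v y) // (upn u x) // (upn u y) //.
set W1 := w (u, v, x); set W2 := w (x, y, v); set W3 := w (x, y, u); set W4 := w (u, v, y).
set h1 : int := up (p v - p x); set h2 : int := up (p u - p x).
set h3 : int := up (p v - p y); set h4 : int := up (p u - p y).
clearbody W1 W2 W3 W4 h1 h2 h3 h4; clear; lia.
Qed.

End Turning.

Local Close Scope classical_set_scope.

Definition defect (w : nat -> nat -> nat -> int) (h : nat -> nat -> int) u v x y :=
  w u v x + w x y v - w x y u - w u v y + h x v - h x u - h y v + h y u.

(* In the sum over all pairs of disjoint edges, every value of w and h occurs an
   even number of times, but an odd number of the values of h are reversed. *)
Lemma parity_K5 (w : nat -> nat -> nat -> int) (h : nat -> nat -> int) :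
  (forall u v x y, (u < v < 5)%N -> (x < y < 5)%N ->
     uniq [:: u; v; x; y] -> defect w h u v x y = 0) ->
  (forall x v, (x < v < 5)%N -> h v x = 1 - h x v) -> False.
Proof.
move=> rel anti.
have : \sum_(q <- [:: (0, 1, 2, 3); (0, 1, 2, 4); (0, 1, 3, 4); (0, 2, 1, 3); (0, 2, 1, 4); (0, 2, 3, 4); (0, 3, 1, 2); (0, 3, 1, 4); (0, 3, 2, 4); (0, 4, 1, 2); (0, 4, 1, 3); (0, 4, 2, 3); (1, 2, 3, 4); (1, 3, 2, 4); (1, 4, 2, 3)]%N) defect w h q.1.1.1 q.1.1.2 q.1.2 q.2 = 0.
  by rewrite !big_cons big_nil /= !rel.
rewrite !big_cons big_nil /defect /=.
rewrite ?(anti 0%N 1%N isT) ?(anti 0%N 2%N isT) ?(anti 0%N 3%N isT) ?(anti 0%N 4%N isT) ?(anti 1%N 2%N isT) ?(anti 1%N 3%N isT) ?(anti 1%N 4%N isT) ?(anti 2%N 3%N isT) ?(anti 2%N 4%N isT) ?(anti 3%N 4%N isT).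
clear; lia.
Qed.

(** As in K5, an edge uv and a vertex x off it extend to a pair of disjoint edges in exactly two
    ways, so every value of [w] cancels modulo 2. *)
Lemma parity_K33 (w : nat -> nat -> nat -> int) (h : nat -> nat -> int) :
  (forall u v x y, (u < 3 <= v)%N -> (v < 6)%N -> (x < 3 <= y)%N -> (y < 6)%N ->
     uniq [:: u; v; x; y] -> defect w h u v x y = 0) ->
  (forall x v, (x < v < 6)%N -> h v x = 1 - h x v) -> False.
Proof.
move=> rel anti.
have : \sum_(q <- [:: (0, 3, 1, 4); (0, 3, 1, 5); (0, 3, 2, 4); (0, 3, 2, 5); (0, 4, 1, 3); (0, 4, 1, 5); (0, 4, 2, 3); (0, 4, 2, 5); (0, 5, 1, 3); (0, 5, 1, 4); (0, 5, 2, 3); (0, 5, 2, 4); (1, 3, 2, 4); (1, 3, 2, 5); (1, 4, 2, 3); (1, 4, 2, 5); (1, 5, 2, 3); (1, 5, 2, 4)]%N) defect w h q.1.1.1 q.1.1.2 q.1.2 q.2 = 0.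
  by rewrite !big_cons big_nil /= !rel.
rewrite !big_cons big_nil /defect /=.
rewrite ?(anti 0%N 1%N isT) ?(anti 0%N 2%N isT) ?(anti 0%N 3%N isT) ?(anti 0%N 4%N isT) ?(anti 0%N 5%N isT) ?(anti 1%N 2%N isT) ?(anti 1%N 3%N isT) ?(anti 1%N 4%N isT) ?(anti 1%N 5%N isT) ?(anti 2%N 3%N isT) ?(anti 2%N 4%N isT) ?(anti 2%N 5%N isT) ?(anti 3%N 4%N isT) ?(anti 3%N 5%N isT) ?(anti 4%N 5%N isT).
clear; lia.
Qed.

Section Nonplanar.
Variables (R : realType) (G : sgraph) (f : nat -> G) (m : nat).
Hypothesis finj : forall i j, (i < m)%N -> (j < m)%N -> f i = f j -> i = j.

Lemma planar_defect (e : rel nat) : (forall i j, e i j -> [&& (i < m)%N, (j < m)%N & edge (f i) (f j)]) ->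
  planar R G -> exists w h,
    (forall u v x y, e u v -> e x y -> uniq [:: u; v; x; y] -> defect w h u v x y = 0) /\
    (forall x v, (x < v < m)%N -> h v x = 1 - h x v).
Proof.
move=> eE [p [c dr]]; have [w wE] := drawing_parity dr.
exists (fun i j k => w (f i) (f j) (f k)), (fun i j => (up (p (f j) - p (f i)))%:Z); split.
  move=> u v x y /eE/and3P[um vm uv] /eE/and3P[xm ym xy] un.
  apply: wE => //; rewrite -[[:: _; _; _; _]]/(map f [:: u; v; x; y]).
  rewrite map_inj_in_uniq // => i j; rewrite !inE.
  by move=> /or4P[]/eqP-> /or4P[]/eqP->; exact: finj.
move=> x v /andP[xv vm]; rewrite -opprB up_opp; first by case: (up _).
rewrite subr_eq0 (inj_eq (drawing_inj dr)); apply/eqP => /finj xv'.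
have vx : v = x by apply: xv' => //; exact: ltn_trans vm.
by rewrite vx ltnn in xv.
Qed.

Lemma nonplanar_K5 : m = 5%N -> (forall i j, (i < 5)%N -> (j < 5)%N -> i != j -> edge (f i) (f j)) ->
  ~ planar R G.
Proof.
move=> m5 fE /(@planar_defect (fun i j => (i < j < 5)%N)) [i j /andP[ij j5]|w [h [rel anti]]].
  by rewrite m5 j5 (ltn_trans ij j5) fE ?(ltn_trans ij j5) // neq_ltn ij.
by apply: (parity_K5 rel); rewrite -m5.
Qed.

Lemma nonplanar_K33 : m = 6%N -> (forall i j, (i < 3 <= j)%N -> (j < 6)%N -> edge (f i) (f j)) ->
  ~ planar R G.
Proof.
move=> m6 fE /(@planar_defect (fun i j => (i < 3 <= j)%N && (j < 6)%N)) [i j /andP[ij j6]|w [h [rel anti]]].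
  have i6 : (i < 6)%N by case/andP: ij => i3 _; exact: leq_trans i3 _.
  by rewrite m6 j6 i6 fE.
apply: (@parity_K33 w h); last by rewrite -m6.
by move=> u v x y uv v6 xy y6; apply: rel; rewrite ?uv ?xy.
Qed.

End Nonplanar.

Local Close Scope ring_scope.

(** * Characterization of the forbidden minors *)

Lemma minor_free_planar (R : realType) (G : sgraph) :
  minor_free (@edge G) [set: G]%SET -> free_class (planar R) G.
Proof.
move=> fr.
(* A realizer of G + uv serves every graph on the same vertices with fewer edges, hence G as well as
   G + uv. *)
have draw (K : rel G) (Ksym : symmetric K) (Kirr : irreflexive K) u v : u != v ->
    (forall x y, K x y -> add_edge_rel edge u v x y) -> planar R (SGraph Ksym Kirr).
  move=> uv sK; have uT : u \in [set: G]%SET by rewrite finset.in_setT.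
  have vT : v \in [set: G]%SET by rewrite finset.in_setT.
  have [r [j [[sep beat] _]]] := minor_free_cert (@edge_sym G) (@edge_irrefl G) uT vT uv fr.
  apply: (@realizer_planar R (SGraph Ksym Kirr) r) => [x y|x y z xy]; first by apply: sep; rewrite finset.in_setT.
  by apply: beat; rewrite ?finset.in_setT //; exact: sK.
split.
  case: G fr draw => T e es ei fr draw.
  have [/existsP[u /existsP[v uv]]|one] := boolP [exists u : T, exists v, u != v].
    by apply: (draw _ es ei u v uv) => x y xy; rewrite /add_edge_rel [edge x y]xy.
  (* With at most one vertex there is no pair to which the certificate applies, and any orders form
     a realizer. *)
  have eq1 (u v : T) : u != v = false.
    by apply/negbTE; apply: contra one => uv; apply/existsP; exists u; apply/existsP; exists v.
  by apply: (@realizer_planar R (SGraph es ei) (fun _ _ => 0%N)) => /= [u v|u v w _]; rewrite eq1.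
move=> u v uv nuv; apply: (draw _ _ _ u v uv) => x y.
rewrite /add_edge_rel => /orP[->//|/andP[_]].
by rewrite /same_pair => /orP[]/andP[/eqP-> /eqP->]; rewrite !eqxx ?orbT.
Qed.

Lemma not_free_K5_minus (R : realType) (G : sgraph) :
  isomorphic K5_minus G -> ~ free_class (planar R) G.
Proof.
case=> f [g fK gK] fE [_ /(_ (f ord0) (f ord_max))].
rewrite (can_eq fK) fE => /(_ isT isT).
apply: (@nonplanar_K5 R (add_edge (f ord0) (f ord_max)) (fun i => f (inord i : 'I_5)) 5) => // [i j i5 j5 /(can_inj fK)/(congr1 val)|i j i5 j5 ij].
  by rewrite /= !inordK.
have ij' : (inord i : 'I_5) != inord j by apply: contra ij => /eqP/(congr1 val); rewrite /= !inordK // => ->.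
rewrite /edge /= fE (can_eq fK) ij' /same_pair !(can_eq fK) /=.
by rewrite /same_pair orb_andl orNb andbT; apply/orP; left.
Qed.

Lemma not_free_K33_minus (R : realType) (G : sgraph) :
  isomorphic K33_minus G -> ~ free_class (planar R) G.
Proof.
case=> f [g fK gK] fE [_ /(_ (f (inl ord0)) (f (inr ord0)))].
rewrite (can_eq fK) fE => /(_ isT isT).
pose k i : K33_minus := if (i < 3)%N then inl (inord i) else inr (inord (i - 3)).
apply: (@nonplanar_K33 R (add_edge (f (inl ord0)) (f (inr ord0))) (fun i => f (k i)) 6) => // [i j i6 j6 /(can_inj fK)|i j /andP[i3 j3] j6].
  rewrite /k; case: ltnP => i3; case: ltnP => j3 // -[] /(congr1 val); rewrite /= !inordK //; lia.
have fn : f (k i) != f (k j) by rewrite (can_eq fK) /k i3 ltnNge j3.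
rewrite /edge /= fn fE /same_pair !(can_eq fK) /k i3 ltnNge j3 /edge /= /same_pair.
by case: (_ && _).
Qed.

Theorem theorem14 (R : realType) (G : sgraph) :
  forbidden_minor (free_class (planar R)) G <->
  isomorphic G K5_minus \/ isomorphic G K33_minus.
Proof.
(* A graph outside the class contains one of the two graphs, which lie outside the class themselves;
   both directions follow from this. *)
have bad H : ~ free_class (planar R) H -> minor K5_minus H \/ minor K33_minus H.
  move=> nA; have [m33|n33] := pselect (model k33m (@edge H) [set: H]%SET).
    by right; exact: k33m_minor.
  have [m5|n5] := pselect (model k5m (@edge H) [set: H]%SET).
    by left; exact: k5m_minor.
  by case: nA; apply: minor_free_planar.
have refl K : isomorphic K K by exists id => //; exists id.
split=> [[nG min]|iso].
  by case: (bad _ nG) => m; [left|right]; apply: isomorphic_sym; apply: min m;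
    [exact: not_free_K5_minus (refl _)|exact: not_free_K33_minus (refl _)].
split=> [|H nH HG].
  by case: iso => /isomorphic_sym; [exact: not_free_K5_minus|exact: not_free_K33_minus].
by case: iso; [exact: minor_K5_minus (bad _ nH) HG|exact: minor_K33_minus (bad _ nH) HG].
Qed.
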